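(* In the setting described in the context, if $j\in\{1,\dots,m\}$ is such that $u_j>0$ in $D_1$, then $$\Bigl[\frac{u_j}{|\mathbf{u}|}\Bigr]_{C^\lambda(B_{\epsilon_2\epsilon_1r_0}(x_0)\cap\{|\mathbf{u}|>0\})}\le\frac{C_5}{r_0^\lambda}\Bigl(\sum_{i\neq j}\Bigl(\frac{u_i(a_{r_1}(x_0))}{u_j(a_{r_1}(x_0))}\Bigr)^2\Bigr)^{\frac12},\qquad\text{where } C_5=\Bigl(\frac{c_2}{\epsilon_2\epsilon_1}\Bigr)^\lambda C_4.$$
   Context: $\Omega\subset\mathbb{R}^n$ is a bounded domain, $m\ge1$ an integer, $Q:\Omega\to\mathbb{R}$ is measurable with $0<Q_{min}\le Q\le Q_{max}$ a.e. in $\Omega$, and $\mathbf{g}\in H^1(\Omega;\mathbb{R}^m)$ has $g_i\ge0$ a.e. For $\mathbf{v}\in H^1(\Omega;\mathbb{R}^m)$ let $J(\mathbf{v})=\int_\Omega\bigl(|\nabla\mathbf{v}|^2+Q^2\chi_{\{|\mathbf{v}|>0\}}\bigr)dx$, with $|\nabla\mathbf{v}|^2=\sum_i|\nabla v_i|^2$, $|\cdot|$ Euclidean length. $\mathcal{A}=\{\mathbf{v}\in H^1(\Omega;\mathbb{R}^m):\mathbf{v}-\mathbf{g}\in H^1_0(\Omega;\mathbb{R}^m),\ v_i\ge0\text{ a.e. for all }i\}$. $\mathbf{u}\in\mathcal{A}$ is an absolute minimizer if $J(\mathbf{u})\le J(\mathbf{v})$ for all $\mathbf{v}\in\mathcal{A}$;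 it is a local minimizer if there is $\epsilon>0$ such that $J(\mathbf{u})\le J(\mathbf{v})$ for all $\mathbf{v}\in\mathcal{A}$ with $\|\mathbf{u}-\mathbf{v}\|_{H^1(\Omega;\mathbb{R}^m)}+\|\chi_{\{|\mathbf{u}|>0\}}-\chi_{\{|\mathbf{v}|>0\}}\|_{L^1(\Omega)}<\epsilon$. ''Minimizer'' means absolute or local minimizer; minimizers are identified with their continuous representatives. $[\cdot]_{C^\lambda}$ is the Hölder seminorm. Harnack chain: for a domain $D\subset\mathbb{R}^n$, $M>1$, $p,q\in D$, a Harnack chain with parameter $M$ from $p$ to $q$ in $D$ is a finite sequence of balls $B_{r_i}(z_i)\subset D$, $i=1,\dots,\ell$, with $\frac{r_i}{M}<\operatorname{dist}(B_{r_i}(z_i),\partial D)<Mr_i$, the first containing $p$, the last containing $q$, consecutive balls intersecting; $\ell$ is its length. A bounded domain $D$ is non-tangentially accessible with parameters $M>1,\xi>0,0<c<1$ if: (i) for any $x\in\partial D$, $0<r<\xi$ there is $a_r(x)\in D\cap B_r(x)$ with $\operatorname{dist}(a_r(x),\partial D)>\frac rM$; (ii) $|B_r(x)\cap D^c|\ge c|B_r|$ for all $x\in D^c$, $r>0$; (iii) if $\epsilon>0$, $p,q\in D$ have distance $>\epsilon$ from $\partial D$ and $|p-q|<C\epsilon$, there is a Harnack chain with parameter $M$ from $p$ to $q$ whose length depends on $C$ but not on $\epsilon$. Comparison constants: for such $D$ there are $0<\lambda<1$, $0<c_1<1$, $0<c_2<1$, $C_3>1$, $C_4>0$ depending only on $M$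 and $c$ such that for $r<c_1\xi$, $x\in\partial D$ and positive harmonic $v_1,v_2$ in $D$ vanishing continuously on $B_{C_3r}(x)\cap\partial D$: $\frac1{C_4}\frac{v_2(a_r(x))}{v_1(a_r(x))}\le\frac{v_2(y)}{v_1(y)}\le C_4\frac{v_2(a_r(x))}{v_1(a_r(x))}$ for $y\in B_{c_2r}(x)\cap D$, and $\bigl[\frac{v_2}{v_1}\bigr]_{C^\lambda(B_{c_2r}(x)\cap D)}\le\frac{C_4}{r^\lambda}\frac{v_2(a_r(x))}{v_1(a_r(x))}$ (a known comparison principle). Setting: $\mathbf{u}$ is a minimizer, $B_{r_0}(x_0)\subset\Omega$ with $x_0\in\partial\{|\mathbf{u}|>0\}$ ($r_0$ sufficiently small depending on $\mathbf{u}$ if $\mathbf{u}$ is only a local minimizer); $0<\tilde\epsilon_1<\epsilon_1<1$ are such that $D_1=B_{\epsilon_1r_0}(x_0)\cap\{|\mathbf{u}|>0\}$ is a non-tangentially accessible domain with parameters $M>1$, $\xi=\tilde\epsilon_1r_0$, $0<c<1$; $\lambda,c_1,c_2,C_3,C_4$ are comparison constants for $D_1$ and $a_r(x)$ are points as in (i) for $D_1$; $r_1=\min\bigl(\frac12c_1\tilde\epsilon_1,\frac{\epsilon_1}{2C_3}\bigr)r_0$ and $\epsilon_2=\frac{c_2r_1}{\epsilon_1r_0}\in(0,1)$. *)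

(* Defs.v *)
From HB Require Import structures.
From mathcomp Require Import all_boot all_order all_algebra.
From mathcomp Require Import all_classical all_reals all_analysis.

Set Implicit Arguments.
Unset Strict Implicit.
Unset Printing Implicit Defensive.

Import Order.TTheory GRing.Theory Num.Theory.
Import numFieldNormedType.Exports.

Local Open Scope classical_set_scope.
Local Open Scope ring_scope.

(* R^N, N >= 1, is 'rV[R]_n.+1 with N = n.+1.  The library norm on row vectors
   is the max norm; it is used only through its topology (open, closure,
   continuous, derivable, ...) and its bounded sets.  All metric notions below
   are Euclidean. *)
Section Euclidean.
Context {R : realType} {n : nat}.
Implicit Types (x y : 'rV[R]_n) (A B : set 'rV[R]_n).

Definition enorm x : R := Num.sqrt (\sum_(i < n) x 0 i ^+ 2).

Definition eball x (r : R) : set 'rV[R]_n := [set y | enorm (y - x) < r].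

Definition set_dist A B : R := inf [set enorm (x - y) | x in A & y in B].

Definition boundary A : set 'rV[R]_n := closure A `\` interior A.

Definition domain A := [/\ open A, connected A & A !=set0].

Definition holder_seminorm (lambda : R) A (f : 'rV[R]_n -> R) : \bar R :=
  ereal_sup [set (`|f z.1 - f z.2| / (enorm (z.1 - z.2) `^ lambda))%:E |
    z in [set z : 'rV[R]_n * 'rV[R]_n | [/\ A z.1, A z.2 & z.1 != z.2]]].

End Euclidean.

Section Differentiability.
Context {R : realType} {n : nat}.
Implicit Types (D : set 'rV[R]_n) (f : 'rV[R]_n -> R) (s : seq 'I_n).

Definition partial f (i : 'I_n) : 'rV[R]_n -> R := 'D_(delta_mx 0 i) f.

Definition iter_partial f s : 'rV[R]_n -> R := foldr (fun i h => partial h i) f s.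

Definition Ck (k : nat) D f := forall s x, D x -> (size s <= k)%N ->
  {for x, continuous (iter_partial f s)} /\
  ((size s < k)%N ->
    forall i, derivable (iter_partial f s) x (delta_mx 0 i)).

Definition harmonic D f := Ck 2 D f /\
  forall x, D x -> \sum_(i < n) iter_partial f [:: i; i] x = 0.

Definition test_function D f := (forall k, Ck k setT f) /\
  exists K, [/\ compact K, K `<=` D & forall x, ~ K x -> f x = 0].

End Differentiability.

Section Lebesgue.
Context {R : realType} {n : nat}.
Local Notation E := 'rV[R]_n.+1.
Implicit Types (ab : E * E) (A : set E).

Definition box ab : set E :=
  [set x | forall i, ab.1 0 i <= x 0 i < ab.2 0 i].

Definition box_volume ab : \bar R :=
  (\prod_(i < n.+1) Num.max 0 (ab.2 0 i - ab.1 0 i))%:E.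

Definition lebesgue_outer A : \bar R :=
  ereal_inf [set (\sum_(k <oo) box_volume (B k))%E |
    B in [set B : nat -> E * E | A `<=` \bigcup_k box (B k)]].

Lemma box_volume_ge0 ab : (0 <= box_volume ab)%E.
Proof. by rewrite lee_fin; apply: prodr_ge0 => i _; rewrite le_max lexx. Qed.

Local Open Scope ereal_scope.

Lemma lebesgue_outer_ge0 A : 0 <= lebesgue_outer A.
Proof.
apply: le_ereal_inf_tmp => _ [B _ <-].
by apply: nneseries_ge0 => k _ _; exact: box_volume_ge0.
Qed.

Lemma lebesgue_outer0 : lebesgue_outer set0 = 0.
Proof.
apply/eqP; rewrite eq_le lebesgue_outer_ge0 andbT.
apply: ereal_inf_lbound; exists (fun=> (0, 0)%R); first exact: sub0set.
apply: eseries0 => k _ _; rewrite /box_volume /=.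
by rewrite big_ord_recl mxE subrr maxxx mul0r.
Qed.

Lemma le_lebesgue_outer : {homo lebesgue_outer : A B / A `<=` B >-> A <= B}.
Proof.
move=> A B AB; apply: ereal_inf_le_tmp => _ [C BC <-].
by exists C => //; exact: subset_trans BC.
Qed.

Lemma lebesgue_outer_sigma_subadditive : sigma_subadditive lebesgue_outer.
Proof.
move=> A; have [[i ioo]|] := pselect (exists i, lebesgue_outer (A i) = +oo).
  rewrite (eseries_pinfty _ _ ioo) ?leey// => k _.
  by rewrite -ltNye (lt_le_trans _ (lebesgue_outer_ge0 _)).
rewrite -forallNE => Aoo.
suff add2e (e : {posnum R}) : lebesgue_outer (\bigcup_k A k) <=
    \sum_(i <oo) lebesgue_outer (A i) + e%:num%:E.
  by apply/lee_addgt0Pr => _/posnumP[].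
rewrite (le_trans _ (epsilon_trick _ _ _))//; last first.
  by move=> k; exact: lebesgue_outer_ge0.
pose P k (B : nat -> E * E) := A k `<=` \bigcup_l box (B l) /\
  \sum_(l <oo) box_volume (B l) <=
    lebesgue_outer (A k) + (e%:num / (2 ^ k.+1)%:R)%:E.
have [G PG] : {G : nat -> nat -> E * E & forall k, P k (G k)}.
  apply: (@choice _ _ P) => k; rewrite /P /lebesgue_outer.
  set S := (X in ereal_inf X); move infS : (ereal_inf S) => iS.
  case: iS infS => [r Sr|Soo|Soo].
  - have en1 : (0 < e%:num / (2 ^ k.+1)%:R)%R by [].
    have /(lb_ereal_inf_adherent en1) : ereal_inf S \is a fin_num by rewrite Sr.
    move=> [x [B AB muBx] xS].
    by exists B; split => //; rewrite muBx -Sr; exact/ltW.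
  - by have := Aoo k; rewrite /lebesgue_outer Soo.
  - suff : lbound S 0 by move/le_ereal_inf_tmp; rewrite Soo.
    move=> /= _ [B AB <-].
    by apply: nneseries_ge0 => l _ _; exact: box_volume_ge0.
pose vG x := box_volume (G x.1 x.2).
have vG_ge0 x : 0 <= vG x by exact: box_volume_ge0.
apply: (@le_trans _ _ (\esum_(x in setT) vG x)).
  apply: ereal_inf_lbound => /=.
  have /card_esym/ppcard_eqP[f] := card_nat2.
  exists (fun k => G (f k).1 (f k).2).
    move=> t [i _ /(PG i).1 [j _ Bijt]]; exists (f^-1%FUN (i, j)) => //=.
    by rewrite invK ?inE.
  rewrite -(esum_pred_image vG _ xpredT) ?[fun=> _]set_true//.
  by rewrite image_eq.
rewrite (_ : esum _ _ = \sum_(i <oo) \sum_(j <oo) vG (i, j)); last first.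
  pose J : nat -> set (nat * nat) := fun i => [set (i, j) | j in setT].
  rewrite (_ : setT = \bigcup_k J k); last first.
    by rewrite predeqE => -[a b]; split => // _; exists a => //; exists b.
  rewrite esum_bigcupT /=; last 2 first.
    - apply/trivIsetP => i j _ _ ij.
      rewrite predeqE => -[k l] /=; split => //= -[] [_] _ [<-{k} _].
      by move=> [l' _] [] /esym/eqP; rewrite (negbTE ij).
    - by move=> x; exact: vG_ge0.
  rewrite -(image_id [set: nat]) -fun_true esum_pred_image//; last first.
    by move=> k _; exact: esum_ge0.
  apply: eq_eseriesr => /= j _.
  rewrite -(esum_pred_image vG (pair j) predT)//=; last first.
    by move=> ? ? _ _; exact: (@can_inj _ _ _ snd).
  by congr esum; rewrite predeqE => -[a b]; split; move=> [i _ <-]; exists i.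
apply: lee_lim.
- apply: is_cvg_nneseries => k *.
  by apply: nneseries_ge0 => l *; exact: (vG_ge0 (k, l)).
- apply: is_cvg_nneseries => k *; apply: adde_ge0 => //.
  exact: lebesgue_outer_ge0.
- by apply: nearW => k; apply: lee_sum => i _; exact: (PG i).2.
Qed.

HB.instance Definition _ := isOuterMeasure.Build R E lebesgue_outer
  lebesgue_outer0 lebesgue_outer_ge0 le_lebesgue_outer
  lebesgue_outer_sigma_subadditive.

Definition lebesgue_omeasure : {outer_measure set E -> \bar R} :=
  lebesgue_outer.

(* The Caratheodory sigma-algebra is that of all Lebesgue measurable sets, so
   "measurable" below means Lebesgue measurable, not just Borel. *)
Definition lebesgue :
    {measure set (caratheodory_type lebesgue_omeasure) -> \bar R} :=
  (lebesgue_omeasure : set (caratheodory_type lebesgue_omeasure) -> \bar R).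

Definition lmeasurable_fun (A : set E) (f : E -> R) : Prop :=
  measurable_fun (A : set (caratheodory_type lebesgue_omeasure)) f.

End Lebesgue.

Section Sobolev.
Context {R : realType} {n : nat}.
Local Notation E := 'rV[R]_n.+1.
Local Notation mu := (@lebesgue R n).
Implicit Types (Omega : set E) (f : E -> R).

Definition L2 Omega f := lmeasurable_fun Omega f /\
  (\int[mu]_(x in Omega) (f x ^+ 2)%:E < +oo)%E.

Definition weak_partial Omega f (i : 'I_n.+1) (h : E -> R) :=
  forall phi, test_function Omega phi ->
    \int[mu]_(x in Omega) (f x * partial phi i x) =
    - \int[mu]_(x in Omega) (h x * phi x).

Definition H1 Omega f := L2 Omega f /\
  forall i, exists2 h, L2 Omega h & weak_partial Omega f i h.

(* A choice of the i-th weak derivative (unique a.e.) of f in H^1(Omega) *)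
Definition weak_D Omega f (i : 'I_n.+1) : E -> R :=
  xget (fun=> 0) [set h | L2 Omega h /\ weak_partial Omega f i h].

Definition sqr_grad Omega f (x : E) : R :=
  \sum_(i < n.+1) weak_D Omega f i x ^+ 2.

Definition H1_sqnorm Omega f : R :=
  \int[mu]_(x in Omega) (f x ^+ 2 + sqr_grad Omega f x).

(* The closure of the test functions in H^1(Omega) *)
Definition H10 Omega f := H1 Omega f /\
  forall e : R, 0 < e -> exists2 phi, test_function Omega phi &
    Num.sqrt (H1_sqnorm Omega (fun x => f x - phi x)) < e.

End Sobolev.

Section Minimizers.
Context {R : realType} {n m : nat}.
Local Notation E := 'rV[R]_n.+1.
Local Notation mu := (@lebesgue R n).
Implicit Types (Omega : set E) (Q : E -> R) (g u v : E -> 'rV[R]_m).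

Definition comp v (j : 'I_m) : E -> R := fun x => v x 0 j.

Definition H1_vec Omega v := forall j, H1 Omega (comp v j).

Definition H10_vec Omega v := forall j, H10 Omega (comp v j).

Definition H1_norm_vec Omega v : R :=
  Num.sqrt (\sum_(j < m) H1_sqnorm Omega (comp v j)).

Definition nonneg_ae Omega v :=
  forall j, \forall x \ae mu, Omega x -> 0 <= v x 0 j.

(* {|v| > 0} *)
Definition pos_set Omega v : set E := [set x | Omega x /\ 0 < enorm (v x)].

Definition J Omega Q v : \bar R :=
  (\int[mu]_(x in Omega)
    (\sum_(j < m) sqr_grad Omega (comp v j) x +
     Q x ^+ 2 * \1_(pos_set Omega v) x)%:E)%E.

Definition admissible Omega g v :=
  [/\ H1_vec Omega v, H10_vec Omega (fun x => v x - g x) & nonneg_ae Omega v].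

Definition absolute_minimizer Omega Q g u := admissible Omega g u /\
  forall v, admissible Omega g v -> (J Omega Q u <= J Omega Q v)%E.

Definition local_minimizer Omega Q g u := admissible Omega g u /\
  exists2 eps : R, 0 < eps & forall v, admissible Omega g v ->
    H1_norm_vec Omega (fun x => u x - v x) +
      \int[mu]_(x in Omega)
        `|\1_(pos_set Omega u) x - \1_(pos_set Omega v) x| < eps ->
    (J Omega Q u <= J Omega Q v)%E.

End Minimizers.

Section NTA.
Context {R : realType} {n : nat}.
Local Notation E := 'rV[R]_n.+1.
Local Notation mu := (@lebesgue R n).
Implicit Types (D : set E) (p q x y : E) (a : R -> E -> E) (M xi c : R).

Definition harnack_chain D M p q (l : nat) :=
  exists (z : nat -> E) (r : nat -> R),
  [/\ (0 < l)%N,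
      forall i, (i < l)%N ->
        [/\ 0 < r i, eball (z i) (r i) `<=` D,
            r i / M < set_dist (eball (z i) (r i)) (boundary D) &
            set_dist (eball (z i) (r i)) (boundary D) < M * r i],
      eball (z 0%N) (r 0%N) p,
      eball (z l.-1) (r l.-1) q &
      forall i, (i.+1 < l)%N ->
        eball (z i) (r i) `&` eball (z i.+1) (r i.+1) !=set0].

(* a r x is the point a_r(x) *)
Definition corkscrew_points D M xi a :=
  forall x r, boundary D x -> 0 < r < xi ->
    [/\ D (a r x), eball x r (a r x) &
        r / M < set_dist [set a r x] (boundary D)].

Definition nta D M xi c :=
  [/\ [/\ domain D, bounded_set D, 1 < M, 0 < xi & 0 < c < 1],
      exists a, corkscrew_points D M xi a,
      forall x r, ~ D x -> 0 < r ->
        (c%:E * mu (eball x r) <= mu (eball x r `&` ~` D))%E &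
      forall C : R, 0 < C -> exists L : nat, forall (eps : R) p q,
        0 < eps -> D p -> D q ->
        eps < set_dist [set p] (boundary D) ->
        eps < set_dist [set q] (boundary D) ->
        enorm (p - q) < C * eps ->
        exists2 l, (l <= L)%N & harnack_chain D M p q l].

Definition positive_harmonic D (v : E -> R) :=
  harmonic D v /\ forall x, D x -> 0 < v x.

(* v : D -> R tends to 0 at every point of A *)
Definition vanishes_continuously D (A : set E) (v : E -> R) :=
  forall z, A z -> v y @[y --> within D (nbhs z)] --> 0.

Definition comparison_constants D xi a (lambda c1 c2 C3 C4 : R) :=
  [/\ 0 < lambda < 1, 0 < c1 < 1, 0 < c2 < 1, 1 < C3 & 0 < C4] /\
  forall (r : R) x (v1 v2 : E -> R), 0 < r < c1 * xi -> boundary D x ->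
    positive_harmonic D v1 -> positive_harmonic D v2 ->
    vanishes_continuously D (eball x (C3 * r) `&` boundary D) v1 ->
    vanishes_continuously D (eball x (C3 * r) `&` boundary D) v2 ->
    (forall y, (eball x (c2 * r) `&` D) y ->
      1 / C4 * (v2 (a r x) / v1 (a r x)) <= v2 y / v1 y /\
      v2 y / v1 y <= C4 * (v2 (a r x) / v1 (a r x))) /\
    (holder_seminorm lambda (eball x (c2 * r) `&` D) (fun y => (v2 y / v1 y)%R) <=
      (C4 / r `^ lambda * (v2 (a r x) / v1 (a r x)))%:E)%E.

End NTA.

(* Main.v *)
Require Import Defs.
From HB Require Import structures.
From mathcomp Require Import all_boot all_order all_algebra.
From mathcomp Require Import all_classical all_reals all_analysis.
From mathcomp Require Import measurable_realfun ring lra.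

Set Implicit Arguments.
Unset Strict Implicit.
Unset Printing Implicit Defensive.

Import Order.TTheory GRing.Theory Num.Theory.
Import numFieldNormedType.Exports.

Local Open Scope classical_set_scope.
Local Open Scope ring_scope.

(** The quotient u_j / |u| is 1 / sqrt (1 + sum_(i <> j) (u_i / u_j) ^ 2), and
    the function t |-> 1 / sqrt (1 + |t| ^ 2) is 1-Lipschitz
    ([lipschitz_inv_sqrt]); a Hoelder bound for u_j / |u| thus follows from
    Hoelder bounds for the ratios u_i / u_j.  The comparison principle, used with
    v_1 = u_j, v_2 = u_i and r = r_1, bounds the seminorm of u_i / u_j by
    C_4 / r_1 ^ lambda times the value of the ratio at a_(r_1)(x_0), and the
    constants are arranged so that c_2 r_1 = e_2 e_1 r_0 and
    C_4 / r_1 ^ lambda = C_5 / r_0 ^ lambda.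

    What has to be shown is that the principle applies: on the connected open set
    D_1 of {|u| > 0} each u_i is either a positive harmonic function or
    identically zero ([minimizer_dichotomy]), and in the second case the ratio is
    zero.  Outside D_1 but near x_0 all the u_i vanish, so that they tend to zero
    at the boundary because u is continuous.

    For the dichotomy, perturb the minimizer to u + t phi e_j with phi smooth and
    compactly supported in {|u| > 0}, in such a way that the components stay
    nonnegative and the set {|u| > 0} does not change.  Then the term with Q
    cancels, only the Dirichlet energy is compared, and the first variation gives
    that u_j is a super-solution (phi >= 0), and a weak solution of the Laplace
    equation where u_j > 0 (any phi, small t).  Such perturbations are arbitrarily
    close to u, which is why local minimality is enough.

    The facts on the Laplacian rest on one family of radial kernels k_sigma with
    compact support whose derivative in sigma is, up to a positive factor, minus
    the Laplacian of a nonnegative radial cut-off ([is_derive_ker]).  So the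
    average of a super-solution against k_sigma increases with sigma
    ([average_mono]) to a multiple of the value at the centre.  This yields the
    strong minimum principle ([strong_minimum]); for weak solutions the average
    equals that multiple, hence they coincide locally with their own
    mollification and are smooth and harmonic ([weyl]).

    The energy is defined through chosen weak derivatives.  They are compared
    with classical ones by almost everywhere uniqueness ([weak_D_ae]), which is
    the fundamental lemma of the calculus of variations ([fundamental_lemma]) and
    uses the outer regularity of Lebesgue measure ([outer_open]). *)

(** * Euclidean norm and balls *)

Lemma cvg_sumr {R : realType} {T : Type} (F : set_system T) (FF : Filter F)
    {I : Type} (r : seq I) (P : pred I) (f : I -> T -> R) (l : I -> R) :
  (forall i, P i -> f i x @[x --> F] --> l i) ->
  \sum_(i <- r | P i) f i x @[x --> F] --> \sum_(i <- r | P i) l i.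
Proof.
by apply: cvg_big; exact: add_continuous.
Qed.

Section EuclideanNorm.
Context {R : realType} {n : nat}.
Implicit Types (x y z : 'rV[R]_n) (r s : R).

Definition sqnorm x : R := \sum_(i < n) x 0 i ^+ 2.

Lemma sqnorm_ge0 x : 0 <= sqnorm x.
Proof. by apply: sumr_ge0 => i _; exact: sqr_ge0. Qed.

Lemma enorm_ge0 x : 0 <= enorm x.
Proof. exact: sqrtr_ge0. Qed.

Lemma sqr_enorm x : enorm x ^+ 2 = sqnorm x.
Proof. by rewrite sqr_sqrtr // sqnorm_ge0. Qed.

Lemma sqr_coord_le x i : x 0 i ^+ 2 <= sqnorm x.
Proof.
by rewrite /sqnorm (bigD1 i) //= lerDl; apply: sumr_ge0 => j _; exact: sqr_ge0.
Qed.

Lemma sqnorm0 : sqnorm 0 = 0.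
Proof. by apply: big1 => i _; rewrite mxE expr0n. Qed.

Lemma sqnorm_eq0 x : sqnorm x = 0 -> x = 0.
Proof.
move=> x0; apply/rowP => i; rewrite mxE; apply/eqP; rewrite -sqrf_eq0.
by rewrite eq_le sqr_ge0 andbT -x0 sqr_coord_le.
Qed.

Lemma sqnormN x : sqnorm (- x) = sqnorm x.
Proof. by apply: eq_bigr => i _; rewrite mxE sqrrN. Qed.

Lemma enorm_gt0P x : 0 < enorm x <-> x <> 0.
Proof.
rewrite sqrtr_gt0; split => [+ x0|x0]; first by rewrite x0 -/(sqnorm _) sqnorm0 ltxx.
rewrite lt_neqAle sqnorm_ge0 andbT eq_sym; apply/eqP => /sqnorm_eq0; exact: x0.
Qed.

Lemma in_eball x r y : 0 < r -> eball x r y <-> sqnorm (y - x) < r ^+ 2.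
Proof.
move=> r0; rewrite /eball /= -sqr_enorm ltr_pXn2r// nnegrE ?enorm_ge0//.
exact: ltW.
Qed.

Lemma eball_center x r : 0 < r -> eball x r x.
Proof. by move=> r0; rewrite in_eball// subrr sqnorm0 exprn_gt0. Qed.

Lemma subset_eball x r s : r <= s -> eball x r `<=` eball x s.
Proof. by move=> rs y; rewrite /eball /= => /lt_le_trans; exact. Qed.

Lemma sqdist_continuous x : continuous (fun y => sqnorm (y - x)).
Proof.
move=> y; apply: (cvg_sumr (nbhs_filter y)) => i _.
rewrite (_ : (fun z : 'rV[R]_n => (z - x) 0 i ^+ 2) =
             fun z => (z 0 i - x 0 i) ^+ 2); last first.
  by apply/funext => z; rewrite !mxE.
rewrite !mxE; have FF := nbhs_filter y.
have c : (fun z : 'rV[R]_n => z 0 i - x 0 i) @ y --> y 0 i - x 0 i.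
  by apply: (@cvgB _ _ _ _ FF); [exact: coord_continuous|exact: cvg_cst].
exact: (@cvgM _ _ _ FF).
Qed.

Lemma edist_continuous x : continuous (fun y => enorm (y - x)).
Proof.
move=> y; apply: (@continuous_comp _ _ _ (fun y => sqnorm (y - x)) Num.sqrt).
  exact: sqdist_continuous.
exact: sqrt_continuous.
Qed.

Lemma open_eball x r : open (eball x r).
Proof.
rewrite (_ : eball x r = (fun y => enorm (y - x)) @^-1` [set t | t < r])//.
by apply: open_comp; [move=> y _; exact: edist_continuous|exact: open_lt].
Qed.

Definition cball x r : set 'rV[R]_n := [set y | enorm (y - x) <= r].

Lemma closed_cball x r : closed (cball x r).
Proof.
rewrite (_ : cball x r = (fun y => enorm (y - x)) @^-1` [set t | t <= r])//.
by apply: preimage_closed; [move=> y _; exact: edist_continuous|exact: closed_le].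
Qed.

Lemma coord_le_enorm x i : `|x 0 i| <= enorm x.
Proof.
rewrite -(@ler_pXn2r _ 2)// ?nnegrE// ?enorm_ge0//.
by rewrite sqr_enorm real_normK ?num_real// sqr_coord_le.
Qed.

Lemma norm_le_enorm x : `|x| <= enorm x.
Proof.
rewrite /Num.norm /= mx_normrE; apply: bigmax_le; first exact: enorm_ge0.
by move=> [i j] _ /=; rewrite ord1; exact: coord_le_enorm.
Qed.

Lemma bounded_cball x r : bounded_set (cball x r).
Proof.
exists (`|x| + r); split; first exact: num_real.
move=> M xrM y /= yx; apply/ltW/(le_lt_trans _ xrM).
have -> : y = x + (y - x) by rewrite addrC subrK.
by apply: (le_trans (ler_normD _ _)); rewrite lerD2l (le_trans (norm_le_enorm _)).
Qed.

Lemma compact_cball x r : compact (cball x r).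
Proof.
by apply: bounded_closed_compact; [exact: bounded_cball|exact: closed_cball].
Qed.

Lemma eball_sub_cball x r : eball x r `<=` cball x r.
Proof. by move=> y; rewrite /eball/= => /ltW. Qed.

Lemma cball_sub_eball x r s : r < s -> cball x r `<=` eball x s.
Proof. by move=> rs y; rewrite /cball/eball/= => /le_lt_trans; exact. Qed.

Lemma bounded_eball x r : bounded_set (eball x r).
Proof.
have [M [Mr xrM]] := bounded_cball x r; exists M; split => // N MN y.
by move=> /eball_sub_cball; exact: xrM.
Qed.

Lemma open_eballP (U : set 'rV[R]_n) x : open U -> U x ->
  exists2 r : R, 0 < r & eball x r `<=` U.
Proof.
move=> oU Ux; have : nbhs x U by exact: open_nbhs_nbhs.
move=> /nbhs_ballP[e /= e0 xeU].
exists e => // y; rewrite /eball/= => yx; apply: xeU; split => // i j.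
rewrite ord1 /ball /=; apply: le_lt_trans yx.
by rewrite distrC (le_trans _ (coord_le_enorm _ j))// !mxE.
Qed.

Lemma bounded_setP (A : set 'rV[R]_n) : bounded_set A ->
  exists2 M : R, 0 < M & forall x, A x -> forall i, `|x 0 i| < M.
Proof.
move=> [M [Mr AM]]; exists (`|M| + 2); first by rewrite ltr_wpDl.
move=> x Ax i; apply: (@le_lt_trans _ _ (`|M| + 1)); last by rewrite ltrD2l ltr1n.
apply: (le_trans _ (AM (`|M| + 1) _ x Ax)).
  rewrite [leRHS]/Num.norm/= mx_normrE.
  exact: (le_bigmax_cond _ (fun k : 'I_1 * 'I_n => `|x k.1 k.2|) (j:=(0, i))).
by rewrite (le_lt_trans (ler_norm _))// ltrDl.
Qed.

End EuclideanNorm.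

Lemma sum_cauchy_schwarz {R : realType} {I : finType} (P : pred I) (a b : I -> R) :
  (\sum_(i | P i) a i * b i) ^+ 2 <=
  (\sum_(i | P i) a i ^+ 2) * \sum_(i | P i) b i ^+ 2.
Proof.
set A := \sum_(i | P i) a i ^+ 2; set B := \sum_(i | P i) b i ^+ 2.
set C := \sum_(i | P i) a i * b i.
have A0 : 0 <= A by apply: sumr_ge0 => i _; exact: sqr_ge0.
have : 0 <= \sum_(i | P i) (A * b i - C * a i) ^+ 2.
  by apply: sumr_ge0 => i _; exact: sqr_ge0.
have -> : \sum_(i | P i) (A * b i - C * a i) ^+ 2 = A * (A * B - C ^+ 2).
  transitivity (A ^+ 2 * B - 2 * A * C * C + C ^+ 2 * A); last by ring.
  rewrite [X in _ = X - _ + _]mulr_sumr [X in _ = _ - X + _]mulr_sumr.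
  rewrite [X in _ = _ - _ + X]mulr_sumr -sumrN -!big_split /=.
  by apply: eq_bigr => i _; ring.
have [A00 _|A0' AC] := eqVneq A 0; last first.
  by rewrite -subr_ge0 -(pmulr_rge0 _ (_ : 0 < A))// lt_neqAle eq_sym A0'.
have a0 i : P i -> a i = 0.
  move=> Pi; apply/eqP; rewrite -sqrf_eq0; apply/eqP; move: i Pi.
  by apply/psumr_eq0P => // i _; exact: sqr_ge0.
rewrite A00 mul0r le_eqVlt sqrf_eq0 /C big1 ?eqxx// => i Pi.
by rewrite a0// mul0r.
Qed.

Lemma ler_enormD {R : realType} {n : nat} (x y : 'rV[R]_n) :
  enorm (x + y) <= enorm x + enorm y.
Proof.
rewrite -(@ler_pXn2r _ 2)// ?nnegrE ?addr_ge0 ?enorm_ge0//.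
rewrite sqrrD !sqr_enorm.
pose C := \sum_(i < n) x 0 i * y 0 i.
have -> : sqnorm (x + y) = sqnorm x + sqnorm y + 2 * C.
  rewrite /sqnorm /C mulr_sumr -!big_split /=.
  by apply: eq_bigr => i _; rewrite mxE; ring.
have CS : C <= enorm x * enorm y.
  have [C0|/ltW C0] := leP C 0; first by rewrite (le_trans C0)// mulr_ge0// enorm_ge0.
  rewrite -(@ler_pXn2r _ 2)// ?nnegrE ?mulr_ge0 ?enorm_ge0//.
  rewrite exprMn !sqr_enorm; exact: sum_cauchy_schwarz.
by rewrite -mulr_natl; lra.
Qed.

(** With A = sqrt (1 + |s| ^ 2) and B = sqrt (1 + |t| ^ 2) the left-hand side is
    |A - B| / (A B), where A B >= 1; and (A - B) ^ 2 <= |s - t| ^ 2 amounts to the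
    Cauchy-Schwarz inequality 1 + s . t <= A B. *)
Lemma lipschitz_inv_sqrt {R : realType} {I : finType} (P : pred I) (s t : I -> R) :
  `|(Num.sqrt (1 + \sum_(i | P i) s i ^+ 2))^-1 -
    (Num.sqrt (1 + \sum_(i | P i) t i ^+ 2))^-1| <=
  Num.sqrt (\sum_(i | P i) (s i - t i) ^+ 2).
Proof.
set S := \sum_(i | P i) s i ^+ 2; set T := \sum_(i | P i) t i ^+ 2.
have S0 : 0 <= S by apply: sumr_ge0 => i _; exact: sqr_ge0.
have T0 : 0 <= T by apply: sumr_ge0 => i _; exact: sqr_ge0.
set A := Num.sqrt _; set B := Num.sqrt (1 + T).
have A2 : A ^+ 2 = 1 + S by rewrite sqr_sqrtr// addr_ge0.
have B2 : B ^+ 2 = 1 + T by rewrite sqr_sqrtr// addr_ge0.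
have A1 : 1 <= A by rewrite -[leLHS]sqrtr1 ler_wsqrtr// lerDl.
have B1 : 1 <= B by rewrite -[leLHS]sqrtr1 ler_wsqrtr// lerDl.
have [A0 B0] : 0 < A /\ 0 < B by split; exact: lt_le_trans ltr01 _.
pose C := \sum_(i | P i) s i * t i.
have ST : \sum_(i | P i) (s i - t i) ^+ 2 = S + T - 2 * C.
  rewrite /S /T /C mulr_sumr -sumrN -!big_split /=.
  by apply: eq_bigr => i _; ring.
have CAB : 1 + C <= A * B.
  have [C0|/ltW C0] := leP (1 + C) 0; first by rewrite (le_trans C0)// mulr_ge0// ltW.
  rewrite -(@ler_pXn2r _ 2)// ?nnegrE//; last by rewrite mulr_ge0// ltW.
  rewrite exprMn A2 B2.
  have := sum_cauchy_schwarz P s t; rewrite -/S -/T -/C => CS.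
  have : 0 <= S + T - 2 * C by rewrite -ST; apply: sumr_ge0 => i _; exact: sqr_ge0.
  nra.
have -> : A^-1 - B^-1 = (B - A) / (A * B).
  by field; rewrite !gt_eqF.
rewrite normrM normfV [X in _ / X]gtr0_norm ?mulr_gt0//.
rewrite ler_pdivrMr ?mulr_gt0//.
rewrite (@le_trans _ _ (Num.sqrt (\sum_(i | P i) (s i - t i) ^+ 2)))//; last first.
  by rewrite ler_peMr ?sqrtr_ge0//; nra.
rewrite -(@ler_pXn2r _ 2)// ?nnegrE// ?sqrtr_ge0// real_normK ?num_real//.
rewrite sqr_sqrtr; last by apply: sumr_ge0 => i _; exact: sqr_ge0.
rewrite ST.
have -> : (B - A) ^+ 2 = B ^+ 2 + A ^+ 2 - 2 * (A * B) by ring.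
by rewrite A2 B2; lra.
Qed.

(** * Lebesgue measure of open sets *)

Section LebesgueMeasure.
Context {R : realType} {n : nat}.
Local Notation E := 'rV[R]_n.+1.
Local Notation CT := (caratheodory_type (@lebesgue_omeasure R n)).
Local Notation mu := (@lebesgue R n).
Implicit Types (ab : E * E) (A : set E) (x : E).

Definition cut_below (i : 'I_n.+1) (c : R) ab : E * E :=
  (ab.1, \row_j (if j == i then Num.min (ab.2 0 j) c else ab.2 0 j)).

Definition cut_above (i : 'I_n.+1) (c : R) ab : E * E :=
  (\row_j (if j == i then Num.max (ab.1 0 j) c else ab.1 0 j), ab.2).

Lemma box_volume_cut i c ab :
  (box_volume (cut_below i c ab) + box_volume (cut_above i c ab) =
   box_volume ab)%E.
Proof.
rewrite /box_volume -EFinD; congr EFin.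
rewrite (bigD1 i) //= [X in _ + X](bigD1 i) //= [RHS](bigD1 i) //= !mxE eqxx.
set P := \prod_(j < n.+1 | j != i) Num.max 0 (ab.2 0 j - ab.1 0 j).
have -> : \prod_(j < n.+1 | j != i) Num.max 0 ((cut_below i c ab).2 0 j -
    (cut_below i c ab).1 0 j) = P.
  by apply: eq_bigr => j /negbTE ji; rewrite !mxE ji.
have -> : \prod_(j < n.+1 | j != i) Num.max 0 ((cut_above i c ab).2 0 j -
    (cut_above i c ab).1 0 j) = P.
  by apply: eq_bigr => j /negbTE ji; rewrite !mxE ji.
rewrite -mulrDl; congr (_ * _).
move: (ab.1 0 i) (ab.2 0 i) => a b; rewrite !minEle !maxEle.
case: (leP b c) => bc; case: (leP a c) => ac;
  by do ![case: ifPn; rewrite -?ltNge => ?]; lra.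
Qed.

Lemma box_cut_below i c ab :
  box ab `&` [set x | x 0 i < c] `<=` box (cut_below i c ab).
Proof.
move=> x [/= xab xc] j; rewrite /= mxE; have /andP[-> /= xb] := xab j.
by case: eqP => // ->; rewrite lt_min xc andbT; have /andP[] := xab i.
Qed.

Lemma box_cut_above i c ab :
  box ab `&` ~` [set x | x 0 i < c] `<=` box (cut_above i c ab).
Proof.
move=> x [/= xab /negP]; rewrite -leNgt => xc j.
rewrite /= mxE; have /andP[ax -> /=] := xab j; rewrite andbT.
by case: eqP => // ->; rewrite ge_max xc andbT; have /andP[] := xab i.
Qed.

(** Cutting every box of a cover along the hyperplane preserves the total volume,
    which gives the criterion of Caratheodory. *)
Lemma measurable_halfspace i c : measurable ([set x | x 0 i < c] : set CT).
Proof.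
apply: (@le_caratheodory_measurable R E lebesgue_omeasure) => X.
pose H : set E := [set x | x 0 i < c].
change (lebesgue_outer (X `&` H) + lebesgue_outer (X `&` ~` H) <=
  lebesgue_outer X)%E.
apply: le_ereal_inf_tmp => _ [B XB <-].
apply: (@le_trans _ _ (\sum_(k <oo) box_volume (cut_below i c (B k)) +
    \sum_(k <oo) box_volume (cut_above i c (B k)))%E).
  apply: leeD; apply: ereal_inf_lbound.
    exists (fun k => cut_below i c (B k)) => // x [Xx xc].
    by have [k _ Bx] := XB _ Xx; exists k => //; exact: box_cut_below.
  exists (fun k => cut_above i c (B k)) => // x [Xx xc].
  by have [k _ Bx] := XB _ Xx; exists k => //; exact: box_cut_above.
rewrite -nneseriesD; [|by move=> *; exact: box_volume_ge0..].
by under eq_eseriesr do rewrite box_volume_cut.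
Qed.

Lemma measurable_coord (i : 'I_n.+1) : measurable_fun (setT : set CT) (fun x => (x : E) 0 i).
Proof.
apply: (measurability _ (RGenInftyO.measurableE R)) => /= _ [_ [c ->] <-].
rewrite setTI; have := measurable_halfspace i c.
by congr (measurable _); apply/seteqP; split => x /=; rewrite in_itv.
Qed.

Lemma measurable_edist x :
  measurable_fun (setT : set CT) (fun y => enorm ((y : E) - x)).
Proof.
apply: measurableT_comp; first exact: continuous_measurable_fun (@sqrt_continuous R).
apply: measurable_sum => i.
under eq_fun do rewrite !mxE.
apply: measurable_funX; apply: measurable_funB.
  exact: measurable_coord.
exact: measurable_cst.
Qed.

Lemma measurable_eball x r : measurable (eball x r : set CT).
Proof.
rewrite (_ : eball x r = setT `&` (fun y => enorm (y - x)) @^-1` `]-oo, r[%classic).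
  by apply: measurable_edist => //; exact: measurable_itv.
by rewrite setTI; apply/seteqP; split => y /=; rewrite in_itv.
Qed.

(** The balls have rational centres and radii 1 / N; one that does not fit in A
    gets the radius -1, which makes it empty. *)
Lemma open_bigcup_eball A : open A -> exists (c : nat -> E) (r : nat -> R),
  (forall k, cball (c k) (r k) `<=` A) /\ A = \bigcup_k eball (c k) (r k).
Proof.
move=> oA.
pose ctr (q : 'rV[rat]_n.+1) : E := \row_i ratr (q 0 i).
pose good (p : 'rV[rat]_n.+1 * nat) := cball (ctr p.1) p.2.+1%:R^-1 `<=` A.
pose rad p : R := if `[< good p >] then p.2.+1%:R^-1 else -1.
pose C k : E := if @unpickle ('rV[rat]_n.+1 * nat)%type k is Some p then ctr p.1 else 0.
pose r k : R := if @unpickle ('rV[rat]_n.+1 * nat)%type k is Some p then rad p else -1.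
have noball (z : E) (y : E) : ~ (enorm (y - z) <= -1).
  by move=> /(le_trans (enorm_ge0 _)); rewrite ler0N1.
have CA k : cball (C k) (r k) `<=` A.
  rewrite /C /r; case: unpickle => [p|]; last by move=> y /noball.
  by rewrite /rad; case: asboolP => [|_ y /noball].
exists C, r; split => //.
apply/seteqP; split => [x Ax|x [k _] /eball_sub_cball]; last exact: CA.
have [e e0 xeA] := open_eballP oA Ax.
have e20 : 0 < e / 2 by rewrite divr_gt0.
have [N _ /(_ N (leqnn N)) /= Ne] := near_infty_natSinv_lt (PosNum e20).
pose d := N.+1%:R^-1 / n.+1%:R : R.
have d0 : 0 < d by rewrite divr_gt0.
have /choice[q qx] : forall i, exists q : rat, `|x 0 i - ratr q| < d.
  move=> i; have : x 0 i - d < x 0 i + d by lra.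
  move=> /rat_in_itvoo[q]; rewrite in_itv /= => /andP[q1 q2].
  by exists q; rewrite ltr_norml; lra.
pose qv : 'rV[rat]_n.+1 := \row_i q i.
have xq : enorm (x - ctr qv) < N.+1%:R^-1.
  apply/in_eball; first by rewrite invr_gt0.
  apply: (@lt_le_trans _ _ (\sum_(i < n.+1) d ^+ 2)).
    apply: ltr_sum => [|i _]; first by apply/hasP; exists ord0; rewrite ?mem_index_enum.
    rewrite !mxE -real_normK ?num_real// ltr_pXn2r ?nnegrE//; exact: ltW.
  have -> : N.+1%:R^-1 = d * n.+1%:R by rewrite /d divfK// pnatr_eq0.
  rewrite sumr_const card_ord -[leLHS]mulr_natr [leRHS]exprMn; apply: ler_wpM2l.
    exact: sqr_ge0.
  by rewrite expr2 ler_peMl// ler1n.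
have gq : good (qv, N).
  move=> y /= yq; apply: xeA; rewrite /eball /=.
  rewrite (_ : y - x = (y - ctr qv) + (ctr qv - x)); last by rewrite addrA subrK.
  apply: (le_lt_trans (ler_enormD _ _)).
  have -> : enorm (ctr qv - x) = enorm (x - ctr qv).
    by rewrite -opprB /enorm -!/(sqnorm _) sqnormN.
  rewrite [ltRHS]splitr; apply: ltrD; last exact: lt_trans xq Ne.
  exact: le_lt_trans yq Ne.
exists (pickle (qv, N)) => //; rewrite /C /r pickleK /=.
by rewrite /rad asboolT.
Qed.

Lemma open_lmeasurable A : open A -> measurable (A : set CT).
Proof.
move=> /open_bigcup_eball[c [r [_ ->]]].
by apply: bigcup_measurable => k _; exact: measurable_eball.
Qed.

Lemma closed_lmeasurable A : closed A -> measurable (A : set CT).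
Proof.
move=> cA; rewrite -(setCK A).
by apply: (@measurableC _ CT); apply: open_lmeasurable; exact: closed_openC.
Qed.

Lemma continuous_lmeasurable A (f : E -> R) : open A ->
  (forall x, A x -> {for x, continuous f}) ->
  measurable_fun (A : set CT) f.
Proof.
move=> oA fA; apply: (measurability _ (RGenOpens.measurableE R)) => /=.
move=> _ [_ [a [b ->]] <-]; apply: open_lmeasurable.
rewrite openE => x [Ax fx].
have nA : nbhs x A by exact: open_nbhs_nbhs.
have nf : nbhs x (f @^-1` `]a, b[%classic).
  by apply: (fA x Ax); apply: open_nbhs_nbhs; split => //; exact: interval_open.
exact: filterI.
Qed.

Lemma cvg_prod_shift {N : nat} (l : 'I_N -> R) :
  \prod_i (l i + d) @[d --> (0 : R)] --> \prod_i l i.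
Proof.
have FF := @nbhs_filter R^o 0.
elim: N l => [|N IH] l.
  rewrite big_ord0 (_ : (fun=> _) = fun=> 1); first exact: cvg_cst.
  by apply/funext => d; rewrite big_ord0.
rewrite big_ord_recl (_ : (fun d => _) =
    fun d => (l ord0 + d) * \prod_i (l (lift ord0 i) + d)); last first.
  by apply/funext => d; rewrite big_ord_recl.
apply: cvgM; last exact: IH.
rewrite -[X in _ --> X]addr0; apply: cvgD; first exact: cvg_cst.
exact: cvg_id.
Qed.

(** Half-open boxes fit in slightly larger open ones; compactness and outer
    regularity need open covers. *)
Definition obox ab : set E := [set x | forall i, ab.1 0 i < x 0 i < ab.2 0 i].

Lemma open_obox ab : open (obox ab).
Proof.
rewrite openE => x xab.
exists (fun _ j => `]ab.1 0 j, ab.2 0 j[%classic) => [k j|y /= yab j].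
  apply: open_nbhs_nbhs; split; first exact: interval_open.
  by rewrite ord1 /= in_itv /=; exact: xab.
by have := yab 0 j; rewrite in_itv.
Qed.

Lemma box_in_obox ab (e : R) : 0 < e -> exists2 ab', box ab `<=` obox ab' &
  (box_volume ab' <= box_volume ab + e%:E)%E.
Proof.
move=> e0; pose l i : R := Num.max 0 (ab.2 0 i - ab.1 0 i).
have /cvgrPdist_lt /(_ _ e0) := @cvg_prod_shift _ l.
move=> /nbhs_ballP[d /= d0 /(_ (d / 2))]; rewrite /ball /= sub0r normrN.
rewrite gtr0_norm ?divr_gt0// ltr_pdivrMr// ltr_pMr// ltr1n => /(_ isT) le.
exists (\row_i (ab.1 0 i - d / 2), ab.2) => [x xab i|].
  by rewrite /= mxE; have /andP[ax ->] := xab i; rewrite andbT; lra.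
rewrite /box_volume -EFinD lee_fin /=.
apply: (@le_trans _ _ (\prod_i (l i + d / 2))); last first.
  by move: le; rewrite ltr_norml -/l => /andP[+ _]; rewrite /l; lra.
apply: ler_prod => i _; rewrite mxE le_max lexx /=.
rewrite /l ge_max; apply/andP; split.
  by rewrite addr_ge0 ?divr_ge0 ?(ltW d0)// le_max lexx.
have : ab.2 0 i - ab.1 0 i <= Num.max 0 (ab.2 0 i - ab.1 0 i).
  by rewrite le_max lexx orbT.
by lra.
Qed.

Lemma outer_open_boxes A (e : R) : 0 < e -> (lebesgue_outer A < +oo)%E ->
  exists2 B : nat -> E * E, A `<=` \bigcup_k obox (B k) &
    (\sum_(k <oo) box_volume (B k) <= lebesgue_outer A + e%:E)%E.
Proof.
move=> e0 Aoo.
have e20 : 0 < e / 2 by rewrite divr_gt0.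
have fA : lebesgue_outer A \is a fin_num by rewrite ge0_fin_numE// lebesgue_outer_ge0.
have [_ [B AB <-] Be] := lb_ereal_inf_adherent e20 fA.
have /choice[C BC] : forall k, exists ab, box (B k) `<=` obox ab /\
    (box_volume ab <= box_volume (B k) + (e / 2 / (2 ^ k.+1)%:R)%:E)%E.
  move=> k; have [|ab] := @box_in_obox (B k) (e / 2 / (2 ^ k.+1)%:R).
    by rewrite divr_gt0// ltr0n expn_gt0.
  by exists ab.
exists C => [x /AB[k _ /(BC k).1]|]; first by exists k.
apply: (@le_trans _ _ (\sum_(k <oo) (box_volume (B k) +
    (e / 2 / (2 ^ k.+1)%:R)%:E))%E).
  apply: lee_nneseries => [k _ _|k _]; [exact: box_volume_ge0|exact: (BC k).2].
apply: le_trans.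
  by apply: epsilon_trick; [move=> k; exact: box_volume_ge0|exact: ltW].
rewrite [in leRHS](splitr e) EFinD addeA leeD2r//.
exact: ltW.
Qed.

Lemma lebesgue_outer_box ab : (lebesgue_outer (box ab) <= box_volume ab)%E.
Proof.
pose B k := if k is 0%N then ab else (0, 0) : E * E.
apply: ereal_inf_lbound; exists B; first by move=> x xab; exists 0%N.
rewrite (nneseries_split 0 1); last by move=> k _; exact: box_volume_ge0.
rewrite add0n big_nat1 eseries0 ?adde0// => -[//|k] _ _.
by rewrite /box_volume /= big_ord_recl mxE subrr maxxx mul0r.
Qed.

Lemma bounded_outer_fin A : bounded_set A -> (lebesgue_outer A < +oo)%E.
Proof.
move=> /bounded_setP[M M0 AM].
pose ab : E * E := (const_mx (- M), const_mx M).
apply: (@le_lt_trans _ _ (box_volume ab)); last exact: ltry.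
apply: le_trans (lebesgue_outer_box ab); apply: le_lebesgue_outer => x Ax i.
rewrite !mxE; have := AM x Ax i.
by rewrite ltr_norml => /andP[/ltW -> ->].
Qed.

(** Outer regularity: take the union of a nearly optimal cover by open boxes. *)
Lemma outer_open A (e : R) : 0 < e -> (lebesgue_outer A < +oo)%E ->
  exists G : set E, [/\ open G, A `<=` G &
    (lebesgue_outer G <= lebesgue_outer A + e%:E)%E].
Proof.
move=> e0 /(outer_open_boxes e0)[B AB Be].
exists (\bigcup_k obox (B k)); split => //.
  by apply: bigcup_open => k _; exact: open_obox.
apply: le_trans Be; apply: (@le_trans _ _ (\sum_(k <oo) lebesgue_outer (box (B k)))%E).
  apply: (@le_trans _ _ (lebesgue_outer (\bigcup_k box (B k)))).
    apply: le_lebesgue_outer => x [k _ xk]; exists k => // i.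
    by have /andP[/ltW -> ->] := xk i.
  exact: lebesgue_outer_sigma_subadditive.
apply: lee_nneseries => [k _ _|k _]; first exact: lebesgue_outer_ge0.
exact: lebesgue_outer_box.
Qed.

Lemma count_interval (s t : R) (K : nat) :
  \sum_(k < K) ((s <= k%:R) && (k%:R < t))%:R <= Num.max 0 (t - s) + 1.
Proof.
set S := fun K => \sum_(k < K) ((s <= k%:R) && (k%:R < t))%:R : R.
rewrite -[leLHS]/(S K).
suff [->|[_]] : S K = 0 \/ S K <= K%:R - s /\ S K < t - s + 1.
- by rewrite addr_ge0 ?le_max ?lexx.
- move=> /ltW /le_trans; apply; by rewrite lerD2r le_max lexx orbT.
(* The first bound, in terms of K, is what keeps the second one true when the
   count grows. *)
elim: K => [|K IH]; first by left; rewrite /S big_ord0.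
rewrite /S big_ord_recr /= -/(S K).
have K1 : K.+1%:R = K%:R + 1 :> R by rewrite -natr1.
case: (leP s K%:R) => sK /=; last by case: IH => [->|[? ?]]; [left|right]; rewrite ?addr0// K1; split; lra.
case: (ltP K%:R t) => Kt /=; last first.
  by case: IH => [->|[? ?]]; [left|right]; rewrite ?addr0// K1; split; lra.
by right; rewrite K1; case: IH => [->|[? ?]]; split; lra.
Qed.

(** The lattice of mesh d / K has K ^ (n + 1) points in the cube, and a box contains
    at most the product of its side lengths, each increased by one mesh, times
    (K / d) ^ (n + 1) of them; let K tend to infinity. *)
Lemma cube_cover_volume (a : E) (d : R) (M : nat) (B : nat -> E * E) : 0 < d ->
  (forall x, (forall i, a 0 i <= x 0 i <= a 0 i + d) ->
    exists2 k, (k < M)%N & box (B k) x) ->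
  d ^+ n.+1 <=
    \sum_(k < M) \prod_(i < n.+1) Num.max 0 ((B k).2 0 i - (B k).1 0 i).
Proof.
move=> d0 cov; pose l k i : R := Num.max 0 ((B k).2 0 i - (B k).1 0 i).
have lat K : d ^+ n.+1 <= \sum_(k < M) \prod_(i < n.+1) (l k i + d / K.+1%:R).
  have K0 : 0 < K.+1%:R :> R by [].
  pose pt (f : {ffun 'I_n.+1 -> 'I_K.+1}) : E :=
    \row_i (a 0 i + d * (f i)%:R / K.+1%:R).
  pose hit k i (j : 'I_K.+1) : R :=
    (((B k).1 0 i <= a 0 i + d * j%:R / K.+1%:R) &&
     (a 0 i + d * j%:R / K.+1%:R < (B k).2 0 i))%:R.
  have hit0 k i j : 0 <= hit k i j by rewrite /hit ler0n.
  have count : K.+1%:R ^+ n.+1 <=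
      \sum_(k < M) \prod_(i < n.+1) \sum_(j < K.+1) hit k i j.
    under eq_bigr do rewrite bigA_distr_bigA /=.
    rewrite exchange_big /=.
    have -> : K.+1%:R ^+ n.+1 =
        \sum_(f : {ffun 'I_n.+1 -> 'I_K.+1}) (1 : R).
      by rewrite sumr_const card_ffun !card_ord natrX.
    apply: ler_sum => f _.
    have [i|k kM ptk] := cov (pt f).
      rewrite mxE lerDl divr_ge0 ?mulr_ge0 ?(ltW d0)//= lerD2l.
      rewrite ler_pdivrMr// ler_pM2l// ler_nat; exact: ltnW (ltn_ord _).
    rewrite (bigD1 (Ordinal kM)) //= -[leLHS]addr0; apply: lerD; last first.
      by apply: sumr_ge0 => k' _; apply: prodr_ge0.
    rewrite big1// => i _; have := ptk i; rewrite mxE /hit /= => ->.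
    by [].
  have {count} count : K.+1%:R ^+ n.+1 <=
      (K.+1%:R / d) ^+ n.+1 * \sum_(k < M) \prod_(i < n.+1) (l k i + d / K.+1%:R).
    apply: (le_trans count); rewrite mulr_sumr; apply: ler_sum => k _.
    have -> : (K.+1%:R / d) ^+ n.+1 = \prod_(i < n.+1) (K.+1%:R / d : R).
      by rewrite prodr_const card_ord.
    rewrite -big_split /=; apply: ler_prod => i _.
    apply/andP; split; first exact: sumr_ge0.
    pose s := ((B k).1 0 i - a 0 i) * (K.+1%:R / d).
    pose t := ((B k).2 0 i - a 0 i) * (K.+1%:R / d).
    have Kd : 0 < K.+1%:R / d by rewrite divr_gt0.
    have ts : Num.max 0 (t - s) + 1 = K.+1%:R / d * (l k i + d / K.+1%:R).
      rewrite mulrDr [K.+1%:R / d * (d / _)]mulrA divfK ?gt_eqF// divff ?gt_eqF//.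
      congr (_ + 1); rewrite /l maxr_pMr ?(ltW Kd)// mulr0; congr (Num.max 0 _).
      by rewrite /t /s; ring.
    rewrite -ts; apply: le_trans (count_interval s t K.+1).
    apply: ler_sum => j _; rewrite le_eqVlt; apply/orP; left; apply/eqP.
    rewrite /hit; congr ((_ && _)%:R).
      rewrite /s -lerBlDl -ler_pdivlMr//; congr (_ <= _).
      by rewrite invf_div; ring.
    rewrite /t -ltrBrDl -ltr_pdivrMr//; congr (_ < _).
    by rewrite invf_div; ring.
  move: count; rewrite exprMn exprVn -mulrA ler_pMr ?exprn_gt0// mulrC.
  by rewrite ler_pdivlMr ?exprn_gt0// mul1r.
rewrite leNgt; apply/negP => lt.
have e0 : 0 < d ^+ n.+1 - \sum_(k < M) \prod_(i < n.+1) l k i by rewrite subr_gt0.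
have /cvgrPdist_lt /(_ _ e0) : \sum_(k < M) \prod_(i < n.+1) (l k i + e)
    @[e --> (0 : R)] --> \sum_(k < M) \prod_(i < n.+1) l k i.
  apply: (cvg_sumr (@nbhs_filter R^o 0)) => k _; exact: cvg_prod_shift.
move=> /nbhs_ballP[e /= e1 He].
have ed0 : 0 < e / d by rewrite divr_gt0.
have [N _ /(_ N (leqnn N)) /= Ne] := near_infty_natSinv_lt (PosNum ed0).
have /He : ball (0 : R) e (d / N.+1%:R).
  rewrite /ball /= sub0r normrN gtr0_norm ?divr_gt0//.
  by rewrite mulrC -ltr_pdivlMr.
rewrite /= ltr_norml => /andP[+ _]; have := lat N.
by lra.
Qed.

(** The outer measure is an infimum over countable covers; compactness of a cube
    inside A reduces them to finite ones, for which volumes can be compared. *)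
Lemma open_gt0 A : open A -> A !=set0 -> (0 < lebesgue_outer A)%E.
Proof.
move=> oA [a Aa]; have /nbhs_ballP[e /= e0 aeA] : nbhs a A by exact: open_nbhs_nbhs.
pose d := e / 2; have d0 : 0 < d by rewrite divr_gt0.
pose Q : set E := [set x | forall i, `[a 0 i, a 0 i + d]%classic (x 0 i)].
have cQ : compact Q.
  apply: (@rV_compact _ _ (fun i => `[a 0 i, a 0 i + d]%classic)) => i.
  exact: segment_compact.
have QA : Q `<=` A.
  move=> x Qx; apply: aeA; split => // i j; rewrite ord1 /ball /=.
  have := Qx j; rewrite /= in_itv /= /d => /andP[? ?].
  by rewrite ltr_norml; apply/andP; split; lra.
rewrite lt_neqAle lebesgue_outer_ge0 andbT; apply/eqP => A0.
pose v := d ^+ n.+1 / 2; have v0 : 0 < v by rewrite divr_gt0// exprn_gt0.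
have [|B AB Bv] := outer_open_boxes v0 (A := A); first by rewrite -A0 ltry.
have : cover_compact Q by rewrite -compact_cover.
move=> /(_ nat setT (fun k => obox (B k))).
case=> [k _|x /QA/AB[k _ xk]|F _ QF]; [exact: open_obox|by exists k|].
pose M := (\max_(k <- finmap.enum_fset F) k).+1.
have := @cube_cover_volume a d M B d0.
rewrite leNgt => /(_ _)/negP; apply; last first.
  rewrite -lte_fin; apply: (@le_lt_trans _ _ v%:E); last first.
    by rewrite lte_fin /v ltr_pdivrMr// ltr_pMr ?exprn_gt0// ltr1n.
  rewrite -A0 add0e in Bv; apply: le_trans Bv; rewrite -sumEFin.
  rewrite -(big_mkord xpredT (fun k => box_volume (B k))).
  by apply: nneseries_lim_ge => k _ _; exact: box_volume_ge0.
move=> x ax; have [|k /= kF xk] := QF x.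
  by move=> i; rewrite /= in_itv /=; exact: ax.
exists k; first by rewrite ltnS; apply: leq_bigmax_seq.
by move=> i; have /andP[/ltW -> ->] := xk i.
Qed.

Definition translate (v : E) A : set E := [set x | A (x + v)].

Lemma lebesgue_outer_shift_le A v :
  (lebesgue_outer (translate v A) <= lebesgue_outer A)%E.
Proof.
apply: le_ereal_inf_tmp => _ [B AB <-]; apply: ereal_inf_lbound.
exists (fun k => ((B k).1 - v, (B k).2 - v)) => [x /AB[k _ Bk]|].
  exists k => // i; have := Bk i; rewrite /= !mxE.
  by rewrite lerBlDr ltrBrDr.
apply: eq_eseriesr => k _; rewrite /box_volume /=; congr EFin.
by apply: eq_bigr => i _; rewrite !mxE opprB addrA subrK.
Qed.

Lemma lebesgue_outer_shift A v :
  lebesgue_outer (translate v A) = lebesgue_outer A.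
Proof.
apply/eqP; rewrite eq_le lebesgue_outer_shift_le /=.
apply: le_trans (lebesgue_outer_shift_le (translate v A) (- v)).
by apply: le_lebesgue_outer => x Ax; rewrite /translate /= subrK.
Qed.

Lemma measurable_shift v : measurable_fun (setT : set CT)
  (fun x : CT => ((x : E) + v) : CT).
Proof.
move=> _ A mA; rewrite setTI; apply: (@le_caratheodory_measurable R E lebesgue_omeasure) => X.
pose X' : set E := translate (- v) X.
have := mA X'; pose A' : set E := translate v A.
change (lebesgue_outer X' = lebesgue_outer (X' `&` A) +
  lebesgue_outer (X' `&` ~` A) ->
  lebesgue_outer (X `&` A') + lebesgue_outer (X `&` ~` A') <=
  lebesgue_outer X)%E.
rewrite -(lebesgue_outer_shift (X' `&` A) v).
rewrite -(lebesgue_outer_shift (X' `&` ~` A) v) -(lebesgue_outer_shift X' v).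
have -> : translate v X' = X.
  by apply/seteqP; split => x; rewrite /X' /translate /= addrK.
have -> : translate v (X' `&` A) = X `&` A'.
  by apply/seteqP; split => x; rewrite /X' /A' /translate /= addrK.
have -> : translate v (X' `&` ~` A) = X `&` ~` A'.
  by apply/seteqP; split => x; rewrite /X' /A' /translate /= addrK.
by move=> ->.
Qed.

Local Notation integ D f := (mu.-integrable (D : set CT) (EFin \o f)).

Lemma Rintegral_shift (f : E -> R) v : integ setT f ->
  \int[mu]_x f ((x : E) + v) = \int[mu]_x f x.
Proof.
move=> intf.
have mf : measurable_fun (setT : set CT) (EFin \o f) by exact: measurable_int intf.
pose s := (fun x : CT => ((x : E) + v) : CT).
have ms : measurable_fun setT s := measurable_shift v.
congr fine.
have key (h : CT -> \bar R) : measurable_fun setT h -> (forall x, 0 <= h x)%E ->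
    (\int[mu]_x h (s x) = \int[mu]_x h x)%E.
  move=> mh h0; rewrite -[LHS](ge0_integral_pushforward ms mu measurableT mh)//.
  by apply: eq_measure_integral => A mA AT; exact: lebesgue_outer_shift.
rewrite integralE [RHS]integralE; congr (_ - _)%E.
  have <- := key _ (measurable_funepos mf) (@funepos_ge0 _ _ _).
  by apply: eq_integral => x _; rewrite !funeposE.
have <- := key _ (measurable_funeneg mf) (@funeneg_ge0 _ _ _).
by apply: eq_integral => x _; rewrite !funenegE.
Qed.

Lemma integ_bounded D (f : E -> R) (C : R) : measurable (D : set CT) ->
  (lebesgue_outer D < +oo)%E -> measurable_fun (D : set CT) f ->
  (forall x, D x -> `|f x| <= C) -> integ D f.
Proof.
move=> mD Doo mf fC; apply: measurable_bounded_integrable => //.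
exists C; split; first exact: num_real.
by move=> M CM x Dx /=; rewrite (le_trans (fC x Dx))// ltW.
Qed.

End LebesgueMeasure.

(** * Smooth cut-off functions *)

Section FlatFunction.
Context {R : realType}.

(** The classical flat functions t^-k exp(-1/t) extended by 0; differentiation
    only produces functions of the same family. *)
Definition flat (k : nat) (t : R) : R :=
  if 0 < t then t^-1 ^+ k * expR (- t^-1) else 0.

Lemma flat_ge0 k t : 0 <= flat k t.
Proof.
by rewrite /flat; case: ifP => // t0; rewrite mulr_ge0 ?expR_ge0// exprn_ge0// invr_ge0 ltW.
Qed.

Lemma flat_gt0 k t : 0 < t -> 0 < flat k t.
Proof.
by move=> t0; rewrite /flat t0 mulr_gt0 ?expR_gt0// exprn_gt0// invr_gt0.
Qed.

Lemma flat_eq0 k t : t <= 0 -> flat k t = 0.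
Proof. by rewrite leNgt /flat => /negbTE ->. Qed.

(** This is s ^ k <= k! exp s at s = 1 / t, one term of the exponential series. *)
Lemma flat_le k t : flat k t <= k`!%:R.
Proof.
rewrite /flat; case: ifP => t0; last by rewrite ler0n.
have s0 : 0 <= t^-1 by rewrite invr_ge0 ltW.
rewrite expRN ler_pdivrMr ?expR_gt0//.
case: k => [|k].
  by rewrite expr0 fact0 mul1r -expR0 ler_expR.
rewrite mulrC -ler_pdivrMr ?ltr0n ?fact_gt0//.
by apply: le_trans (expR_ge1Dxn k s0); rewrite lerDr.
Qed.

Lemma flatS k t : flat k t = t * flat k.+1 t.
Proof.
rewrite /flat; case: ifP => t0; last by rewrite mulr0.
by rewrite exprS !mulrA mulfV ?mul1r// gt_eqF.
Qed.

Lemma cvg_flat0 k : flat k @ (0 : R) --> 0.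
Proof.
apply/cvgrPdist_lt => e e0; near=> h.
rewrite sub0r normrN flatS normrM.
have f0 : 0 < k.+1`!%:R + 1 :> R by rewrite ltr_wpDl.
apply: (@le_lt_trans _ _ (`|h| * (k.+1`!%:R + 1))).
  rewrite ler_wpM2l// ger0_norm ?flat_ge0// (le_trans (flat_le _ _))//.
  by rewrite lerDl.
rewrite -ltr_pdivlMr//; near: h.
apply/nbhs_ballP; exists (e / (k.+1`!%:R + 1)) => /=; first exact: divr_gt0.
by move=> h; rewrite /ball /= sub0r normrN.
Unshelve. all: by end_near. Qed.

(** At t = 0 the difference quotient is flat k.+1, which tends to 0. *)
Lemma is_derive_flat (k : nat) (t : R) :
  is_derive t (1 : R) (flat k) (flat k.+2 t - k%:R * flat k.+1 t).
Proof.
have [t0|t0|->] := ltgtP t 0.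
- rewrite !flat_eq0 ?(ltW t0)// mulr0 subr0.
  apply: (@near_eq_is_derive _ _ _ (cst 0)).
  near=> s; rewrite /= flat_eq0// ltW//; near: s.
  exact: (cvgr_lt t) (@cvg_id _ _) _ t0.
- have tn0 : t != 0 by rewrite gt_eqF.
  have dV : is_derive t (1 : R) (fun s : R => s^-1) (- t ^- 2).
    have := @is_deriveV R id t 1 1 tn0 (is_derive_id _ _).
    by rewrite /GRing.scale /= mulr1.
  have dE : is_derive t (1 : R) (expR \o - (fun s : R => s^-1))
      (expR (- t^-1) * - (- t ^- 2)).
    exact: (is_derive1_comp (is_derive_expR _) (is_deriveN dV)).
  have dg := is_deriveM (is_deriveX k dV) dE.
  have nE : \forall s \near t,
      ((fun s : R => s^-1) ^+ k * (expR \o - (fun s : R => s^-1))) s = flat k s.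
    near=> s; rewrite !fctE /flat ifT//; near: s.
    exact: (cvgr_gt t) (@cvg_id _ _) _ t0.
  apply: (is_derive_eq (near_eq_is_derive nE dg)).
  rewrite !fctE /flat t0 /GRing.scale /= opprK -exprVn.
  case: k {dg nE} => [|k]; first by ring.
  by rewrite -[k.+1.-1]/k !exprS; ring.
- rewrite !flat_eq0// mulr0 subr0.
  have cv : h^-1 *: ((flat k \o shift 0) (h *: 1) - flat k 0) @[h --> 0^'] --> (0 : R).
    rewrite (_ : (fun h => _) = flat k.+1); last first.
      apply/funext => h /=; rewrite addr0 [h%:A]mulr1 (flat_eq0 _ (lexx 0)) subr0.
      have [->|h0] := eqVneq h 0; first by rewrite invr0 scale0r flat_eq0.
      by rewrite flatS /GRing.scale /= mulKf.
    by apply: cvg_trans (cvg_flat0 k.+1); exact/cvg_app/cvg_within.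
  split; first by apply/cvg_ex; exists 0.
  exact: cvg_lim cv.
Unshelve. all: by end_near. Qed.

End FlatFunction.

Section DirectionalDerivative.
Context {R : realType} {V : normedModType R}.

Lemma is_derive_line (f : V -> R) x v df :
  is_derive x v f df <-> is_derive (0 : R) 1 (fun h => f (h *: v + x)) df.
Proof.
have E : 'D_v f x = 'D_1 (fun h : R => f (h *: v + x)) 0.
  rewrite /derive; set g1 := fun h => h^-1 *: _; set g2 := fun h => h^-1 *: _.
  suff -> : g1 = g2 by []; apply/funext => h; rewrite /g1 /g2 /=.
  by rewrite addr0 scale0r add0r [_%:A]mulr1.
split=> -[d e]; split.
- by have [+ _] := derivable1P f x v; apply.
- by rewrite -e; exact: esym E.
- by have [_] := derivable1P f x v; apply.
- by rewrite -e; exact: E.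
Qed.

Lemma is_derive_flat_comp k (f : V -> R) x v df : is_derive x v f df ->
  is_derive x v (fun y => flat k (f y))
    ((flat k.+2 (f x) - k%:R * flat k.+1 (f x)) * df).
Proof.
move=> /is_derive_line df0; apply/is_derive_line.
apply: (@is_derive1_comp _ (flat k) (fun h : R => f (h *: v + x))) => //.
by rewrite scale0r add0r; exact: is_derive_flat.
Qed.

End DirectionalDerivative.

Section Elementary.
Context {R : realType} {n : nat}.
Local Notation E := 'rV[R]_n.
Implicit Types (f g : E -> R) (i : 'I_n) (s : seq 'I_n) (D K : set E).

(** A class of functions that contains the cut-offs needed below and is closed
    under partial derivatives, hence consists of smooth functions. *)
Inductive elementary : (E -> R) -> Prop :=
| elementary_cst c : elementary (fun=> c)
| elementary_coord i : elementary (fun x => x 0 i)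
| elementaryD f g : elementary f -> elementary g -> elementary (fun x => f x + g x)
| elementaryM f g : elementary f -> elementary g -> elementary (fun x => f x * g x)
| elementary_flat k f : elementary f -> elementary (fun x => flat k (f x)).

Lemma is_derive_coord i (x v : E) : is_derive x v (fun y : E => y 0 i) (v 0 i).
Proof.
apply/is_derive_line.
rewrite (_ : (fun h : R => _) = (fun h => h * v 0 i + x 0 i)); last first.
  by apply/funext => h; rewrite !mxE.
have d1 : is_derive (0 : R) (1 : R) (fun h : R => h * v 0 i) (v 0 i).
  have := is_deriveM (@is_derive_id _ _ (0 : R) 1) (is_derive_cst (v 0 i) (0 : R) 1).
  by move=> d; apply: (is_derive_eq d); rewrite /GRing.scale /= mulr0 add0r mulr1.
have := is_deriveD d1 (is_derive_cst (x 0 i) (0 : R) 1).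
by move=> d; apply: (is_derive_eq d); rewrite addr0.
Qed.

Lemma elementary_is_derive f i : elementary f ->
  exists2 df, elementary df & forall x, is_derive x (delta_mx 0 i) f (df x).
Proof.
elim=> [c|j|{}f g _ [df edf dfP] eg' [dg edg dgP]|{}f g ef [df edf dfP] eg [dg edg dgP]|k {}f ef [df edf dfP]].
- by exists (fun=> 0) => [|x]; [exact: elementary_cst|exact: is_derive_cst].
- exists (fun=> (delta_mx 0 i : E) 0 j) => [|x]; first exact: elementary_cst.
  exact: is_derive_coord.
- by exists (fun x => df x + dg x) => [|x]; [exact: elementaryD|exact: is_deriveD].
- exists (fun x => f x * dg x + g x * df x) => [|x].
    by apply: elementaryD; exact: elementaryM.
  exact: is_deriveM.
- exists (fun x => (flat k.+2 (f x) + (- k%:R) * flat k.+1 (f x)) * df x) => [|x].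
    apply: elementaryM => //; apply: elementaryD; first exact: elementary_flat.
    by apply: elementaryM; [exact: elementary_cst|exact: elementary_flat].
  have d := is_derive_flat_comp k (dfP x).
  by apply: (is_derive_eq d); rewrite mulNr.
Qed.

Lemma flat_continuous k : continuous (flat k : R -> R).
Proof.
move=> t; have [d _] := is_derive_flat k t.
exact/differentiable_continuous/derivable1_diffP.
Qed.

Lemma elementary_continuous f : elementary f -> continuous f.
Proof.
move=> ef x; have FF := nbhs_filter x; elim: ef => [c|j|{}f g _ cf _ cg|{}f g _ cf _ cg|k {}f _ cf].
- exact: cst_continuous.
- exact: coord_continuous.
- exact: (@cvgD _ _ _ _ FF).
- exact: (@cvgM _ _ _ FF).
- by apply: (@continuous_comp _ _ _ f (flat k)) => //; exact: flat_continuous.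
Qed.

Lemma elementary_derivable f i x : elementary f -> derivable f x (delta_mx 0 i).
Proof. by move=> /(elementary_is_derive i)[df _ /(_ x)[]]. Qed.

Lemma elementary_partial f i : elementary f -> elementary (partial f i).
Proof.
move=> /(elementary_is_derive i)[df edf dP].
rewrite (_ : partial f i = df)//; apply/funext => x.
by have [_] := dP x.
Qed.

Lemma elementary_iter_partial f s : elementary f -> elementary (iter_partial f s).
Proof. by move=> ef; elim: s => //= i s; exact: elementary_partial. Qed.

Lemma elementary_Ck f k : elementary f -> Ck k setT f.
Proof.
move=> /elementary_iter_partial ef s x _ _; split=> [|_ i].
  exact: elementary_continuous.
exact: elementary_derivable.
Qed.

Lemma elementaryN f : elementary f -> elementary (fun x => - f x).
Proof.
move=> ef; rewrite (_ : (fun x => - f x) = fun x => (-1) * f x).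
  by apply: elementaryM => //; exact: elementary_cst.
by apply/funext => x; rewrite mulN1r.
Qed.

Lemma elementary_sum (I : Type) (r : seq I) (P : pred I) (f : I -> E -> R) :
  (forall j, elementary (f j)) -> elementary (fun x => \sum_(j <- r | P j) f j x).
Proof.
move=> ef; elim: r => [|j r IH].
  by under eq_fun do rewrite big_nil; exact: elementary_cst.
under eq_fun do rewrite big_cons.
case: (P j) => //.
exact: elementaryD.
Qed.

Lemma elementary_prod (I : Type) (r : seq I) (P : pred I) (f : I -> E -> R) :
  (forall j, elementary (f j)) -> elementary (fun x => \prod_(j <- r | P j) f j x).
Proof.
move=> ef; elim: r => [|j r IH].
  by under eq_fun do rewrite big_nil; exact: elementary_cst.
under eq_fun do rewrite big_cons.
case: (P j) => //.
exact: elementaryM.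
Qed.

Lemma elementaryX f k : elementary f -> elementary (fun x => f x ^+ k).
Proof.
move=> ef; elim: k => [|k IH]; first exact: elementary_cst.
by under eq_fun do rewrite exprS; exact: elementaryM.
Qed.

Lemma elementary_sqdist c : elementary (fun x => sqnorm (x - c)).
Proof.
apply: elementary_sum => i; apply: elementaryX.
under eq_fun do rewrite !mxE.
by apply: elementaryD; [exact: elementary_coord|exact: elementary_cst].
Qed.

Lemma near_partial0 f (U : set E) i x : open U -> U x ->
  (forall y, U y -> f y = 0) -> partial f i x = 0.
Proof.
move=> oU Ux f0; rewrite /partial.
rewrite (@near_eq_derive _ _ _ f (cst 0)) ?derive_cst//.
have : nbhs x U by exact: open_nbhs_nbhs.
by apply: filterS => y /f0.
Qed.

(** Smooth functions with compact support in D whose iterated partial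
    derivatives are again of that kind. *)
Definition cutoff D f := elementary f /\
  exists K, [/\ compact K, K `<=` D & forall x, ~ K x -> f x = 0].

Lemma cutoff_test D f : cutoff D f -> test_function D f.
Proof. by move=> [ef K]; split => // k; exact: elementary_Ck. Qed.

Lemma partial_off_compact K f i : compact K -> (forall x, ~ K x -> f x = 0) ->
  forall x, ~ K x -> partial f i x = 0.
Proof.
move=> cK f0 x Kx.
apply: (@near_partial0 f (~` K)) => //; apply: closed_openC.
exact: compact_closed (@norm_hausdorff _ _) cK.
Qed.

Lemma cutoff_partial D f i : cutoff D f -> cutoff D (partial f i).
Proof.
move=> [ef [K [cK KD f0]]]; split; first exact: elementary_partial.
by exists K; split => //; exact: partial_off_compact.
Qed.

Lemma cutoff_subset D D' f : D `<=` D' -> cutoff D f -> cutoff D' f.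
Proof.
move=> DD' [ef [K [cK KD f0]]]; split => //.
by exists K; split => //; exact: subset_trans DD'.
Qed.

(** The truncation makes the bump of a ball of negative radius identically zero,
    as the empty balls of [open_bigcup_eball] require. *)
Definition bump k (c : E) (r : R) (x : E) : R := flat k (Num.max 0 r ^+ 2 - sqnorm (x - c)).

Lemma bump_elementary k c r : elementary (bump k c r).
Proof.
apply: elementary_flat; apply: elementaryD; first exact: elementary_cst.
exact/elementaryN/elementary_sqdist.
Qed.

Lemma bump_gt0 k c r x : eball c r x -> 0 < bump k c r x.
Proof.
move=> xr; have r0 : 0 < r by apply: le_lt_trans xr; exact: enorm_ge0.
by apply: flat_gt0; rewrite subr_gt0 max_r ?(ltW r0)//; exact/in_eball.
Qed.

Lemma bump_out k c r x : ~ eball c r x -> bump k c r x = 0.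
Proof.
move=> xr; apply: flat_eq0; rewrite subr_le0.
have [r0|r0] := leP r 0; first by rewrite expr0n sqnorm_ge0.
by rewrite leNgt; apply/negP => /(in_eball _ _ r0).
Qed.

Lemma bump0_lt1 c r x : 0 <= bump 0 c r x < 1.
Proof.
rewrite flat_ge0 /= /bump /flat; case: ifP => // t0.
by rewrite expr0 mul1r -expR0 ltr_expR oppr_lt0 invr_gt0.
Qed.

End Elementary.

(** * Integrals of functions with compact support *)

Section Integration.
Context {R : realType} {n : nat}.
Local Notation E := 'rV[R]_n.+1.
Local Notation CT := (caratheodory_type (@lebesgue_omeasure R n)).
Local Notation mu := (@lebesgue R n).
Local Notation integ D f := (mu.-integrable (D : set CT) (EFin \o f)).
Local Notation mset D := (measurable (D : set CT)).
Implicit Types (D K Omega : set E) (f g psi : E -> R) (x y : E).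

Lemma Rdominated_cvg D (F : nat -> E -> R) f g : mset D ->
  (forall k, measurable_fun (D : set CT) (F k)) ->
  (forall x, D x -> F ^~ x @ \oo --> f x) -> integ D g ->
  (forall k x, D x -> `|F k x| <= g x) ->
  \int[mu]_(x in (D : set CT)) F k x @[k --> \oo] -->
    \int[mu]_(x in (D : set CT)) f x.
Proof.
move=> mD mF Ff ig Fg.
have mF' k : measurable_fun (D : set CT) (EFin \o F k) by exact/measurable_EFinP.
have Ff' (x : CT) : D x -> (EFin \o F ^~ x) @ \oo --> (EFin \o f) x.
  by move=> Dx; apply/fine_cvgP; split; [exact: nearW|exact: Ff].
have mf : measurable_fun (D : set CT) (EFin \o f).
  by apply: emeasurable_fun_cvg mF' _ => x Dx; exact: Ff'.
have Fg' : {ae mu, forall x k, D x -> (`|(EFin \o F k) x| <= (EFin \o g) x)%E}.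
  by apply: aeW => x k Dx; rewrite lee_fin Fg.
have [intf _ cv] := dominated_convergence mD mF' mf (aeW _ Ff') ig Fg'.
have ffin : (\int[mu]_(x in (D : set CT)) (f x)%:E)%E \is a fin_num.
  exact: integrable_fin_num intf.
by apply: fine_cvg; rewrite fineK.
Qed.

Lemma integZ D f (c : R) : mset D -> integ D f -> integ D (fun x => c * f x).
Proof.
by move=> mD intf; apply: eq_integrable (integrableZl mD c intf) => // x _.
Qed.

Lemma integD D f g : mset D -> integ D f -> integ D g -> integ D (fun x => f x + g x).
Proof.
by move=> mD intf intg; apply: eq_integrable (integrableD mD intf intg) => // x _.
Qed.

Lemma integB D f g : mset D -> integ D f -> integ D g -> integ D (fun x => f x - g x).
Proof.
by move=> mD intf intg; apply: eq_integrable (integrableB mD intf intg) => // x _.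
Qed.

Lemma integ_le D f g : mset D -> measurable_fun (D : set CT) f -> integ D g ->
  (forall x, D x -> `|f x| <= g x) -> integ D f.
Proof.
move=> mD mf ig fg; apply: le_integrable ig => //; first exact/measurable_EFinP.
move=> x Dx /=; rewrite lee_fin (le_trans (fg x Dx))//; exact: ler_norm.
Qed.

Lemma integ_measurable D f : integ D f -> measurable_fun (D : set CT) f.
Proof. by move=> /measurable_int /measurable_EFinP. Qed.

Lemma integ_norm D f : mset D -> integ D f -> integ D (fun x => `|f x|).
Proof.
move=> mD intf; apply: eq_integrable (integrable_abse intf) => // x _.
Qed.

Lemma integM D f g (C : R) : mset D -> integ D f ->
  measurable_fun (D : set CT) g -> (forall x, D x -> `|g x| <= C) ->
  integ D (fun x => f x * g x).
Proof.
move=> mD intf mg gC.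
apply: (@integ_le _ _ (fun x => C * `|f x|) mD).
- by apply: measurable_funM; [exact: integ_measurable|exact: mg].
- by apply: integZ; [exact: mD|exact: integ_norm].
- by move=> x Dx; rewrite normrM mulrC ler_wpM2r// gC.
Qed.

Lemma continuous_measurableT D f : mset D -> continuous f ->
  measurable_fun (D : set CT) f.
Proof.
move=> mD cf; apply: measurable_funTS; apply: continuous_lmeasurable.
  exact: openT.
by move=> x _; exact: cf.
Qed.

Lemma mset_compact K : compact K -> mset K.
Proof.
move=> cK; apply: closed_lmeasurable; exact: compact_closed (@norm_hausdorff _ _) cK.
Qed.

Lemma compact_outer_fin K : compact K -> (lebesgue_outer K < +oo)%E.
Proof. by move=> /compact_bounded; exact: bounded_outer_fin. Qed.

Lemma continuous_compact_bounded K f : compact K -> continuous f ->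
  (forall x, ~ K x -> f x = 0) -> exists C : R, forall x, `|f x| <= C.
Proof.
move=> cK cf f0.
have : compact (f @` K) by apply: continuous_compact => //; exact: continuous_subspaceT.
move=> /compact_bounded[M [_ HM]]; exists (`|M| + 1) => x.
have [Kx|/f0 ->] := pselect (K x); last by rewrite normr0 addr_ge0.
apply: HM; last by exists x.
by rewrite (le_lt_trans (ler_norm _))// ltrDl.
Qed.

Lemma integ_compact K f D : compact K -> continuous f ->
  (forall x, ~ K x -> f x = 0) -> mset D -> integ D f.
Proof.
move=> cK cf f0 mD; apply: (@integrableS _ _ _ mu setT) => //.
have [C fC] := continuous_compact_bounded cK cf f0.
have mK := mset_compact cK.
have : integ K f.
  apply: (@integ_bounded _ _ _ _ C) => //; first exact: compact_outer_fin.
  exact: continuous_measurableT.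
rewrite -[X in mu.-integrable X](setTI (K : set CT)) integrable_restrict//.
rewrite (_ : (_ \_ _) = EFin \o f)//; apply/funext => x; rewrite patchE /=.
by case: ifPn => // /negP; rewrite inE => /f0 ->.
Qed.

Lemma Rintegral_supp D f : (forall x, ~ D x -> f x = 0) ->
  \int[mu]_(x in (D : set CT)) f x = \int[mu]_x f x.
Proof.
move=> f0; rewrite Rintegral_mkcond; apply: eq_Rintegral => x _.
by rewrite patchE; case: ifPn => // /negP; rewrite inE => /f0.
Qed.

Lemma is_derive_shift f x (v : E) (t : R) :
  derivable f (t *: v + x) v ->
  is_derive t (1 : R) (fun s => f (s *: v + x)) ('D_v f (t *: v + x)).
Proof.
move=> /derivableP /is_derive_line d.
have e : (fun s : R => f (s *: v + x)) =
    (fun h : R => f (h *: v + (t *: v + x))) \o (fun s => s - t).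
  by apply/funext => s /=; rewrite addrA -scalerDl subrK.
rewrite e; have d' : is_derive t (1 : R) (fun s : R => s - t) 1.
  have := is_deriveB (@is_derive_id _ _ t 1) (is_derive_cst t t (1 : R)).
  by move=> d'; apply: (is_derive_eq d'); rewrite subr0.
have d0 : is_derive (t - t) (1 : R)
    (fun h : R => f (h *: v + (t *: v + x))) ('D_v f (t *: v + x)).
  by rewrite subrr.
have := @is_derive1_comp _ _ (fun s => s - t) t _ _ d0 d'.
by move=> d1; apply: (is_derive_eq d1); rewrite mulr1.
Qed.

Section Convolution.
Variables (D : set E) (f : E -> R).
Hypotheses (mD : mset D) (intf : integ D f).

Definition conv psi (x : E) : R := \int[mu]_(y in (D : set CT)) (f y * psi (x - (y : E))).

Lemma continuous_subr x : continuous (fun y : E => x - y).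
Proof.
move=> y; apply: (@cvgB _ _ _ _ (nbhs_filter y)); last exact: cvg_id.
exact: cst_continuous.
Qed.

Lemma integ_conv psi (C : R) x : continuous psi -> (forall x, `|psi x| <= C) ->
  integ D (fun y => f y * psi (x - y)).
Proof.
move=> cpsi psiC; apply: (@integM _ _ _ C mD intf); last by move=> y _; exact: psiC.
apply: (continuous_measurableT mD) => y.
exact: (continuous_comp (@continuous_subr x y) (cpsi _)).
Qed.

(** Differentiation under the integral sign along the line through x with
    direction v; the dominating function is C' |f|. *)
Lemma is_derive_conv psi (C C' : R) (v : E) x : continuous psi ->
  (forall x, `|psi x| <= C) -> (forall x, derivable psi x v) ->
  (forall x, `|'D_v psi x| <= C') ->
  is_derive x v (conv psi) (conv ('D_v psi) x).
Proof.
move=> cpsi psiC dpsi dC; apply/is_derive_line.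
pose F (t : R) (y : CT) : R := f y * psi (t *: v + (x - (y : E))).
have dF t y : is_derive t (1 : R) (F ^~ y) (f y * 'D_v psi (t *: v + (x - y))).
  have d := is_deriveM (is_derive_cst (f y) t (1 : R)) (is_derive_shift (dpsi (t *: v + (x - y)))).
  by apply: (is_derive_eq d); rewrite scaler0 addr0.
have d1F t y : partial1of2 F t y = f y * 'D_v psi (t *: v + (x - y)).
  by rewrite partial1of2E; have [_ ->] := dF t y.
have I0 : (`]-1, 1[%classic : set R) 0 by rewrite /= in_itv /=; lra.
have iF (t : R) : `]-1, 1[%classic t -> integ D (F t).
  move=> _; have := integ_conv (t *: v + x) cpsi psiC.
  by apply: eq_integrable => // y _; rewrite /= /F addrA.
have dF1 (t : R) (y : CT) : `]-1, 1[%classic t -> D y -> derivable (F ^~ y) t 1.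
  by move=> _ _; have [] := dF t y.
have G0 (y : CT) : 0 <= C' * `|f y|.
  by rewrite mulr_ge0// (le_trans _ (dC 0)).
have iG : integ D (fun y => C' * `|f y|) by apply: integZ => //; exact: integ_norm.
have FG (t : R) (y : CT) : `]-1, 1[%classic t -> D y ->
    `|partial1of2 F t y| <= C' * `|f y|.
  by move=> _ _; rewrite d1F normrM mulrC ler_wpM2r.
have dd := derivable_under_integral mD I0 iF dF1 G0 iG FG.
have ee := differentiation_under_integral mD I0 iF dF1 G0 iG FG.
have e1 : (fun h : R => conv psi (h *: v + x)) =
    (fun t => \int[mu]_(y in (D : set CT)) F t y).
  by apply/funext => t; apply: eq_Rintegral => y _; rewrite /F addrA.
rewrite e1; split => //; rewrite -derive1E ee.
by apply: eq_Rintegral => y _; rewrite d1F scale0r add0r.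
Qed.

Lemma conv_continuous psi (C : R) : continuous psi ->
  (forall x, `|psi x| <= C) -> continuous (conv psi).
Proof.
move=> cpsi psiC x; apply/(@cvgrPdist_lt _ _ _ _ (nbhs_filter x)) => e e0; apply: contrapT => nbad.
(* A failure of continuity is witnessed by a sequence, to which dominated
   convergence applies. *)
have bad (k : nat) : exists z : E, ball x k.+1%:R^-1 z /\ e <= `|conv psi x - conv psi z|.
  apply: contrapT => nz; apply: nbad; apply/nbhs_ballP.
  exists k.+1%:R^-1 => /=; first by rewrite invr_gt0.
  by move=> z xz; rewrite ltNge; apply/negP => ez; apply: nz; exists z.
have /choice[z zP] := bad.
have zx : z @ \oo --> x.
  apply/cvg_ballP => d d0; have [N _ HN] := near_infty_natSinv_lt (PosNum d0).
  exists N => // k /= Nk; apply: le_ball (zP k).1.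
  exact/ltW/HN.
have cv : conv psi (z k) @[k --> \oo] --> conv psi x.
  apply: (@Rdominated_cvg D (fun k y => f y * psi (z k - y)) _
    (fun y => C * `|f y|) mD).
  - move=> k; apply: integ_measurable; exact: (integ_conv (z k) cpsi psiC).
  - move=> y _; apply: cvgM; first exact: cvg_cst.
    have cy : {for x, continuous (fun z : E => z - y)}.
      apply: (@cvgB _ _ _ _ (nbhs_filter x)); first exact: cvg_id.
      exact: cst_continuous.
    have cc : {for x, continuous (fun z : E => psi (z - y))}.
      exact: (continuous_comp cy (cpsi _)).
    exact: (cvg_comp _ _ zx cc).
  - by apply: integZ; [exact: mD|exact: integ_norm].
  - by move=> k y _; rewrite normrM mulrC ler_wpM2r.
have /cvgrPdist_lt /(_ _ e0)[N _ /(_ N (leqnn N))] := cv.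
by rewrite ltNge (zP N).2.
Qed.

End Convolution.

Lemma compact_in_cball K : compact K -> exists M : R, K `<=` cball 0 M.
Proof.
move=> cK; have : compact ((fun x : E => enorm (x - 0)) @` K).
  by apply: continuous_compact => //; apply: continuous_subspaceT; exact: edist_continuous.
move=> /compact_bounded[M [_ HM]]; exists (`|M| + 1) => x Kx.
apply: le_trans (ler_norm _) _; apply: HM; last by exists x.
by rewrite (le_lt_trans (ler_norm _))// ltrDl.
Qed.

Lemma enorm_delta (i : 'I_n.+1) (t : R) : enorm (t *: (delta_mx 0 i : E)) = `|t|.
Proof.
rewrite /enorm (bigD1 i) //= big1 => [|j ji]; rewrite !mxE.
  by rewrite !eqxx /= mulr1 addr0 sqrtr_sqr.
by rewrite (negbTE ji) /= mulr0 expr0n.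
Qed.

(** Lebesgue measure is translation invariant, so the integral of f(y + t e_i)
    does not depend on t. *)
Lemma Rintegral_partial0 K f i : compact K -> (forall x, ~ K x -> f x = 0) ->
  continuous f -> (forall x, derivable f x (delta_mx 0 i)) ->
  continuous (partial f i) -> \int[mu]_x partial f i x = 0.
Proof.
move=> cK f0 cf df cdf; set v : E := delta_mx 0 i.
have [C' dC] := continuous_compact_bounded cK cdf (partial_off_compact i cK f0).
have [M KM] := compact_in_cball cK.
(* All the translates by t e_i with |t| < 1 are supported in this ball. *)
pose B : set E := cball 0 (M + 1).
have cB : compact B by exact: compact_cball.
have mB : mset B by exact: mset_compact.
pose F (t : R) (y : CT) : R := f (t *: v + (y : E)).
have dF t y : is_derive t (1 : R) (F ^~ y) (partial f i (t *: v + y)).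
  exact: is_derive_shift (df _).
have d1F t y : partial1of2 F t y = partial f i (t *: v + y).
  by rewrite partial1of2E; have [_ ->] := dF t y.
have I0 : (`]-1, 1[%classic : set R) 0 by rewrite /= in_itv /=; lra.
have supp (t : R) (y : E) : `]-1, 1[%classic t -> ~ B y -> f (t *: v + y) = 0.
  rewrite /= in_itv /= => tI By; apply: f0 => /KM; rewrite /cball /= subr0 => tyM.
  apply: By; rewrite /B /cball /= subr0.
  have -> : y = (t *: v + y) + (- t) *: v by rewrite scaleNr addrAC subrr add0r.
  apply: (le_trans (ler_enormD _ _)); apply: lerD => //.
  by rewrite enorm_delta normrN ltW// ltr_norml.
have cF (t : R) : continuous (fun y : E => f (t *: v + y)).
  move=> y; have cy : {for y, continuous (fun z : E => t *: v + z)}.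
    apply: (@cvgD _ _ _ _ (nbhs_filter y)); last exact: cvg_id.
    exact: cst_continuous.
  exact: (continuous_comp cy (cf _)).
have iF (t : R) : `]-1, 1[%classic t -> integ B (F t).
  by move=> tI; apply: (integ_compact cB (cF t)) => // y; exact: supp.
have dF1 (t : R) (y : CT) : `]-1, 1[%classic t -> B y -> derivable (F ^~ y) t 1.
  by move=> _ _; have [] := dF t y.
have C0 (y : CT) : 0 <= C' by exact: le_trans (dC 0).
have iG : integ B (fun=> C').
  apply: (@integ_bounded _ _ _ _ `|C'| mB).
  - exact: compact_outer_fin.
  - exact: measurable_cst.
  - by [].
have FG (t : R) (y : CT) : `]-1, 1[%classic t -> B y -> `|partial1of2 F t y| <= C'.
  by move=> _ _; rewrite d1F.
have dd := derivable_under_integral mB I0 iF dF1 C0 iG FG.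
have ee := differentiation_under_integral mB I0 iF dF1 C0 iG FG.
have iT : integ setT f by exact: (integ_compact cK cf f0).
have cst : \forall t \near (0 : R),
    \int[mu]_(y in (B : set CT)) F t y = \int[mu]_y f y.
  have : nbhs (0 : R) (`]-1, 1[%classic : set R).
    by apply: open_nbhs_nbhs; split => //; exact: interval_open.
  apply: filterS => t tI; rewrite Rintegral_supp; last by move=> y; exact: supp.
  rewrite -(Rintegral_shift (t *: v) iT).
  by apply: eq_Rintegral => y _; rewrite /F addrC.
rewrite -(@Rintegral_supp B); last first.
  move=> x Bx; apply: (partial_off_compact i cK f0) => /KM Mx; apply: Bx.
  by apply: le_trans Mx _; rewrite lerDl.
transitivity (\int[mu]_(y in (B : set CT)) partial1of2 F 0 y).
  by apply: eq_Rintegral => y _; rewrite d1F scale0r add0r.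
rewrite -[LHS]ee derive1E.
rewrite (near_eq_derive _ (g := fun=> \int[mu]_y f y)) ?derive_cst//.
Qed.

(** * Integration by parts *)

Lemma test_smooth Omega psi : test_function Omega psi ->
  [/\ continuous psi, forall x i, derivable psi x (delta_mx 0 i) &
      forall i, continuous (partial psi i)].
Proof.
move=> [sm _]; split=> [x|x i|i x].
- by have [] := sm 1%N [::] x I isT.
- by have [_ /(_ isT)] := sm 1%N [::] x I isT; exact.
- by have [] := sm 1%N [:: i] x I isT.
Qed.

(** The product of f with a test function has compact support, so that its partial
    derivative has integral zero. *)
Lemma cutoff_weak_partial Omega f i : mset Omega -> cutoff Omega f ->
  weak_partial Omega f i (partial f i).
Proof.
move=> mO [ef [K [cK KO f0]]] psi tpsi.
have [cpsi dpsi cdpsi] := test_smooth tpsi.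
have cf := elementary_continuous ef.
have df x : derivable f x (delta_mx 0 i) by exact: elementary_derivable.
have cdf := elementary_continuous (elementary_partial i ef).
have pf0 := partial_off_compact i cK f0.
have pM x : partial (fun y => f y * psi y) i x =
    f x * partial psi i x + psi x * partial f i x.
  by rewrite /partial (deriveM (df x) (dpsi x i)).
have c1 : continuous (fun x => f x * partial psi i x).
  move=> x; apply: (@cvgM _ _ _ (nbhs_filter x)); [exact: cf|exact: cdpsi].
have c2 : continuous (fun x => partial f i x * psi x).
  move=> x; apply: (@cvgM _ _ _ (nbhs_filter x)); [exact: cdf|exact: cpsi].
have i1 : integ setT (fun x => f x * partial psi i x).
  by apply: (integ_compact cK c1) => // x /f0 ->; rewrite mul0r.
have i2 : integ setT (fun x => partial f i x * psi x).
  by apply: (integ_compact cK c2) => // x /pf0 ->; rewrite mul0r.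
have offO g (x : E) : (forall x, ~ K x -> g x = 0) -> ~ Omega x -> g x = 0 :> R.
  by move=> g0 Ox; apply: g0 => /KO.
rewrite (@Rintegral_supp Omega (fun x => f x * partial psi i x)); last first.
  by move=> x; apply: (offO (fun x => f x * partial psi i x)) => y /f0 ->; rewrite mul0r.
rewrite (@Rintegral_supp Omega (fun x => partial f i x * psi x)); last first.
  by move=> x; apply: (offO (fun x => partial f i x * psi x)) => y /pf0 ->; rewrite mul0r.
apply/eqP; rewrite -addr_eq0 -RintegralD//; apply/eqP.
rewrite -[RHS](@Rintegral_partial0 K (fun y => f y * psi y) i cK).
- by apply: eq_Rintegral => x _; rewrite pM [psi x * _]mulrC.
- by move=> x /f0 ->; rewrite mul0r.
- by move=> x; apply: (@cvgM _ _ _ (nbhs_filter x)); [exact: cf|exact: cpsi].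
- by move=> x; exact: derivableM.
- rewrite (_ : partial _ i = fun x => f x * partial psi i x + partial f i x * psi x).
    by move=> x; apply: (@cvgD _ _ _ _ (nbhs_filter x)); [exact: c1|exact: c2].
  by apply/funext => x; rewrite pM [psi x * _]mulrC.
Qed.

Lemma iter_partialD f g s : (forall k, Ck k setT f) -> (forall k, Ck k setT g) ->
  iter_partial (fun x => f x + g x) s = fun x => iter_partial f s x + iter_partial g s x.
Proof.
move=> sf sg; elim: s => //= i s ->; apply/funext => x.
have [_ /(_ (ltnSn _) i) df] := sf (size s).+1 s x I (leqnSn _).
have [_ /(_ (ltnSn _) i) dg] := sg (size s).+1 s x I (leqnSn _).
exact: (deriveD df dg).
Qed.

Lemma smoothD f g : (forall k, Ck k setT f) -> (forall k, Ck k setT g) ->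
  forall k, Ck k setT (fun x => f x + g x).
Proof.
move=> sf sg k s x _ sk; rewrite iter_partialD//.
have [cf df] := sf k s x I sk; have [cg dg] := sg k s x I sk.
split; first exact: (@cvgD _ _ _ _ (nbhs_filter x)).
by move=> lt i; exact: (derivableD (df lt i) (dg lt i)).
Qed.

Lemma test_functionD Omega f g : test_function Omega f -> test_function Omega g ->
  test_function Omega (fun x => f x + g x).
Proof.
move=> [sf [K [cK KO f0]]] [sg [L [cL LO g0]]]; split; first exact: smoothD.
exists (K `|` L); split; first exact: compactU.
  by move=> x [/KO|/LO].
by move=> x KLx; rewrite f0 ?g0 ?addr0// => ?; apply: KLx; [right|left].
Qed.

Lemma cutoffZ Omega (c : R) f : cutoff Omega f -> cutoff Omega (fun x => c * f x).
Proof.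
move=> [ef [K [cK KO f0]]]; split.
  by apply: elementaryM => //; exact: elementary_cst.
by exists K; split => // x /f0 ->; rewrite mulr0.
Qed.

Section L2.
Variables (Omega : set E).
Hypotheses (oO : open Omega) (bO : bounded_set Omega).
Let mO : mset Omega. Proof. exact: open_lmeasurable. Qed.

Lemma L2_integ f : L2 Omega f <->
  measurable_fun (Omega : set CT) f /\ integ Omega (fun x => f x ^+ 2).
Proof.
have e : (\int[mu]_(x in (Omega : set CT)) `|(EFin \o (fun x => (f x ^+ 2)%R)) x| =
    \int[mu]_(x in (Omega : set CT)) (f x ^+ 2)%:E)%E.
  by apply: eq_integral => x _; rewrite /= ger0_norm ?sqr_ge0.
split=> -[mf foo]; split=> //.
  apply/integrableP; split; last by rewrite e.
  by apply/measurable_EFinP; exact: measurable_funX.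
by rewrite -e; have /integrableP[_] := foo.
Qed.

Lemma integ_cst (c : R) : integ Omega (fun=> c).
Proof.
apply: (@integ_bounded _ _ _ _ `|c| mO).
- exact: bounded_outer_fin.
- exact: measurable_cst.
- by [].
Qed.

Lemma L2_L1 f : L2 Omega f -> integ Omega f.
Proof.
move=> /L2_integ[mf if2].
apply: (@integ_le Omega f (fun x => 1 + f x ^+ 2) mO mf).
  by apply: integD => //; exact: integ_cst.
move=> x _; rewrite -real_normK ?num_real//.
by have := sqr_ge0 (`|f x| - 1); have := normr_ge0 (f x); nra.
Qed.

Lemma L2M f g : L2 Omega f -> L2 Omega g -> integ Omega (fun x => f x * g x).
Proof.
move=> /L2_integ[mf if2] /L2_integ[mg ig2].
apply: (@integ_le Omega _ (fun x => f x ^+ 2 + g x ^+ 2) mO).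
- exact: measurable_funM mf mg.
- exact: integD mO if2 ig2.
- move=> x _; rewrite ler_norml.
  have := sqr_ge0 (f x - g x); have := sqr_ge0 (f x + g x).
  by have := sqr_ge0 (f x); have := sqr_ge0 (g x); nra.
Qed.

Lemma L2D f g : L2 Omega f -> L2 Omega g -> L2 Omega (fun x => f x + g x).
Proof.
move=> Lf Lg; have ifg := L2M Lf Lg.
have [mf if2] := (L2_integ _).1 Lf; have [mg ig2] := (L2_integ _).1 Lg.
apply/L2_integ; split; first exact: measurable_funD mf mg.
apply: (@integ_le Omega _ (fun x => f x ^+ 2 + g x ^+ 2 + 2 * (f x * g x)) mO).
- exact: measurable_funX (measurable_funD mf mg).
- exact: integD mO (integD mO if2 ig2) (integZ _ mO ifg).
- by move=> x _; rewrite ger0_norm ?sqr_ge0//; lra.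
Qed.

Lemma L2_cutoff f : cutoff Omega f -> L2 Omega f.
Proof.
move=> [ef [K [cK KO f0]]]; apply/L2_integ; split.
  exact: continuous_measurableT (elementary_continuous ef).
apply: (integ_compact cK) => //.
  exact/elementary_continuous/elementaryX.
by move=> x /f0 ->; rewrite expr0n.
Qed.

Lemma test_integ f psi : integ Omega f -> test_function Omega psi ->
  integ Omega (fun x => f x * psi x) /\
  forall i, integ Omega (fun x => f x * partial psi i x).
Proof.
move=> intf tpsi; have [cpsi dpsi cdpsi] := test_smooth tpsi.
have [_ [K [cK KO f0]]] := tpsi; split=> [|i].
  have [C psiC] := continuous_compact_bounded cK cpsi f0.
  by apply: (@integM _ _ _ C) => //; exact: continuous_measurableT.
have [C psiC] := continuous_compact_bounded cK (cdpsi i) (partial_off_compact i cK f0).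
by apply: (@integM _ _ _ C) => //; exact: continuous_measurableT.
Qed.

Lemma weak_partialD f g i h k : L2 Omega f -> L2 Omega g -> L2 Omega h -> L2 Omega k ->
  weak_partial Omega f i h -> weak_partial Omega g i k ->
  weak_partial Omega (fun x => f x + g x) i (fun x => h x + k x).
Proof.
move=> /L2_L1 Lf /L2_L1 Lg /L2_L1 Lh /L2_L1 Lk fh gk psi tpsi.
have [_ /(_ i) if1] := test_integ Lf tpsi; have [_ /(_ i) ig1] := test_integ Lg tpsi.
have [ih _] := test_integ Lh tpsi; have [ik _] := test_integ Lk tpsi.
under eq_Rintegral do rewrite mulrDl.
under [in RHS]eq_Rintegral do rewrite mulrDl.
by rewrite !RintegralD// fh// gk// opprD.
Qed.

Lemma H1D_cutoff f phi : H1 Omega f -> cutoff Omega phi ->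
  H1 Omega (fun x => f x + phi x).
Proof.
move=> [Lf Df] cphi; have Lphi := L2_cutoff cphi.
split; first exact: L2D.
move=> i; have [h Lh fh] := Df i; have Lp := L2_cutoff (cutoff_partial i cphi).
exists (fun x => h x + partial phi i x); first exact: L2D.
by apply: weak_partialD => //; exact: cutoff_weak_partial.
Qed.

End L2.

(** * The fundamental lemma of the calculus of variations *)

(** For balls that exhaust an open set these cut-offs increase to its indicator:
    the power k drives 1 - bump < 1 to zero. *)
Lemma ball_product_cutoff (c : nat -> E) (r : nat -> R) (k : nat) Omega :
  (forall j, cball (c j) (r j) `<=` Omega) ->
  cutoff Omega (fun x => 1 - \prod_(j < k) (1 - bump 0 (c j) (r j) x) ^+ k).
Proof.
move=> cO; split.
  apply: elementaryD; first exact: elementary_cst.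
  apply/elementaryN/elementary_prod => j; apply: elementaryX.
  apply: elementaryD; first exact: elementary_cst.
  exact/elementaryN/bump_elementary.
exists (\big[setU/set0]_(j < k) cball (c j) (r j)); split.
- elim: k => [|k IH]; first by rewrite big_ord0; exact: compact0.
  by rewrite big_ord_recr /=; apply: compactU => //; exact: compact_cball.
- rewrite -(bigcup_mkord k (fun j => cball (c j) (r j))).
  by move=> x [j _]; exact: cO.
- move=> x; rewrite -(bigcup_mkord k (fun j => cball (c j) (r j))) => nx.
  rewrite big1 ?subrr// => j _; rewrite bump_out ?subr0 ?expr1n//.
  by move=> /eball_sub_cball xj; apply: nx; exists j => //=; exact: ltn_ord.
Qed.

Section FundamentalLemma.
Variables (Omega : set E) (d : E -> R).
Hypotheses (oO : open Omega) (intd : integ Omega d).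
Hypothesis d0 : forall phi, cutoff Omega phi ->
  \int[mu]_(x in (Omega : set CT)) (d x * phi x) = 0.
Let mO : mset Omega. Proof. exact: open_lmeasurable. Qed.

(** The indicator of G is a bounded pointwise limit of cut-offs. *)
Lemma Rintegral_open0 (G : set E) : open G -> G `<=` Omega ->
  \int[mu]_(x in (G : set CT)) d x = 0.
Proof.
move=> oG GO; have mG : mset G by exact: open_lmeasurable.
have [c [r [cG GE]]] := open_bigcup_eball oG.
pose phi (k : nat) (x : E) := 1 - \prod_(j < k) (1 - bump 0 (c j) (r j) x) ^+ k.
have cphi k : cutoff G (phi k) by exact: ball_product_cutoff.
have b01 j x : 0 <= 1 - bump 0 (c j) (r j) x <= 1.
  by have /andP[b0 /ltW b1] := bump0_lt1 (c j) (r j) x; rewrite subr_ge0 b1 gerBl.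
have P01 k x : 0 <= \prod_(j < k) (1 - bump 0 (c j) (r j) x) ^+ k <= 1.
  apply/andP; split; first by apply: prodr_ge0 => j _; rewrite exprn_ge0//; case/andP: (b01 j x).
  apply: Num.Theory.prodr_ile1 => j _; have /andP[b0 b1] := b01 j x.
  by rewrite exprn_ge0//= exprn_ile1.
have iG : integ G d by exact: integrableS mO mG GO intd.
have int0 k : \int[mu]_(x in (G : set CT)) (d x * phi k x) = 0.
  have [_ [K [cK KG f0]]] := cphi k.
  rewrite Rintegral_supp; last by move=> x Gx; rewrite f0 ?mulr0// => /KG.
  rewrite -[RHS](d0 (cutoff_subset GO (cphi k))) [RHS]Rintegral_supp// => x Ox.
  by rewrite f0 ?mulr0// => /KG /GO.
have cv : \int[mu]_(x in (G : set CT)) (d x * phi k x) @[k --> \oo] -->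
    \int[mu]_(x in (G : set CT)) d x.
  apply: (@Rdominated_cvg G (fun k x => d x * phi k x) d (fun x => `|d x|) mG).
  - move=> k; apply: measurable_funM; first exact: integ_measurable.
    by apply: (continuous_measurableT mG); apply: elementary_continuous; exact: (cphi k).1.
  - move=> x; rewrite {1}GE => -[j _ xj].
    rewrite -[X in _ --> X]mulr1; apply: cvgM; first exact: cvg_cst.
    rewrite -[X in _ --> X]subr0; apply: cvgB; first exact: cvg_cst.
    pose q := 1 - bump 0 (c j) (r j) x.
    have q1 : `|q| < 1.
      have /andP[q0 _] := b01 j x; rewrite ger0_norm// /q.
      by rewrite gtrBl bump_gt0.
    have sq : \forall k \near \oo,
        0 <= \prod_(i < k) (1 - bump 0 (c i) (r i) x) ^+ k <= q ^+ k.
      near=> k; have /andP[-> _] := P01 k x; rewrite /=.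
      have jk : (j < k)%N by near: k; exact: nbhs_infty_gt.
      rewrite (bigD1 (Ordinal jk)) //= -[leRHS]mulr1 ler_wpM2l//.
        by rewrite exprn_ge0//; case/andP: (b01 j x).
      apply: Num.Theory.prodr_ile1 => i _; have /andP[b0 b1] := b01 i x.
      by rewrite exprn_ge0//= exprn_ile1.
    exact: (squeeze_cvgr sq (cvg_cst _) (cvg_expr q1)).
  - exact: integ_norm.
  - move=> k x _; rewrite normrM ler_piMr// ger0_norm.
      by have /andP[P0 _] := P01 k x; rewrite gerBl.
    by have /andP[_ P1] := P01 k x; rewrite subr_ge0.
move: cv; rewrite (_ : (fun k => _) = fun=> 0); last by apply/funext.
by move=> /cvg_lim <- //; exact: lim_cst.
Unshelve. all: by end_near. Qed.

(** By outer regularity A differs by a null set from a countable intersection of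
    open sets, whose indicator is a limit of indicators of open sets. *)
Lemma Rintegral_measurable0 (A : set E) : bounded_set Omega -> mset A ->
  A `<=` Omega -> \int[mu]_(x in (A : set CT)) d x = 0.
Proof.
move=> bO mA AO.
have Aoo : (lebesgue_outer A < +oo)%E.
  exact: le_lt_trans (le_lebesgue_outer AO) (bounded_outer_fin bO).
have /choice[G GP] : forall k, exists G : set E, [/\ open G, A `<=` G &
    (lebesgue_outer G <= lebesgue_outer A + (k.+1%:R^-1)%:E)%E].
  by move=> k; apply: outer_open.
pose H k := Omega `&` \big[setI/setT]_(j < k) G j.
have oH k : open (H k).
  apply: openI => //; elim: k => [|k IH]; first by rewrite big_ord0; exact: openT.
  by rewrite big_ord_recr; apply: openI => //; have [] := GP k.
have HO k : H k `<=` Omega by move=> x [].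
pose N : set E := Omega `&` \bigcap_j G j.
have mN : mset N.
  apply: measurableI => //; apply: bigcapT_measurable => j.
  by apply: open_lmeasurable; have [] := GP j.
have AN : A `<=` N by move=> x Ax; split; [exact: AO|move=> j _; have [_ + _] := GP j; exact].
have NA : (lebesgue_outer N <= lebesgue_outer A)%E.
  apply/lee_addgt0Pr => e e0.
  have [k _ /(_ k (leqnn k)) /= ke] := near_infty_natSinv_lt (PosNum e0).
  have [_ _ Gk] := GP k; apply: (@le_trans _ _ (lebesgue_outer (G k))).
    by apply: le_lebesgue_outer => x [_]; exact.
  by apply: (le_trans Gk); rewrite leeD2l// lee_fin ltW.
have NA0 : mu (N `\` A) = 0%E.
  have mNA : mset (N `\` A) by exact: measurableD.
  have : (lebesgue_outer A + lebesgue_outer (N `\` A) <= lebesgue_outer A)%E.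
    apply: le_trans NA.
    rewrite -[leRHS]/(mu N) -{2}(setDUK AN) measureU// setDE setIA setIAC.
    by rewrite setICr set0I.
  rewrite -[leRHS]adde0 leeD2lE; last first.
    by rewrite ge0_fin_numE ?lebesgue_outer_ge0.
  by move=> le0; apply/eqP; rewrite eq_le le0; exact: lebesgue_outer_ge0.
have restr (P : set E) : P `<=` Omega ->
    \int[mu]_(x in (Omega : set CT)) (d x * \1_P x) = \int[mu]_(x in (P : set CT)) d x.
  move=> PO; rewrite -[in RHS](setIidl PO) Rintegral_mkcondl.
  apply: eq_Rintegral => x _; rewrite patchE indicE.
  by case: (x \in P); rewrite ?mulr1 ?mulr0.
have mH k : mset (H k) by exact: open_lmeasurable.
have cv : \int[mu]_(x in (Omega : set CT)) (d x * \1_(H k) x) @[k --> \oo] -->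
    \int[mu]_(x in (Omega : set CT)) (d x * \1_N x).
  apply: (@Rdominated_cvg Omega (fun k x => d x * \1_(H k) x) _ (fun x => `|d x|) mO).
  - move=> k; apply: measurable_funM; first exact: integ_measurable.
    exact: measurable_indic.
  - move=> x Ox; apply: cvgM; first exact: cvg_cst.
    have [Nx|Nx] := pselect (N x).
      apply: cvg_near_cst; apply: nearW => k; rewrite !indicE !mem_set//.
      split => //; rewrite -bigcap_mkord => j _; exact: Nx.2.
    have [j Gj] : exists j, ~ G j x.
      by apply: contrapT => all; apply: Nx; split => // j _; apply: contrapT => nG; apply: all; exists j.
    apply: cvg_near_cst; near=> k; rewrite !indicE !memNset// => -[_].
    rewrite -bigcap_mkord => /(_ j); apply: contra_not Gj; apply => /=.
    near: k; exact: nbhs_infty_gt.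
  - exact: integ_norm.
  - move=> k x _; rewrite normrM ler_piMr// indicE.
    by case: (x \in H k); rewrite ?normr1 ?normr0.
have <- : \int[mu]_(x in (N : set CT)) d x = \int[mu]_(x in (A : set CT)) d x.
  have iN : integ N d by apply: integrableS intd => // x [].
  rewrite /Rintegral (negligible_integral _ mN iN NA0)//; last exact: measurableD.
  by rewrite setDD (setIidr AN).
rewrite -restr; last by move=> x [].
move: cv; rewrite (_ : (fun k => _) = fun=> 0); last first.
  by apply/funext => k; rewrite (restr _ (@HO k)) Rintegral_open0.
by move=> /cvg_lim <- //; exact: lim_cst.
Unshelve. all: by end_near. Qed.

Lemma fundamental_lemma : bounded_set Omega ->
  ae_eq mu (Omega : set CT) (EFin \o d) (fun=> 0%E).
Proof.
move=> bO; apply: integral_ae_eq => // A AO mA.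
rewrite integral0 -[LHS]fineK.
  by rewrite -[fine _]/(\int[mu]_(x in (A : set CT)) d x) Rintegral_measurable0.
by apply: integrable_fin_num => //; exact: integrableS mO mA AO intd.
Qed.

End FundamentalLemma.

(** * Weak derivatives of perturbed functions *)

Section WeakDerivative.
Variables (Omega : set E).
Hypotheses (oO : open Omega) (bO : bounded_set Omega).
Let mO : mset Omega. Proof. exact: open_lmeasurable. Qed.

Lemma Rintegral_ae f g : measurable_fun (Omega : set CT) f ->
  measurable_fun (Omega : set CT) g ->
  {ae mu, forall x : CT, Omega x -> f x = g x} ->
  \int[mu]_(x in (Omega : set CT)) f x = \int[mu]_(x in (Omega : set CT)) g x.
Proof.
move=> mf mg fg; rewrite /Rintegral; congr fine.
apply: ae_eq_integral => //; [exact/measurable_EFinP|exact/measurable_EFinP|].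
by apply: filterS fg => x fg Ox; rewrite fg.
Qed.

Lemma weak_D_spec f i : H1 Omega f ->
  L2 Omega (weak_D Omega f i) /\ weak_partial Omega f i (weak_D Omega f i).
Proof.
move=> [_ /(_ i)[h Lh fh]].
by apply: (@xgetPex _ (fun=> 0) [set h | L2 Omega h /\ weak_partial Omega f i h]); exists h.
Qed.

(** It allows to replace the chosen derivatives by explicit ones under the integral
    sign. *)
Lemma weak_D_ae f i h : H1 Omega f -> L2 Omega h -> weak_partial Omega f i h ->
  {ae mu, forall x : CT, Omega x -> weak_D Omega f i x = h x}.
Proof.
move=> Hf Lh fh; have [Lw fw] := weak_D_spec i Hf.
have iw := L2_L1 oO bO Lw; have ih := L2_L1 oO bO Lh.
have id : integ Omega (fun x => weak_D Omega f i x - h x) by exact: integB.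
have : ae_eq mu (Omega : set CT)
    (EFin \o (fun x => weak_D Omega f i x - h x)) (fun=> 0%E).
  apply: fundamental_lemma => // phi cphi; have tphi := cutoff_test cphi.
  under eq_Rintegral do rewrite mulrBl.
  have [i1 _] := test_integ oO iw tphi; have [i2 _] := test_integ oO ih tphi.
  rewrite RintegralB//.
  by have := fw phi tphi; rewrite fh// => /oppr_inj ->; rewrite subrr.
by apply: filterS => x + Ox => /(_ Ox)[] /eqP; rewrite subr_eq0 => /eqP.
Qed.

Lemma H1_cutoff f : cutoff Omega f -> H1 Omega f.
Proof.
move=> cf; split; first exact: L2_cutoff.
move=> i; exists (partial f i); last exact: cutoff_weak_partial.
by apply: L2_cutoff => //; exact: cutoff_partial.
Qed.

Lemma weak_D_cutoff_ae f : cutoff Omega f ->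
  {ae mu, forall x : CT, Omega x -> forall i, weak_D Omega f i x = partial f i x}.
Proof.
move=> cf.
have : forall i : 'I_n.+1, {ae mu, forall x : CT, Omega x -> weak_D Omega f i x = partial f i x}.
  move=> i; apply: weak_D_ae; [exact: H1_cutoff| |exact: cutoff_weak_partial].
  by apply: L2_cutoff => //; exact: cutoff_partial.
by move=> /filter_forall; apply: filterS => x H Ox i; exact: H.
Qed.

Lemma weak_DD_ae f phi : H1 Omega f -> cutoff Omega phi ->
  {ae mu, forall x : CT, Omega x -> forall i,
    weak_D Omega (fun x => f x + phi x) i x = weak_D Omega f i x + partial phi i x}.
Proof.
move=> Hf cphi.
have : forall i : 'I_n.+1, {ae mu, forall x : CT, Omega x ->
    weak_D Omega (fun x => f x + phi x) i x = weak_D Omega f i x + partial phi i x}.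
  move=> i; have [Lw fw] := weak_D_spec i Hf.
  have Lp : L2 Omega (partial phi i) by apply: L2_cutoff => //; exact: cutoff_partial.
  apply: weak_D_ae; [exact: H1D_cutoff|exact: L2D|].
  apply: weak_partialD => //; first exact: Hf.1.
    exact: L2_cutoff.
  exact: cutoff_weak_partial.
by move=> /filter_forall; apply: filterS => x H Ox i; exact: H.
Qed.

Lemma integ_sum (I : Type) (r : seq I) (P : pred I) (F : I -> E -> R) :
  (forall i, integ Omega (F i)) -> integ Omega (fun x => \sum_(i <- r | P i) F i x).
Proof.
move=> iF; elim: r => [|a r IH].
  by under eq_fun do rewrite big_nil; exact: integ_cst.
under eq_fun do rewrite big_cons.
by case: (P a) => //; exact: integD.
Qed.

Lemma L2_sqr f : L2 Omega f -> integ Omega (fun x => f x ^+ 2).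
Proof. by move=> /L2_integ[]. Qed.

Lemma integ_sqr_grad f : H1 Omega f -> integ Omega (sqr_grad Omega f).
Proof.
move=> Hf; apply: integ_sum => i; apply: L2_sqr.
by have [] := weak_D_spec i Hf.
Qed.

Lemma H1_sqnorm_cutoff f : cutoff Omega f -> H1_sqnorm Omega f =
  \int[mu]_(x in (Omega : set CT)) (f x ^+ 2 + \sum_i partial f i x ^+ 2).
Proof.
move=> cf; apply: Rintegral_ae.
- apply: integ_measurable; apply: integD => //; first exact/L2_sqr/L2_cutoff.
  exact/integ_sqr_grad/H1_cutoff.
- apply: integ_measurable; apply: integD => //; first exact/L2_sqr/L2_cutoff.
  by apply: integ_sum => i; apply/L2_sqr/L2_cutoff => //; exact: cutoff_partial.
- apply: filterS (weak_D_cutoff_ae cf) => x H Ox.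
  by congr (_ + _); apply: eq_bigr => i _; rewrite H.
Qed.

Lemma partialZ (c : R) f i x : elementary f ->
  partial (fun x => c * f x) i x = c * partial f i x.
Proof. by move=> ef; apply: deriveMl; exact: elementary_derivable. Qed.

Lemma H1_sqnormZ_cutoff (c : R) f : cutoff Omega f ->
  H1_sqnorm Omega (fun x => c * f x) = c ^+ 2 * H1_sqnorm Omega f.
Proof.
move=> cf; rewrite !H1_sqnorm_cutoff//; last exact: cutoffZ.
rewrite -RintegralZl//; last first.
  apply: integD => //; first exact/L2_sqr/L2_cutoff.
  by apply: integ_sum => i; apply/L2_sqr/L2_cutoff => //; exact: cutoff_partial.
apply: eq_Rintegral => x _; rewrite mulrDr exprMn mulr_sumr; congr (_ + _).
by apply: eq_bigr => i _; rewrite partialZ ?exprMn//; exact: cf.1.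
Qed.

End WeakDerivative.

(** * First variation of the functional *)

Section FirstVariation.
Context {m : nat}.
Variables (Omega : set E) (Q : E -> R) (Qmin Qmax : R) (g u : E -> 'rV[R]_m).
Hypotheses (oO : open Omega) (bO : bounded_set Omega).
Hypothesis mQ : lmeasurable_fun Omega Q.
Hypothesis Qmin0 : 0 < Qmin.
Hypothesis QQ : {ae mu, forall x : CT, Omega x -> Qmin <= Q x <= Qmax}.
Hypothesis cu : forall x, Omega x -> {for x, continuous u}.
Hypothesis umin : local_minimizer Omega Q g u.
Implicit Types (j : 'I_m) (phi : E -> R).
Let mO : mset Omega. Proof. exact: open_lmeasurable. Qed.

Definition perturb (j : 'I_m) (f : E -> R) (x : E) : 'rV[R]_m :=
  u x + f x *: delta_mx 0 j.

Lemma comp_perturb j f (i : 'I_m) : Defs.comp (perturb j f) i =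
  if i == j then (fun x => Defs.comp u i x + f x) else Defs.comp u i.
Proof.
rewrite /Defs.comp /perturb; case: eqP => [->|ij]; apply/funext => x; rewrite !mxE.
  by rewrite !eqxx /= mulr1.
by rewrite (introF eqP ij) andbF mulr0 addr0.
Qed.

Lemma comp_cvg x j : Omega x -> {for x, continuous (Defs.comp u j)}.
Proof.
move=> Ox; apply: (@continuous_comp _ _ _ u (fun z : 'rV[R]_m => z 0 j)).
  exact: cu.
exact: coord_continuous.
Qed.

Lemma open_pos : open (pos_set Omega u).
Proof.
rewrite openE => x [Ox ux].
have nO : nbhs x Omega by exact: open_nbhs_nbhs.
have cx : {for x, continuous (fun y => enorm (u y))}.
  apply: (@continuous_comp _ _ _ u (@enorm R m)); first exact: cu.
  rewrite (_ : @enorm R m = fun y : 'rV[R]_m => enorm (y - 0)); first exact: edist_continuous.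
  by apply/funext => y; rewrite subr0.
have nx : nbhs x ((fun y => enorm (u y)) @^-1` [set t | 0 < t]).
  by apply: cx; apply: open_nbhs_nbhs; split => //; exact: open_gt.
exact: filterI.
Qed.

Let S x := \sum_(j < m) sqr_grad Omega (Defs.comp u j) x +
  Q x ^+ 2 * \1_(pos_set Omega u) x.

Let Hu j : H1 Omega (Defs.comp u j).
Proof. by have [[H _ _] _] := umin; exact: H. Qed.

Lemma integ_Q2 : integ Omega (fun x => Q x ^+ 2 * \1_(pos_set Omega u) x).
Proof.
have mQ1 : measurable_fun (Omega : set CT) (fun x => Q x ^+ 2 * \1_(pos_set Omega u) x).
  apply: measurable_funM; first exact: measurable_funX.
  by apply: measurable_indic; apply: open_lmeasurable; exact: open_pos.
apply/integrableP; split; first exact/measurable_EFinP.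
apply: (@le_lt_trans _ _ (\int[mu]_(x in (Omega : set CT)) (Qmax ^+ 2)%:E)%E).
  apply: ae_ge0_le_integral.
  - exact: mO.
  - by move=> x _; exact: abse_ge0.
  - by apply: measurableT_comp; [exact: abse_measurable|exact/measurable_EFinP].
  - by move=> x _; rewrite lee_fin sqr_ge0.
  - exact: measurable_cst.
  - apply: filterS QQ => x H Ox; have /andP[Q1 Q2] := H Ox.
    have Q0 : 0 <= Q x by rewrite (le_trans (ltW Qmin0)).
    rewrite /= lee_fin normrM ger0_norm ?sqr_ge0// indicE.
    case: (x \in _); rewrite ?normr1 ?normr0 ?mulr1 ?mulr0 ?sqr_ge0//.
    by rewrite ler_pXn2r// nnegrE (le_trans Q0).
have := integ_cst oO bO (Qmax ^+ 2) => /integrableP[_]; apply: le_lt_trans.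
rewrite le_eqVlt; apply/orP; left; apply/eqP; apply: eq_integral => x _.
by rewrite /= ger0_norm ?sqr_ge0.
Qed.

Lemma integ_J : integ Omega S.
Proof.
apply: integD => //; last exact: integ_Q2.
by apply: integ_sum => // j; exact: integ_sqr_grad.
Qed.

Lemma J_Rintegral : J Omega Q u = (\int[mu]_(x in (Omega : set CT)) S x)%:E.
Proof. by rewrite /J fineK//; exact: integrable_fin_num integ_J. Qed.

(** As the set {|u| > 0} does not change, the functional is a quadratic polynomial
    along the perturbation. *)
Lemma J_perturb j phi : cutoff Omega phi ->
  pos_set Omega (perturb j phi) = pos_set Omega u ->
  J Omega Q (perturb j phi) = (\int[mu]_(x in (Omega : set CT)) S x +
    2 * \int[mu]_(x in (Omega : set CT))
          \sum_k weak_D Omega (Defs.comp u j) k x * partial phi k x +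
    \int[mu]_(x in (Omega : set CT)) \sum_k partial phi k x ^+ 2)%:E.
Proof.
move=> cphi pos.
have iD : integ Omega (fun x => \sum_k weak_D Omega (Defs.comp u j) k x * partial phi k x).
  apply: integ_sum => // k; apply: L2M => //; first by have [] := weak_D_spec k (Hu j).
  by apply: L2_cutoff => //; exact: cutoff_partial.
have ip : integ Omega (fun x => \sum_k partial phi k x ^+ 2).
  by apply: integ_sum => // k; apply/L2_sqr/L2_cutoff => //; exact: cutoff_partial.
have iJ := integ_J.
pose T x := S x + 2 * (\sum_k weak_D Omega (Defs.comp u j) k x * partial phi k x) +
  \sum_k partial phi k x ^+ 2.
have i2D : integ Omega (fun x => 2 * (\sum_k weak_D Omega (Defs.comp u j) k x * partial phi k x)).
  exact: integZ.
have iT : integ Omega T by apply: integD => //; exact: integD.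
transitivity (\int[mu]_(x in (Omega : set CT)) (T x)%:E)%E; last first.
  rewrite -[LHS]fineK; last exact: integrable_fin_num iT.
  rewrite -[fine _]/(\int[mu]_(x in (Omega : set CT)) T x) RintegralD//; last exact: integD.
  by rewrite RintegralD// RintegralZl.
have Hj : H1 Omega (fun x => Defs.comp u j x + phi x) by exact: H1D_cutoff.
apply: ae_eq_integral => //.
- apply/measurable_EFinP; apply: integ_measurable.
  apply: integD => //; last by rewrite pos; exact: integ_Q2.
  apply: integ_sum => // i; apply: integ_sqr_grad => //.
  by rewrite comp_perturb; case: eqP => [->|_].
- by apply/measurable_EFinP; exact: integ_measurable.
- apply: filterS (weak_DD_ae oO bO (Hu j) cphi) => x H Ox; congr EFin.
  rewrite pos /T /S.
  suff -> : \sum_(i < m) sqr_grad Omega (Defs.comp (perturb j phi) i) x =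
      \sum_(i < m) sqr_grad Omega (Defs.comp u i) x +
      (2 * (\sum_k weak_D Omega (Defs.comp u j) k x * partial phi k x) +
       \sum_k partial phi k x ^+ 2) by ring.
  rewrite (bigD1 j)//= [in RHS](bigD1 j)//= [RHS]addrAC; congr (_ + _).
    rewrite comp_perturb eqxx /sqr_grad mulr_sumr -!big_split /=.
    by apply: eq_bigr => k _; rewrite (H Ox); ring.
  by apply: eq_bigr => i /negbTE ij; rewrite comp_perturb ij.
Qed.

Lemma admissible_perturb j phi : cutoff Omega phi ->
  nonneg_ae Omega (perturb j phi) -> admissible Omega g (perturb j phi).
Proof.
move=> cphi nn; have [[Hu1 Hg _] _] := umin.
have comp_g (i : 'I_m) : Defs.comp (fun x => perturb j phi x - g x) i =
    if i == j then (fun x => Defs.comp (fun x => u x - g x) i x + phi x)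
    else Defs.comp (fun x => u x - g x) i.
  have /funeqP ci := comp_perturb j phi i; case: ifPn ci => _ ci; apply/funext => x;
    by have := ci x; rewrite /Defs.comp !mxE => ->; rewrite // addrAC.
split; last exact: nn.
  by move=> i; rewrite comp_perturb; case: ifP => _; [exact: H1D_cutoff|exact: Hu1].
move=> i; rewrite comp_g; case: ifP => _; last exact: Hg.
have [H1g H10g] := Hg i; split; first exact: H1D_cutoff.
move=> e e0; have [psi tpsi psie] := H10g e e0.
exists (fun x => psi x + phi x); first by apply: test_functionD => //; exact: cutoff_test.
rewrite (_ : (fun x => _) = fun x => Defs.comp (fun x => u x - g x) i x - psi x)//.
by apply/funext => x; ring.
Qed.

Lemma H1_dist_perturb j phi : cutoff Omega phi ->
  H1_norm_vec Omega (fun x => u x - perturb j phi x) =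
  Num.sqrt (H1_sqnorm Omega phi).
Proof.
move=> cphi; rewrite /H1_norm_vec (bigD1 j)//= big1 => [|i ij].
  rewrite addr0 (_ : Defs.comp _ j = fun x => (-1) * phi x).
    by rewrite H1_sqnormZ_cutoff// sqrrN expr1n mul1r.
  by apply/funext => x; rewrite /Defs.comp /perturb !mxE !eqxx /=; ring.
rewrite (_ : Defs.comp _ i = fun x => 0 * phi x).
  by rewrite H1_sqnormZ_cutoff// expr0n mul0r.
by apply/funext => x; rewrite /Defs.comp /perturb !mxE (negbTE ij) andbF /=; ring.
Qed.

(** Divide J(u) <= J(u + t phi e_j) by t > 0 and let t tend to 0; for small t the
    perturbation is within the radius of local minimality. *)
Lemma first_variation j phi (t0 : R) : cutoff Omega phi -> 0 < t0 ->
  (forall t, 0 < t < t0 -> nonneg_ae Omega (perturb j (fun x => t * phi x)) /\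
     pos_set Omega (perturb j (fun x => t * phi x)) = pos_set Omega u) ->
  0 <= \int[mu]_(x in (Omega : set CT))
         \sum_k weak_D Omega (Defs.comp u j) k x * partial phi k x.
Proof.
move=> cphi t00 ht; have [_ [eps eps0 umin']] := umin.
set B := \int[mu]_(x in _) _.
pose C := \int[mu]_(x in (Omega : set CT)) \sum_k partial phi k x ^+ 2.
have iD : integ Omega (fun x => \sum_k weak_D Omega (Defs.comp u j) k x * partial phi k x).
  apply: integ_sum => // k; apply: L2M => //; first by have [] := weak_D_spec k (Hu j).
  by apply: L2_cutoff => //; exact: cutoff_partial.
have ip : integ Omega (fun x => \sum_k partial phi k x ^+ 2).
  by apply: integ_sum => // k; apply/L2_sqr/L2_cutoff => //; exact: cutoff_partial.
pose H := Num.sqrt (H1_sqnorm Omega phi).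
have H0 : 0 <= H by exact: sqrtr_ge0.
have C0 : 0 <= C.
  by apply: Rintegral_ge0 => x _; apply: sumr_ge0 => k _; exact: sqr_ge0.
have small t : 0 < t -> t < t0 -> t * H < eps -> 0 <= 2 * B + t * C.
  move=> tp tt0 tH; have ct := cutoffZ t cphi.
  have [|nn pos] := ht t; first by rewrite tp.
  have := umin' _ (admissible_perturb ct nn).
  rewrite H1_dist_perturb// pos J_Rintegral (J_perturb ct pos).
  rewrite H1_sqnormZ_cutoff// sqrtrM ?sqr_ge0// sqrtr_sqr gtr0_norm// -/H.
  have -> : \int[mu]_(x in (Omega : set CT))
      `|\1_(pos_set Omega u) x - \1_(pos_set Omega u) x| = 0 :> R.
    under eq_Rintegral do rewrite subrr normr0.
    by rewrite Rintegral_cst// mul0r.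
  rewrite addr0 => /(_ tH); rewrite lee_fin.
  have -> : \int[mu]_(x in (Omega : set CT))
      \sum_k weak_D Omega (Defs.comp u j) k x * partial (fun y => t * phi y) k x = t * B.
    rewrite -RintegralZl//; apply: eq_Rintegral => x _; rewrite mulr_sumr.
    by apply: eq_bigr => k _; rewrite partialZ//; [ring|exact: cphi.1].
  have -> : \int[mu]_(x in (Omega : set CT))
      \sum_k partial (fun y => t * phi y) k x ^+ 2 = t ^+ 2 * C.
    rewrite -RintegralZl//; apply: eq_Rintegral => x _; rewrite mulr_sumr.
    by apply: eq_bigr => k _; rewrite partialZ ?exprMn//; exact: cphi.1.
  rewrite -addrA lerDl (_ : _ + _ = t * (2 * B + t * C)); last by ring.
  by rewrite pmulr_rge0.
rewrite leNgt; apply/negP => B0.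
have H1 : 0 < H + 1 by rewrite ltr_wpDl.
have C1 : 0 < C + 1 by rewrite ltr_wpDl.
(* Small enough to be allowed, to stay close to u, and for the linear term 2 B t
   to dominate the quadratic one. *)
pose t := Num.min (t0 / 2) (Num.min (eps / (H + 1) / 2) (- B / (C + 1))).
have tp : 0 < t by rewrite !lt_min !divr_gt0// oppr_gt0.
have t1 : t <= t0 / 2 by rewrite /t ge_min lexx.
have t2 : t <= eps / (H + 1) / 2 by rewrite /t !ge_min lexx orbT.
have t3 : t <= - B / (C + 1) by rewrite /t !ge_min lexx !orbT.
have tt0 : t < t0 by lra.
have tH : t * H < eps.
  have : t * (H + 1) <= eps / 2 by rewrite -ler_pdivlMr// mulrAC.
  by rewrite mulrDr; lra.
have tC : t * (C + 1) <= - B by rewrite -ler_pdivlMr.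
by have := small t tp tt0 tH; rewrite mulrDr in tC; lra.
Qed.

End FirstVariation.


(** * Radial kernels *)

Definition lap f (x : E) : R := \sum_i partial (partial f i) i x.

(** With s = sigma ^ 2 the support is the closed ball of radius 1 / sigma. *)
Definition rad (k : nat) (s : R) (c y : E) : R := flat k (1 - s * sqnorm (y - c)).

Definition dflat (k : nat) (t : R) : R := flat k.+2 t - k%:R * flat k.+1 t.

Lemma rad_elementary k s c : elementary (rad k s c).
Proof.
apply: elementary_flat; apply: elementaryD; first exact: elementary_cst.
apply/elementaryN/elementaryM; first exact: elementary_cst.
exact: elementary_sqdist.
Qed.

Lemma is_derive_sqdist (c x : E) i :
  is_derive x (delta_mx 0 i) (fun y => sqnorm (y - c)) (2 * (x 0 i - c 0 i)).
Proof.
have coord (j : 'I_n.+1) : is_derive x (delta_mx 0 i : E)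
    (fun y : E => (y 0 j - c 0 j) ^+ 2) (2 * (x 0 j - c 0 j) * (i == j)%:R).
  have d := is_deriveB (is_derive_coord j x (delta_mx 0 i)) (is_derive_cst (c 0 j) x (delta_mx 0 i)).
  have := is_deriveX 2 d; move=> d2; apply: (is_derive_eq d2).
  by rewrite !fctE mxE /= expr1 subr0 /GRing.scale /= eq_sym.
rewrite (_ : (fun y : E => sqnorm (y - c)) =
    \sum_(j < n.+1) (fun y : E => (y 0 j - c 0 j) ^+ 2)); last first.
  apply/funext => y; rewrite /sqnorm fct_sumE.
  by apply: eq_bigr => j _; rewrite !mxE.
apply: (is_derive_eq (is_derive_sum coord)).
rewrite (bigD1 i) //= eqxx mulr1 big1 ?addr0// => j /negbTE ji.
by rewrite eq_sym ji mulr0.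
Qed.

Lemma is_derive_rad k s c x i : is_derive x (delta_mx 0 i) (rad k s c)
  (dflat k (1 - s * sqnorm (x - c)) * (- (2 * s) * (x 0 i - c 0 i))).
Proof.
have dZ := is_deriveM (is_derive_cst s x (delta_mx 0 i : E)) (is_derive_sqdist c x i).
have dB := is_deriveB (is_derive_cst (1 : R) x (delta_mx 0 i : E)) dZ.
have := is_derive_flat_comp k dB; move=> d; apply: (is_derive_eq d).
by rewrite !fctE /GRing.scale /= /dflat; ring.
Qed.

Lemma partial_rad k s c i : partial (rad k s c) i =
  fun x => (rad k.+2 s c x - k%:R * rad k.+1 s c x) * (- (2 * s) * (x 0 i - c 0 i)).
Proof. by apply/funext => x; have [_] := is_derive_rad k s c x i. Qed.

Lemma lap_rad k s c x : lap (rad k s c) x =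
  4 * s ^+ 2 * sqnorm (x - c) *
    (dflat k.+2 (1 - s * sqnorm (x - c)) - k%:R * dflat k.+1 (1 - s * sqnorm (x - c)))
  - 2 * s * n.+1%:R * dflat k (1 - s * sqnorm (x - c)).
Proof.
pose q := 1 - s * sqnorm (x - c).
have pp i : partial (partial (rad k s c) i) i x =
    (dflat k.+2 q - k%:R * dflat k.+1 q) * (4 * s ^+ 2 * (x 0 i - c 0 i) ^+ 2) -
    2 * s * dflat k q.
  rewrite partial_rad.
  have d2 := is_derive_rad k.+2 s c x i.
  have d1 := is_deriveM (is_derive_cst (k%:R : R) x (delta_mx 0 i : E)) (is_derive_rad k.+1 s c x i).
  have dl := is_deriveM (is_derive_cst (- (2 * s)) x (delta_mx 0 i : E))
     (is_deriveB (is_derive_coord i x (delta_mx 0 i)) (is_derive_cst (c 0 i) x (delta_mx 0 i))).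
  have [_ dd] := is_deriveM (is_deriveB d2 d1) dl.
  etransitivity; first exact: dd.
  rewrite !fctE /GRing.scale /= mxE !eqxx /= /rad -/q /dflat.
  by rewrite /dflat; ring.
rewrite /lap (eq_bigr _ (fun i _ => pp i)) big_split /= -mulr_sumr -mulr_sumr.
have -> : \sum_(i < n.+1) (x 0 i - c 0 i) ^+ 2 = sqnorm (x - c).
  by apply: eq_bigr => i _; rewrite !mxE.
rewrite sumr_const card_ord -/q -[_ *+ n.+1]mulr_natr; ring.
Qed.

Lemma lap0 K f : compact K -> (forall x, ~ K x -> f x = 0) ->
  forall x, ~ K x -> lap f x = 0.
Proof.
move=> cK f0 x Kx; apply: big1 => i _.
by apply: (partial_off_compact i cK) => //; exact: partial_off_compact.
Qed.

Lemma rad_out k (sigma : R) c x : 0 < sigma -> ~ cball c sigma^-1 x ->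
  rad k (sigma ^+ 2) c x = 0.
Proof.
move=> s0 xs; apply: flat_eq0; rewrite subr_le0 -sqr_enorm -exprMn.
rewrite -[leLHS](expr1n _ 2) ler_pXn2r ?nnegrE ?mulr_ge0 ?enorm_ge0 ?(ltW s0)//.
by rewrite -ler_pdivrMl// mulr1; apply/ltW; rewrite ltNge; apply/negP.
Qed.

Lemma rad_cutoff k (sigma : R) c D : 0 < sigma -> cball c sigma^-1 `<=` D ->
  cutoff D (rad k (sigma ^+ 2) c).
Proof.
move=> s0 cD; split; first exact: rad_elementary.
exists (cball c sigma^-1); split => //; first exact: compact_cball.
by move=> x; exact: rad_out.
Qed.

(** The power of sigma makes the integral independent of the scale, see
    [average1]. *)
Definition ker (sigma : R) (c y : E) : R := sigma ^+ n.+1 * rad 2 (sigma ^+ 2) c y.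

Lemma ker_cutoff (sigma : R) c D : 0 < sigma -> cball c sigma^-1 `<=` D ->
  cutoff D (ker sigma c).
Proof. by move=> s0 cD; apply: cutoffZ; exact: rad_cutoff. Qed.

Lemma ker_ge0 sigma c y : 0 <= sigma -> 0 <= ker sigma c y.
Proof. by move=> s0; rewrite mulr_ge0 ?exprn_ge0// flat_ge0. Qed.

Lemma ker_gt0 sigma c y : 0 < sigma -> eball c sigma^-1 y -> 0 < ker sigma c y.
Proof.
move=> s0 yc; rewrite mulr_gt0 ?exprn_gt0// flat_gt0// subr_gt0.
rewrite -sqr_enorm -exprMn -(expr1n _ 2) ltr_pXn2r ?nnegrE ?mulr_ge0 ?enorm_ge0 ?(ltW s0)//.
by rewrite -ltr_pdivlMl// mulr1.
Qed.

(** The profile flat 2 is chosen so that the scaling derivative is exactly a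
    Laplacian; this makes averages against the kernel monotone in the scale. *)
Lemma is_derive_ker (sigma : R) c y : 0 < sigma ->
  is_derive sigma (1 : R) (fun s => ker s c y)
    (- (sigma ^+ n.+1 / (2 * sigma ^+ 3)) * lap (rad 0 (sigma ^+ 2) c) y).
Proof.
move=> s0; pose rho := sqnorm (y - c).
have did := @is_derive_id _ _ (sigma : R^o) (1 : R).
have dq : is_derive sigma (1 : R) (fun s : R => 1 - s ^+ 2 * rho) (- (2 * sigma * rho)).
  have d := is_deriveB (is_derive_cst (1 : R) sigma (1 : R))
    (is_deriveM (is_deriveX 2 did) (is_derive_cst rho sigma (1 : R))).
  by apply: (is_derive_eq d); rewrite !fctE /GRing.scale /=; ring.
have dk := is_deriveM (is_deriveX n.+1 did) (is_derive_flat_comp 2 dq).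
rewrite (_ : (fun s => ker s c y) =
    (id : R -> R) ^+ n.+1 * (fun s => flat 2 (1 - s ^+ 2 * rho))); last first.
  by apply/funext => s; rewrite !fctE.
apply: (is_derive_eq dk); rewrite !fctE /GRing.scale /= lap_rad -/rho.
rewrite /dflat !exprS; field; by rewrite gt_eqF.
Qed.


(** * Averages of super-solutions *)

Lemma ler_norm_dflat k t : `|dflat k t| <= k.+2`!%:R + k%:R * k.+1`!%:R.
Proof.
rewrite /dflat (le_trans (ler_normB _ _))// lerD//.
  by rewrite ger0_norm ?flat_ge0// flat_le.
by rewrite normrM ger0_norm// ler_wpM2l// ger0_norm ?flat_ge0// flat_le.
Qed.

Lemma ler_norm_lap_rad0 (s c0 : R) c y : 0 <= s -> sqnorm (y - c) <= c0 ->
  `|lap (rad 0 s c) y| <= 4 * s ^+ 2 * c0 * (4`!%:R + 2 * 3`!%:R) +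
    2 * s * n.+1%:R * 2`!%:R.
Proof.
move=> s0 yc; rewrite lap_rad mul0r subr0 (le_trans (ler_normB _ _))// lerD//.
  rewrite normrM ler_pM// ?ler_norm_dflat// normrM ler_pM//.
    by rewrite ger0_norm// mulr_ge0// sqr_ge0.
  by rewrite ger0_norm// sqnorm_ge0.
rewrite normrM ler_pM//; first by rewrite ger0_norm// !mulr_ge0.
by apply: (le_trans (ler_norm_dflat 0 _)); rewrite mul0r addr0.
Qed.

Lemma cutoff_lap D f : cutoff D f -> cutoff D (lap f).
Proof.
move=> [ef [K [cK KD f0]]]; split.
  by apply: elementary_sum => i; do 2!apply: elementary_partial.
by exists K; split => //; exact: lap0.
Qed.

Section Averages.
Variables (D : set E) (f : E -> R).
Hypotheses (oD : open D) (cf : forall x, D x -> {for x, continuous f}).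

Lemma integ_on_compact K : compact K -> K `<=` D -> integ K f.
Proof.
move=> cK KD; have mK := mset_compact cK.
have : compact (f @` K).
  apply: continuous_compact => //; apply: continuous_in_subspaceT => x.
  by rewrite inE => /KD; exact: cf.
move=> /compact_bounded[M [_ HM]].
apply: (@integ_bounded _ _ _ _ (`|M| + 1) mK).
- exact: compact_outer_fin.
- apply: (measurable_funS (open_lmeasurable oD) KD).
  exact: continuous_lmeasurable.
- move=> x Kx; apply: HM; last by exists x.
  by rewrite (le_lt_trans (ler_norm _))// ltrDl.
Qed.

Lemma integ_fM K g : compact K -> K `<=` D -> continuous g ->
  (forall x, ~ K x -> g x = 0) -> integ setT (fun x => f x * g x).
Proof.
move=> cK KD cg g0; have mK := mset_compact cK.
have [C gC] := continuous_compact_bounded cK cg g0.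
have : integ K (fun x => f x * g x).
  apply: (@integM _ _ _ C mK) => //; first exact: integ_on_compact.
  exact: continuous_measurableT.
rewrite -[X in mu.-integrable X](setTI (K : set CT)) integrable_restrict//.
rewrite (_ : (_ \_ _) = EFin \o (fun x => f x * g x))//; apply/funext => x.
rewrite patchE /=.
by case: ifPn => // /negP; rewrite inE => /g0 ->; rewrite mulr0.
Qed.

Lemma integ_cutoffM phi : cutoff D phi -> integ setT (fun x => f x * phi x).
Proof.
by move=> [/elementary_continuous cphi [K [cK KD f0]]]; exact: (integ_fM cK KD cphi f0).
Qed.

Definition average (sigma : R) (c : E) : R :=
  \int[mu]_y (f (y : E) * ker sigma c y).

(** Differentiation under the integral sign; the derivative of the kernel is
    bounded uniformly for scales between a and b. *)
Lemma is_derive_average c (r sigma : R) : 0 < r -> eball c r `<=` D -> r^-1 < sigma ->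
  is_derive sigma (1 : R) (average ^~ c)
    (- (sigma ^+ n.+1 / (2 * sigma ^+ 3)) *
     \int[mu]_y (f (y : E) * lap (rad 0 (sigma ^+ 2) c) y)).
Proof.
move=> r0 cD rs; have ri0 : 0 < r^-1 by rewrite invr_gt0.
have [a [b [ra as_ sb]]] : exists a b : R, [/\ r^-1 < a, a < sigma & sigma < b].
  by exists ((r^-1 + sigma) / 2), (sigma + 1); split; lra.
have a0 : 0 < a by exact: lt_trans ra.
have s0 : 0 < sigma by exact: lt_trans as_.
pose K : set E := cball c a^-1.
have cK : compact K by exact: compact_cball.
have KD : K `<=` D.
  apply: subset_trans cD; apply: cball_sub_eball.
  by rewrite -[r]invrK ltf_pV2 ?posrE.
have mK := mset_compact cK.
have iK := integ_on_compact cK KD.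
have off (s : R) k y : a < s -> ~ K y -> rad k (s ^+ 2) c y = 0.
  move=> as' Ky; apply: rad_out; first exact: lt_trans as'.
  apply: contra_not Ky => /le_trans; apply.
  by rewrite lef_pV2 ?posrE// ?ltW// (lt_trans a0).
have I0 : (`]a, b[%classic : set R) sigma by rewrite /= in_itv /= as_.
pose F (s : R) (y : CT) : R := f y * ker s c y.
pose dF (s : R) (y : E) : R :=
  f y * (- (s ^+ n.+1 / (2 * s ^+ 3)) * lap (rad 0 (s ^+ 2) c) y).
have dFP (s : R) y : a < s -> is_derive s (1 : R) (F ^~ y) (dF s y).
  move=> as'; have dk := @is_derive_ker s c y (lt_trans a0 as').
  have d := is_deriveM (is_derive_cst (f y) s (1 : R)) dk.
  by apply: (is_derive_eq d); rewrite scaler0 addr0.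
have d1F (s : R) y : a < s -> partial1of2 F s y = dF s y.
  by move=> as'; rewrite partial1of2E; have [_] := dFP s y as'.
have iF (s : R) : `]a, b[%classic s -> integ K (F s).
  move=> sI; have /andP[as' _] : a < s < b by move: sI; rewrite /= in_itv.
  apply: (integrableS measurableT mK (@subsetT _ _)).
  apply: (integ_fM cK KD); last by move=> y Ky; rewrite /ker off// mulr0.
  apply: elementary_continuous; apply: elementaryM; first exact: elementary_cst.
  exact: rad_elementary.
have dF1 (s : R) (y : CT) : `]a, b[%classic s -> K y -> derivable (F ^~ y) s 1.
  by rewrite /= in_itv /= => /andP[as' _] _; have [] := dFP s y as'.
pose C := b ^+ n.+1 / (2 * a ^+ 3) *
  (4 * (b ^+ 2) ^+ 2 * (a^-1 ^+ 2) * (4`!%:R + 2 * 3`!%:R) +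
   2 * b ^+ 2 * n.+1%:R * 2`!%:R).
have b0 : 0 < b by exact: lt_trans sb.
have C0 : 0 <= C.
  have [a0' b0'] : 0 <= a^-1 /\ 0 <= b by rewrite invr_ge0 !ltW.
  by rewrite /C; do ?[exact: ler0n|exact: a0'|exact: b0'|apply: divr_ge0|
    apply: mulr_ge0|apply: addr_ge0|apply: exprn_ge0|exact: ltW].
have G0 (y : CT) : 0 <= C * `|f y| by rewrite mulr_ge0.
have iG : integ K (fun y => C * `|f y|) by apply: integZ => //; exact: integ_norm.
have FG (s : R) (y : CT) : `]a, b[%classic s -> K y ->
    `|partial1of2 F s y| <= C * `|f y|.
  rewrite /= in_itv /= => /andP[as' s'b] Ky; rewrite d1F// /dF normrM mulrC.
  have s'0 : 0 < s by exact: lt_trans as'.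
  rewrite ler_wpM2r// normrM normrN ler_pM//.
    rewrite ger0_norm ?divr_ge0 ?mulr_ge0 ?exprn_ge0 ?(ltW s'0)//.
    rewrite ler_pM ?invr_ge0 ?mulr_ge0 ?exprn_ge0 ?(ltW s'0)//.
      by rewrite ler_pXn2r ?nnegrE ?(ltW s'0) ?(ltW b0) ?(ltW s'b).
    rewrite lef_pV2 ?posrE ?mulr_gt0 ?exprn_gt0//.
    by rewrite ler_pM2l// ler_pXn2r ?nnegrE ?(ltW s'0) ?(ltW a0) ?(ltW as').
  have yc : sqnorm (y - c) <= a^-1 ^+ 2.
    by rewrite -sqr_enorm ler_pXn2r ?nnegrE ?enorm_ge0 ?invr_ge0 ?(ltW a0).
  apply: (le_trans (ler_norm_lap_rad0 (sqr_ge0 s) yc)).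
  have s2b2 : s ^+ 2 <= b ^+ 2.
    by rewrite ler_pXn2r ?nnegrE ?(ltW s'0) ?(ltW b0) ?(ltW s'b).
  rewrite lerD//.
    apply: ler_wpM2r; first by rewrite addr_ge0.
    apply: ler_wpM2r; first exact: sqr_ge0.
    by apply: ler_wpM2l => //; rewrite ler_pXn2r ?nnegrE ?sqr_ge0.
  by do 2!apply: ler_wpM2r => //; apply: ler_wpM2l.
have dd := derivable_under_integral mK I0 iF dF1 G0 iG FG.
have ee := differentiation_under_integral mK I0 iF dF1 G0 iG FG.
have nE : \forall s \near sigma,
    \int[mu]_(y in (K : set CT)) F s y = average s c.
  have : nbhs sigma (`]a, b[%classic : set R).
    by apply: open_nbhs_nbhs; split => //; exact: interval_open.
  apply: filterS => s; rewrite /= in_itv /= => /andP[as' _].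
  by rewrite Rintegral_supp// => y Ky; rewrite /F /ker off// !mulr0.
have d0 : is_derive sigma (1 : R) (fun s => \int[mu]_(y in (K : set CT)) F s y)
    (\int[mu]_(y in (K : set CT)) dF sigma y).
  split => //; rewrite -derive1E ee; apply: eq_Rintegral => y _.
  exact: d1F.
apply: (is_derive_eq (near_eq_is_derive nE d0)).
have cP : cutoff D (rad 0 (sigma ^+ 2) c).
  apply: rad_cutoff => //; apply: subset_trans KD => y /le_trans; apply.
  by rewrite lef_pV2 ?posrE// ltW.
rewrite -RintegralZl//; last exact: (integ_cutoffM (cutoff_lap cP)).
rewrite Rintegral_supp; last first.
  move=> y Ky; rewrite /dF (lap0 cK)// ?mulr0//.
  by move=> z Kz; exact: off.
by apply: eq_Rintegral => y _; rewrite /dF; ring.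
Qed.

Definition supersolution := forall phi, cutoff D phi -> (forall x, 0 <= phi x) ->
  \int[mu]_y (f (y : E) * lap phi y) <= 0.

(** The derivative of the average in the scale is a negative factor times the
    integral of f against the Laplacian of a nonnegative cut-off. *)
Lemma average_mono c (r a b : R) : supersolution -> 0 < r -> eball c r `<=` D ->
  r^-1 < a -> a <= b -> average a c <= average b c.
Proof.
move=> sf r0 cD ra ab; have ri0 : 0 < r^-1 by rewrite invr_gt0.
have da (s : R) : s \in `[a, b] -> r^-1 < s.
  by rewrite in_itv /= => /andP[? _]; exact: lt_le_trans ra _.
have dA (s : R) : s \in `]a, b[ -> is_derive s (1 : R) (average ^~ c)
    (- (s ^+ n.+1 / (2 * s ^+ 3)) * \int[mu]_y (f (y : E) * lap (rad 0 (s ^+ 2) c) y)).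
  by move=> /subset_itv_oo_cc /da; exact: is_derive_average.
have cA : {within `[a, b], continuous (average ^~ c)}.
  apply: derivable_within_continuous => s /da rs.
  by have [] := is_derive_average r0 cD rs.
have [x /da rs /eqP] := MVT_segment ab dA cA.
rewrite subr_eq => /eqP ->; rewrite lerDr mulr_ge0 ?subr_ge0//.
have x0 : 0 < x by exact: lt_trans rs.
rewrite mulNr oppr_ge0 pmulr_rle0; last first.
  by rewrite divr_gt0 ?mulr_gt0 ?exprn_gt0.
apply: sf; last by move=> y; exact: flat_ge0.
apply: rad_cutoff => //; apply: subset_trans cD; apply: cball_sub_eball.
by rewrite -[r]invrK ltf_pV2 ?posrE.
Qed.

End Averages.

(** * Mean values and the strong minimum principle *)

Lemma Rintegral_sum D (I : Type) (r : seq I) (F : I -> E -> R) : mset D ->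
  (forall i, integ D (F i)) ->
  integ D (fun x => \sum_(i <- r) F i x) /\
  \int[mu]_(x in (D : set CT)) (\sum_(i <- r) F i (x : E)) =
    \sum_(i <- r) \int[mu]_(x in (D : set CT)) F i (x : E).
Proof.
move=> mD iF; elim: r => [|a r [IH1 IH2]].
  under eq_fun do rewrite big_nil.
  rewrite big_nil Rintegral_cst// mul0r; split => //.
  exact: integrable0.
under eq_fun do rewrite big_cons.
rewrite big_cons; split; first exact: integD.
by rewrite RintegralD// IH2.
Qed.

Lemma cutoff_integ phi : cutoff setT phi -> integ setT phi.
Proof.
by move=> [/elementary_continuous cphi [K [cK _ f0]]]; exact: (integ_compact cK cphi f0).
Qed.

Lemma Rintegral_lap0 phi : cutoff setT phi -> \int[mu]_x lap phi x = 0.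
Proof.
move=> cphi; rewrite /lap.
have [_ ->] := @Rintegral_sum setT _ (index_enum 'I_n.+1)
  (fun i => partial (partial phi i) i) measurableT
  (fun i => cutoff_integ (cutoff_partial i (cutoff_partial i cphi))).
apply: big1 => i _; have [ep [K [cK _ f0]]] := cutoff_partial i cphi.
apply: (Rintegral_partial0 cK f0).
- exact: elementary_continuous.
- by move=> x; exact: elementary_derivable.
- exact/elementary_continuous/elementary_partial.
Qed.

Lemma Rintegral_gt0 g (d : R) U : integ setT g -> (forall x, 0 <= g x) -> 0 < d ->
  open U -> U !=set0 -> (forall x, U x -> d <= g x) -> 0 < \int[mu]_x g x.
Proof.
move=> ig g0 d0 oU [x Ux] dg; have [r r0 xU] := open_eballP oU Ux.
pose B : set E := eball x r; have mB : mset B by exact: measurable_eball.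
have Boo : (lebesgue_outer B < +oo)%E by apply: bounded_outer_fin; exact: bounded_eball.
have iB : integ B (fun=> d).
  apply: (@integ_bounded _ _ _ _ `|d| mB) => //; exact: measurable_cst.
apply: (@lt_le_trans _ _ (\int[mu]_(y in (B : set CT)) d)).
  rewrite Rintegral_cst// mulr_gt0//.
  apply: fine_gt0; rewrite Boo andbT; apply: open_gt0; first exact: open_eball.
  by exists x; exact: eball_center.
apply: (@le_trans _ _ (\int[mu]_(y in (B : set CT)) g y)).
  apply: le_Rintegral => //; first exact: integrableS ig.
  by move=> y /xU; exact: dg.
rewrite -(setTI (B : set CT)) Rintegral_mkcondr.
have -> : g \_ B = fun y => g y * \1_B y.
  by apply/funext => y; rewrite patchE indicE; case: ifP; rewrite ?mulr1 ?mulr0.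
have B1 (y : E) : `|\1_B y : R| <= 1.
  by rewrite indicE; case: (y \in B); rewrite ?normr1 ?normr0.
apply: le_Rintegral => //.
  by apply: (@integM _ _ _ 1 measurableT ig) => //; exact: measurable_indic.
by move=> y _; rewrite ler_piMr// (le_trans (ler_norm _)).
Qed.

Definition mass : R := average (fun=> 1) 1 0.

Lemma kerE (sigma : R) c y : ker sigma c y = ker sigma 0 (c - y).
Proof. by rewrite /ker /rad subr0 -sqnormN opprB. Qed.

(** Translations reduce to the centre 0.  Both 1 and -1 are super-solutions, so the
    average of 1 is at once increasing and decreasing in the scale. *)
Lemma average1 (sigma : R) c : 0 < sigma -> average (fun=> 1) sigma c = mass.
Proof.
move=> s0.
have shift a : 0 < a -> average (fun=> 1) a c = average (fun=> 1) a 0.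
  move=> a0; rewrite /average -[LHS](@Rintegral_shift _ _ (fun y => 1 * ker a c y) c).
    by apply: eq_Rintegral => y _; rewrite /ker /rad addrK subr0.
  by apply: cutoff_integ; apply: cutoffZ; apply: ker_cutoff.
have cst1 (e : R) (x : E) : setT x -> {for x, continuous (fun=> e : R)}.
  by move=> _; exact: cst_continuous.
have sup1 (e : R) : supersolution setT (fun=> e).
  move=> phi cphi _; rewrite RintegralZl//; last exact/cutoff_integ/cutoff_lap.
  by rewrite Rintegral_lap0// mulr0.
have avN a : 0 < a -> average (fun=> -1) a 0 = - average (fun=> 1) a 0.
  move=> a0; rewrite /average -[RHS]mulN1r -RintegralZl//.
    by apply: eq_Rintegral => y _; rewrite mul1r.
  by apply: cutoff_integ; apply: cutoffZ; apply: ker_cutoff.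
have le_av (e a b : R) : 0 < a -> a <= b ->
    average (fun=> e) a 0 <= average (fun=> e) b 0.
  move=> a0 ab; have ra : (2 / a)^-1 < a by rewrite invf_div; lra.
  have r0 : 0 < 2 / a by rewrite divr_gt0.
  have e0T : eball (0 : E) (2 / a) `<=` setT by [].
  exact: (average_mono openT (@cst1 e) (sup1 e) r0 e0T ra ab).
have mono (a b : R) : 0 < a -> a <= b -> average (fun=> 1) a 0 = average (fun=> 1) b 0.
  move=> a0 ab; have b0 : 0 < b by exact: lt_le_trans ab.
  have := le_av (-1) a b a0 ab; rewrite (avN a a0) (avN b b0) lerN2 => le1.
  by apply/eqP; rewrite eq_le le1 (le_av 1 a b a0 ab).
apply: (eq_trans (shift sigma s0)).
case: (lerP sigma 1) => [s1|/ltW s1]; first exact: (mono sigma 1 s0 s1).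
exact: (esym (mono 1 sigma ltr01 s1)).
Qed.

Lemma mass_gt0 : 0 < mass.
Proof.
have k0 := @ker_gt0 1 0 0 ltr01; have cc : eball (0 : E) 1^-1 0.
  by rewrite invr1; exact: eball_center.
have ck : cutoff setT (ker 1 0) by exact: ker_cutoff.
apply: (@Rintegral_gt0 _ (ker 1 0 0 / 2) ((ker 1 0) @^-1` [set t | ker 1 0 0 / 2 < t])).
- by apply: cutoff_integ; exact: cutoffZ.
- by move=> y; rewrite mul1r ker_ge0.
- by rewrite divr_gt0// k0.
- apply: open_comp; last exact: open_gt.
  by move=> y _; apply: elementary_continuous; exact: ck.1.
- by exists 0 => /=; rewrite ltr_pdivrMr// ltr_pMr ?k0// ltr1n.
- by move=> y /= /ltW; rewrite mul1r.
Qed.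

Section MeanValue.
Variables (D : set E).
Hypothesis oD : open D.

(** The average increases with the scale, and at large scales it is close to
    mass * f c because f is continuous at c. *)
Lemma mean_value_le f c (r sigma : R) : (forall x, D x -> {for x, continuous f}) ->
  supersolution D f -> 0 < r -> eball c r `<=` D -> r^-1 < sigma ->
  average f sigma c <= mass * f c.
Proof.
move=> cf sf r0 cD rs; have ri0 : 0 < r^-1 by rewrite invr_gt0.
have s0 : 0 < sigma by exact: lt_trans rs.
have Dc : D c by apply: cD; exact: eball_center.
have m0 := mass_gt0.
suff H (e : R) : 0 < e -> average f sigma c <= mass * (f c + e).
  apply/ler_addgt0Pr => e e0; have := H (e / mass) (divr_gt0 e0 m0).
  by rewrite mulrDr mulrCA divff ?mulr1// gt_eqF.
move=> e0.
have [d d0 fd] : exists2 d : R, 0 < d & forall y, eball c d y -> f y < f c + e.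
  have nf : nbhs c (f @^-1` [set t | t < f c + e]).
    by apply: (cf c Dc); apply: open_nbhs_nbhs; split; [exact: open_lt|rewrite /= ltrDl].
  have [d d0 cd] := open_eballP (@open_interior _ (f @^-1` [set t | t < f c + e])) nf.
  by exists d => // y /cd /interior_subset.
(* A scale above sigma at which the kernel is supported in the ball where
   f < f c + e. *)
pose b := Num.max sigma (2 / d).
have sb : sigma <= b by rewrite le_max lexx.
have b0 : 0 < b by exact: lt_le_trans sb.
have bd : b^-1 < d.
  rewrite -[d]invrK ltf_pV2 ?posrE ?invr_gt0//.
  apply: (@lt_le_trans _ _ (2 / d)); last by rewrite le_max lexx orbT.
  by rewrite ltr_pMl ?invr_gt0// ltr1n.
have rb : r^-1 < b by exact: lt_le_trans sb.
have bD : cball c b^-1 `<=` D.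
  apply: subset_trans cD; apply: cball_sub_eball.
  by rewrite -[r]invrK ltf_pV2 ?posrE.
apply: (le_trans (average_mono oD cf sf r0 cD rs sb)).
have ck : cutoff D (ker b c) by exact: ker_cutoff.
have cT : cutoff setT (ker b c) by exact: ker_cutoff.
rewrite -(average1 c b0) mulrC /average -RintegralZl//; last first.
  exact: (cutoff_integ (cutoffZ 1 cT)).
apply: le_Rintegral => //.
- exact: (integ_cutoffM oD cf ck).
- exact: (cutoff_integ (cutoffZ _ (cutoffZ 1 cT))).
- move=> y _; rewrite mul1r.
  have [yc|yc] := pselect (cball c b^-1 y).
    rewrite ler_wpM2r ?ker_ge0 ?(ltW b0)//; apply/ltW/fd.
    exact: cball_sub_eball bd _ yc.
  by rewrite /ker rad_out// !mulr0.
Qed.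

(** At a zero c of f the average of f >= 0 is at most mass * f c = 0, so f vanishes
    near c; the zeros thus form an open and closed subset of D. *)
Lemma strong_minimum f : connected D -> (forall x, D x -> {for x, continuous f}) ->
  supersolution D f -> (forall x, D x -> 0 <= f x) ->
  (forall x, D x -> 0 < f x) \/ (forall x, D x -> f x = 0).
Proof.
move=> conD cf sf f0.
have near0 c : D c -> f c = 0 -> exists2 r : R, 0 < r &
    eball c r `<=` D /\ forall y, eball c r y -> f y = 0.
  move=> Dc fc; have [r r0 cD] := open_eballP oD Dc.
  have ri0 : 0 < r^-1 by rewrite invr_gt0.
  pose s := 2 / r; have rs : r^-1 < s by rewrite /s ltr_pMl// ltr1n.
  have s0 : 0 < s by exact: lt_trans rs.
  have sD : eball c s^-1 `<=` D.
    apply: subset_trans cD; apply: subset_eball.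
    by rewrite -[r]invrK lef_pV2 ?posrE// ltW.
  have sD' : cball c s^-1 `<=` D.
    apply: subset_trans cD; apply: cball_sub_eball.
    by rewrite -[r]invrK ltf_pV2 ?posrE.
  exists s^-1; first by rewrite invr_gt0.
  split => // y yc; apply/eqP; rewrite eq_le f0 ?andbT; last exact: sD.
  rewrite leNgt; apply/negP => fy0.
  have := mean_value_le cf sf r0 cD rs; rewrite fc mulr0 leNgt => /negP; apply.
  have ck : cutoff D (ker s c) by exact: ker_cutoff.
  pose h z := f z * ker s c z.
  have hy : 0 < h y by rewrite mulr_gt0// ker_gt0.
  have ch : {for y, continuous h}.
    apply: (@cvgM _ _ _ (nbhs_filter y)); first exact: cf (sD _ yc).
    by apply: elementary_continuous; exact: ck.1.
  apply: (@Rintegral_gt0 h (h y / 2) (interior (h @^-1` [set t | h y / 2 < t]))).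
  - exact: (integ_cutoffM oD cf ck).
  - move=> z; have [zc|zc] := pselect (cball c s^-1 z).
      by rewrite mulr_ge0 ?ker_ge0 ?(ltW s0)// f0//; exact: sD'.
    by rewrite /h /ker rad_out// !mulr0.
  - by rewrite divr_gt0.
  - exact: open_interior.
  - exists y; apply: ch; apply: open_nbhs_nbhs; split; first exact: open_gt.
    by rewrite /= ltr_pdivrMr// ltr_pMr// ltr1n.
  - by move=> z /interior_subset /ltW.
have [[c Dc fc]|none] := pselect (exists2 c, D c & f c = 0); last first.
  left => x Dx; rewrite lt_neqAle f0// andbT; apply/eqP => fx.
  by apply: none; exists x.
right; pose Z := D `&` [set x | f x = 0].
suff ZD : Z = D by move=> x; rewrite -{1}ZD => -[].
apply: conD; first by exists c.
  exists Z; last by rewrite /Z setIA setIid.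
  rewrite openE => x [Dx fx]; have [r r0 [rD rf]] := near0 x Dx fx.
  have : nbhs x (eball x r).
    by apply: open_nbhs_nbhs; split; [exact: open_eball|exact: eball_center].
  by apply: filterS => y yr; split; [exact: rD|exact: rf].
exists (~` (D `&` [set x | f x != 0])); last first.
  rewrite /Z; apply/seteqP; split => x [Dx /= fx]; split => //.
    by move=> [_]; rewrite /= fx eqxx.
  by apply: contrapT => /eqP fx0; apply: fx.
apply: open_closedC; rewrite openE => x [Dx /= fx].
have nD : nbhs x D by exact: open_nbhs_nbhs.
have nf : nbhs x (f @^-1` [set t | t != 0]).
  by apply: (cf x Dx); apply: open_nbhs_nbhs; split => //; exact: open_neq.
exact: filterI.
Qed.

End MeanValue.


(** * Weyl's lemma *)

Lemma iter_partial_local f g U s : open U -> (forall x, U x -> f x = g x) ->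
  forall x, U x -> iter_partial f s x = iter_partial g s x.
Proof.
move=> oU fg; elim: s => [|i s IH] x Ux; first exact: fg.
apply: near_eq_derive; have : nbhs x U by exact: open_nbhs_nbhs.
by apply: filterS => y /IH.
Qed.

Lemma Ck_local k f g U x s : open U -> (forall x, U x -> f x = g x) -> Ck k setT g ->
  U x -> (size s <= k)%N ->
  {for x, continuous (iter_partial f s)} /\
  ((size s < k)%N -> forall i, derivable (iter_partial f s) x (delta_mx 0 i)).
Proof.
move=> oU fg Cg Ux sk; have [cg dg] := Cg s x I sk.
have nU : nbhs x U by exact: open_nbhs_nbhs.
have fgs := iter_partial_local s oU fg.
split=> [|lt i].
  suff : iter_partial f s @ x --> iter_partial f s x by [].
  rewrite (fgs x Ux); apply: cvg_trans cg.
  apply: (@near_eq_cvg _ _ (nbhs x) (nbhs_filter x)).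
  by apply: filterS nU => y /fgs.
apply: (near_eq_derivable _ (dg lt i)).
by apply: filterS nU => y /fgs.
Qed.

Section ConvolutionSmooth.
Variables (B : set E) (f : E -> R).
Hypotheses (mB : mset B) (intf : integ B f).

Lemma cutoff_bounded psi : cutoff setT psi -> exists C : R, forall x, `|psi x| <= C.
Proof.
move=> [/elementary_continuous cpsi [K [cK _ f0]]].
exact: (continuous_compact_bounded cK cpsi f0).
Qed.

Lemma is_derive_conv_cutoff psi i x : cutoff setT psi ->
  is_derive x (delta_mx 0 i) (conv B f psi) (conv B f (partial psi i) x).
Proof.
move=> cpsi; have [C psiC] := cutoff_bounded cpsi.
have [C' dC] := cutoff_bounded (cutoff_partial i cpsi).
have cc := elementary_continuous cpsi.1.
have dd y : derivable psi y (delta_mx 0 i) by exact: elementary_derivable cpsi.1.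
exact: (is_derive_conv mB intf x cc psiC dd dC).
Qed.

Lemma iter_partial_conv psi s : cutoff setT psi ->
  iter_partial (conv B f psi) s = conv B f (iter_partial psi s) /\
  cutoff setT (iter_partial psi s).
Proof.
move=> cpsi; elim: s => [//|i s [IH1 IH2]] /=; split; last exact: cutoff_partial.
by rewrite IH1; apply/funext => x; have [_] := is_derive_conv_cutoff i x IH2.
Qed.

Lemma conv_Ck psi k : cutoff setT psi -> Ck k setT (conv B f psi).
Proof.
move=> cpsi s x _ _; have [-> cs] := iter_partial_conv s cpsi.
have [C psiC] := cutoff_bounded cs.
split; first exact: (conv_continuous mB intf (elementary_continuous cs.1) psiC).
by move=> _ i; have [] := is_derive_conv_cutoff i x cs.
Qed.

End ConvolutionSmooth.

Lemma lapZ (c : R) f x : elementary f -> lap (fun y => c * f y) x = c * lap f x.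
Proof.
move=> ef; rewrite /lap mulr_sumr; apply: eq_bigr => i _.
have -> : partial (fun y => c * f y) i = fun y => c * partial f i y.
  by apply/funext => y; rewrite partialZ.
by rewrite partialZ//; exact: elementary_partial.
Qed.

Lemma lap_ker_sym (sigma : R) c y : lap (ker sigma 0) (c - y) = lap (ker sigma c) y.
Proof.
rewrite /ker !lapZ; [|exact: rad_elementary..]; rewrite !lap_rad subr0.
by rewrite -[c - y]opprB sqnormN.
Qed.

Definition weakly_harmonic D f := forall phi, cutoff D phi ->
  \int[mu]_y (f (y : E) * lap phi y) = 0.

Section Weyl.
Variables (D : set E) (f : E -> R).
Hypotheses (oD : open D) (cf : forall x, D x -> {for x, continuous f}).
Hypothesis hf : weakly_harmonic D f.

(** Both f and - f are super-solutions. *)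
Lemma mean_value c (r sigma : R) : 0 < r -> eball c r `<=` D -> r^-1 < sigma ->
  average f sigma c = mass * f c.
Proof.
move=> r0 cD rs; have ri0 : 0 < r^-1 by rewrite invr_gt0.
have s0 : 0 < sigma by exact: lt_trans rs.
have ck : cutoff D (ker sigma c).
  apply: ker_cutoff => //; apply: subset_trans cD; apply: cball_sub_eball.
  by rewrite -[r]invrK ltf_pV2 ?posrE.
have sf : supersolution D f by move=> phi cphi _; rewrite hf.
have sNf : supersolution D (fun x => - 1 * f x).
  move=> phi cphi _; under eq_Rintegral do rewrite -mulrA.
  rewrite RintegralZl//; last exact: (integ_cutoffM oD cf (cutoff_lap cphi)).
  by rewrite hf// mulr0.
have cNf x : D x -> {for x, continuous (fun x => - 1 * f x)}.
  move=> Dx; apply: (@cvgM _ _ _ (nbhs_filter x)); last exact: cf.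
  exact: cst_continuous.
apply/eqP; rewrite eq_le (mean_value_le oD cf sf r0 cD rs) /=.
have := mean_value_le oD cNf sNf r0 cD rs.
rewrite /average; under eq_Rintegral do rewrite -mulrA.
rewrite RintegralZl//; last exact: (integ_cutoffM oD cf ck).
by rewrite !mulN1r mulrN lerN2.
Qed.

(** By the mean value property f is, near each point, its own convolution with a
    fixed smooth kernel; its Laplacian there is the integral of f against the
    Laplacian of the kernel, which is zero. *)
Lemma weyl : Defs.harmonic D f.
Proof.
have m0 := mass_gt0.
have main x0 : D x0 -> exists B psi U, [/\ mset B, integ B f, cutoff setT psi,
    [/\ open U, U x0 & forall x, U x -> f x = conv B f psi x] &
    conv B f (lap psi) x0 = 0].
  move=> Dx0; have [r r0 x0D] := open_eballP oD Dx0.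
  have ri0 : 0 < r^-1 by rewrite invr_gt0.
  pose s := 4 / r; have s0 : 0 < s by rewrite divr_gt0.
  have sE : s^-1 = r / 4 by rewrite invf_div.
  (* Large enough to contain the supports of the kernels of radius 1 / s = r / 4
     about all the points at distance less than r / 2 from x0. *)
  pose B : set E := cball x0 (3 * r / 4).
  have cB : compact B by exact: compact_cball.
  have BD : B `<=` D by apply: subset_trans x0D; apply: cball_sub_eball; lra.
  have intf := integ_on_compact oD cf cB BD.
  have mB := mset_compact cB.
  pose psi z := mass^-1 * ker s 0 z.
  have ck : cutoff setT (ker s 0) by exact: ker_cutoff.
  have near_B x y : eball x0 (r / 2) x -> cball x s^-1 y -> B y.
    rewrite /B /eball /cball /= sE => x0x xy.
    have -> : y - x0 = (y - x) + (x - x0) by rewrite addrA subrK.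
    by apply: (le_trans (ler_enormD _ _)); lra.
  have x0x0 : eball x0 (r / 2) x0 by apply: eball_center; rewrite divr_gt0.
  exists B, psi, (eball x0 (r / 2)); split => //.
  - exact: cutoffZ.
  - split; [exact: open_eball|exact: x0x0|move=> x x0x].
    have xD : eball x (r / 2) `<=` D.
      apply: subset_trans x0D => y; rewrite /eball /= => xy.
      have -> : y - x0 = (y - x) + (x - x0) by rewrite addrA subrK.
      apply: (le_lt_trans (ler_enormD _ _)).
      by move: x0x xy; rewrite /eball /=; lra.
    have r20 : 0 < r / 2 by rewrite divr_gt0.
    have rs : (r / 2)^-1 < s.
      by rewrite invf_div /s ltr_pM2r// ltr_nat.
    have mv := mean_value r20 xD rs.
    have -> : f x = mass^-1 * average f s x by rewrite mv mulKf// gt_eqF.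
    have off (y : E) : ~ B y -> f y * ker s x y = 0.
      move=> By; rewrite /ker rad_out ?mulr0//.
      by apply: contra_not By; exact: near_B.
    have ikB : integ B (fun y => f y * ker s x y).
      apply: (integrableS measurableT mB (@subsetT _ _)).
      apply: (integ_cutoffM oD cf); apply: ker_cutoff => //.
      by move=> y xy; apply: BD; exact: near_B xy.
    transitivity (mass^-1 * \int[mu]_(y in (B : set CT)) (f y * ker s x y)).
      by congr (_ * _); exact: esym (Rintegral_supp off).
    rewrite -(RintegralZl _ mB ikB).
    by apply: eq_Rintegral => y _; rewrite /psi kerE; ring.
  - have cx0 : cutoff D (ker s x0).
      by apply: ker_cutoff => // y xy; apply: BD; exact: near_B xy.
    have lk0 (y : E) : ~ B y -> f y * lap (ker s x0) y = 0.
      move=> By; rewrite (lap0 cB) ?mulr0// => z Bz.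
      rewrite /ker rad_out ?mulr0//.
      by apply: contra_not Bz; exact: near_B.
    have h0 : \int[mu]_(y in (B : set CT)) (f y * lap (ker s x0) y) = 0.
      exact: (eq_trans (Rintegral_supp lk0) (hf cx0)).
    have ikB : integ B (fun y => f y * lap (ker s x0) y).
      apply: (integrableS measurableT mB (@subsetT _ _)).
      exact: (integ_cutoffM oD cf (cutoff_lap cx0)).
    transitivity (mass^-1 * \int[mu]_(y in (B : set CT)) (f y * lap (ker s x0) y)); last first.
      by rewrite h0 mulr0.
    rewrite -(RintegralZl _ mB ikB).
    apply: eq_Rintegral => y _; rewrite /psi lapZ; last exact: ck.1.
    by rewrite lap_ker_sym; ring.
split=> [s x Dx sk|x Dx].
  have [B [psi [U [mB iB cpsi [oU Ux fU] _]]]] := main x Dx.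
  have C2 := @conv_Ck _ _ mB iB psi 2 cpsi.
  exact: (Ck_local oU fU C2 Ux sk).
have [B [psi [U [mB iB cpsi [oU Ux fU] l0]]]] := main x Dx.
have ip i : iter_partial f [:: i; i] x = conv B f (partial (partial psi i) i) x.
  rewrite (iter_partial_local _ oU fU)//.
  by have [-> _] := iter_partial_conv mB iB [:: i; i] cpsi.
rewrite (eq_bigr _ (fun i _ => ip i)) -[RHS]l0 /conv /lap.
under [RHS]eq_Rintegral do rewrite mulr_sumr.
have iF i : integ B (fun y => f y * partial (partial psi i) i (x - y)).
  have cpp := cutoff_partial i (cutoff_partial i cpsi).
  have [C pC] := cutoff_bounded cpp.
  exact: (integ_conv mB iB x (elementary_continuous cpp.1) pC).
by have [_ ->] := Rintegral_sum (index_enum 'I_n.+1) mB iF.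
Qed.

End Weyl.

(** * Components of a minimizer *)

(** The open set where h is negative would be a nonempty null set. *)
Lemma nonneg_everywhere Omega (h : E -> R) : open Omega ->
  (forall x, Omega x -> {for x, continuous h}) ->
  {ae mu, forall x : CT, Omega x -> 0 <= h x} -> forall x, Omega x -> 0 <= h x.
Proof.
move=> oO ch [N [mN N0 hN]] x Ox; rewrite leNgt; apply/negP => hx.
pose U : set E := interior (Omega `&` h @^-1` [set t | t < 0]).
have : (lebesgue_outer U <= 0)%E.
  rewrite -N0; apply: le_lebesgue_outer => y /interior_subset[Oy hy].
  apply: hN => /(_ Oy); apply/negP.
  by rewrite -ltNge.
apply/negP; rewrite -ltNge; apply: open_gt0; first exact: open_interior.
exists x; apply: filterI; first exact: open_nbhs_nbhs.
by apply: (ch x Ox); apply: open_nbhs_nbhs; split => //; exact: open_lt.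
Qed.

Section Minimizer.
Context {m : nat}.
Variables (Omega : set E) (Q : E -> R) (Qmin Qmax : R) (g u : E -> 'rV[R]_m).
Hypotheses (oO : open Omega) (bO : bounded_set Omega).
Hypothesis mQ : lmeasurable_fun Omega Q.
Hypothesis Qmin0 : 0 < Qmin.
Hypothesis QQ : {ae mu, forall x : CT, Omega x -> Qmin <= Q x <= Qmax}.
Hypothesis cu : forall x, Omega x -> {for x, continuous u}.
Hypothesis umin : local_minimizer Omega Q g u.
Implicit Types (j : 'I_m) (phi : E -> R).

Local Notation pos := (pos_set Omega u).

Let cuj x j : Omega x -> {for x, continuous (Defs.comp u j)}.
Proof. exact: (comp_cvg cu). Qed.

Lemma minimizer_ge0 j x : Omega x -> 0 <= Defs.comp u j x.
Proof.
apply: (nonneg_everywhere oO); first by move=> y Oy; exact: cuj.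
by have [[_ _ nn] _] := umin; exact: nn.
Qed.

Lemma pos_set_perturb j f : (forall x, ~ pos x -> f x = 0) ->
  (forall x, pos x -> Defs.comp u j x + f x = 0 -> Defs.comp u j x = 0) ->
  pos_set Omega (perturb u j f) = pos.
Proof.
move=> f0 fpos; apply/seteqP; split=> x [Ox].
  move=> /enorm_gt0P vx; apply: contrapT => nx; apply: vx.
  rewrite /perturb f0// scale0r addr0; apply: contrapT => /enorm_gt0P ux.
  exact: nx.
move=> ux; split => //; apply/enorm_gt0P => v0.
have v0i i : u x 0 i + f x * (i == j)%:R = 0.
  by have /rowP/(_ i) := v0; rewrite /perturb !mxE eqxx.
have uj : u x 0 j = 0.
  by apply: fpos => //; rewrite -[RHS](v0i j) eqxx mulr1.
move/enorm_gt0P: ux; apply; apply/rowP => i; rewrite mxE.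
have [->//|ij] := eqVneq i j.
by rewrite -[RHS](v0i i) (negbTE ij) mulr0 addr0.
Qed.

(** The remaining derivative of u_j is moved to the cut-off, which changes the
    sign. *)
Lemma first_variation_lap j phi (t0 : R) : cutoff pos phi -> 0 < t0 ->
  (forall t, 0 < t < t0 -> forall x, pos x ->
     0 <= Defs.comp u j x + t * phi x /\
     (Defs.comp u j x + t * phi x = 0 -> Defs.comp u j x = 0)) ->
  \int[mu]_y (Defs.comp u j (y : E) * lap phi y) <= 0.
Proof.
move=> cphi t00 ht; have mO := open_lmeasurable oO.
have posO : pos `<=` Omega by move=> x [].
have cO := cutoff_subset posO cphi.
have phi0 x : ~ pos x -> phi x = 0.
  by have [_ [K [_ Kp f0]]] := cphi => px; apply: f0 => /Kp.
have Hj : H1 Omega (Defs.comp u j) by have [[H _ _] _] := umin; exact: H.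
have := @first_variation _ Omega Q Qmin Qmax g u oO bO mQ Qmin0 QQ cu umin
  j phi t0 cO t00.
have pert t : 0 < t < t0 -> nonneg_ae Omega (perturb u j (fun x => t * phi x)) /\
    pos_set Omega (perturb u j (fun x => t * phi x)) = pos.
  move=> tt; split.
    move=> i; apply: aeW => x Ox; rewrite -[X in 0 <= X]/(Defs.comp _ i x).
    rewrite comp_perturb; case: eqP => [->|_]; last exact: minimizer_ge0.
    have [px|px] := pselect (pos x); first by have [] := ht t tt x px.
    by rewrite phi0// mulr0 addr0; exact: minimizer_ge0.
  apply: pos_set_perturb => x px; first by rewrite phi0// mulr0.
  by have [] := ht t tt x px.
move=> /(_ pert) B0.
have iD k : integ Omega (fun x => weak_D Omega (Defs.comp u j) k x * partial phi k x).
  apply: L2M => //; first by have [] := weak_D_spec k Hj.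
  by apply: L2_cutoff => //; exact: cutoff_partial.
have iu : integ Omega (Defs.comp u j) by apply: (L2_L1 oO bO); exact: Hj.1.
have iul k : integ Omega (fun x => Defs.comp u j x * partial (partial phi k) k x).
  by have [_ H] := test_integ oO iu (cutoff_test (cutoff_partial k cO)); exact: H.
have off x : ~ Omega x -> Defs.comp u j x * lap phi x = 0.
  have [_ [K [cK Kp f0]]] := cutoff_lap cO => Ox.
  by rewrite f0 ?mulr0// => /Kp.
rewrite -(Rintegral_supp off) /lap.
under eq_Rintegral do rewrite mulr_sumr.
have [_ ->] := Rintegral_sum (index_enum 'I_n.+1) mO iul.
move: B0; have [_ ->] := Rintegral_sum (index_enum 'I_n.+1) mO iD.
rewrite -oppr_le0 -sumrN => B0; apply: le_trans B0.
apply: ler_sum => k _; rewrite le_eqVlt; apply/orP; left; apply/eqP.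
have [_ wk] := weak_D_spec k Hj.
exact: (wk _ (cutoff_test (cutoff_partial k cO))).
Qed.

(** Increasing a component keeps it nonnegative, and |u| is positive on the support
    of phi already. *)
Lemma minimizer_supersolution j D : D `<=` pos -> supersolution D (Defs.comp u j).
Proof.
move=> Dp phi cphi phi0.
apply: (@first_variation_lap j phi 1) => //; first exact: cutoff_subset cphi.
move=> t /andP[t0 _] x [Ox _]; have u0 := minimizer_ge0 j Ox.
have tp : 0 <= t * phi x by rewrite mulr_ge0// ltW.
split; first exact: addr_ge0.
by move=> /eqP; rewrite paddr_eq0// => /andP[/eqP].
Qed.

(** The function u_j is bounded away from zero on the support of phi, so that
    adding t phi and subtracting it are both allowed for small t. *)
Lemma minimizer_weakly_harmonic j D : D `<=` pos ->
  (forall x, D x -> 0 < Defs.comp u j x) -> weakly_harmonic D (Defs.comp u j).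
Proof.
move=> Dp u0.
have H phi : cutoff D phi -> \int[mu]_y (Defs.comp u j (y : E) * lap phi y) <= 0.
  move=> cphi; have [ephi [K [cK KD f0]]] := cphi.
  have [C pC] := continuous_compact_bounded cK (elementary_continuous ephi) f0.
  have C0 : 0 <= C by exact: le_trans (pC 0).
  have [d d0 dK] : exists2 d : R, 0 < d & forall x, K x -> d <= Defs.comp u j x.
    have [[x Kx]|K0] := pselect (K !=set0); last first.
      by exists 1 => // x Kx; case: K0; exists x.
    have cK' : {within K, continuous (Defs.comp u j)}.
      apply: continuous_in_subspaceT => y; rewrite inE => /KD /Dp[Oy _].
      exact: cuj.
    have K0 : K !=set0 by exists x.
    have [c Kc cmin] := compact_EVT_min K0 cK cK'.
    exists (Defs.comp u j c); last by move=> y Ky; apply: cmin; rewrite inE.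
    by apply: u0; apply: KD; rewrite inE in Kc.
  apply: (@first_variation_lap j phi (d / (C + 1))).
  - exact: cutoff_subset cphi.
  - by rewrite divr_gt0// ltr_wpDl.
  - move=> t /andP[t0 td] x [Ox ux].
    have C1 : 0 < C + 1 by rewrite ltr_wpDl.
    have [Kx|/f0 ->] := pselect (K x); last first.
      by rewrite mulr0 addr0; split => //; exact: minimizer_ge0.
    have : 0 < Defs.comp u j x + t * phi x.
      have := dK x Kx; have := pC x; rewrite ler_norml => /andP[p1 p2] dx.
      have : t * (C + 1) < d by rewrite -ltr_pdivlMr.
      have : t * - C <= t * phi x by rewrite ler_wpM2l// ltW.
      by rewrite mulrN mulrDr; lra.
    by move=> lt; split; [exact: ltW|move=> e; rewrite e ltxx in lt].
move=> phi cphi; apply/eqP; rewrite eq_le H//=.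
have clap : cutoff pos (lap phi) by exact: cutoff_lap (cutoff_subset Dp cphi).
have cup x : pos x -> {for x, continuous (Defs.comp u j)} by move=> [Ox _]; exact: cuj.
have ilap := integ_cutoffM (open_pos oO cu) cup clap.
have e : \int[mu]_y (Defs.comp u j (y : E) * lap (fun x => -1 * phi x) y) =
    -1 * \int[mu]_y (Defs.comp u j (y : E) * lap phi y).
  rewrite -(RintegralZl (-1) measurableT ilap); apply: eq_Rintegral => y _.
  by rewrite lapZ; [ring|exact: cphi.1].
have h1 := H _ (cutoffZ (-1) cphi).
rewrite e in h1.
move: h1.
move: (Rintegral _ _ _) => I.
by rewrite mulN1r oppr_le0.
Qed.

Lemma minimizer_dichotomy j D : open D -> connected D -> D `<=` pos ->
  positive_harmonic D (Defs.comp u j) \/ forall x, D x -> Defs.comp u j x = 0.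
Proof.
move=> oD cD Dp.
have cj x : D x -> {for x, continuous (Defs.comp u j)} by move=> /Dp[Ox _]; exact: cuj.
have [] := strong_minimum oD cD cj (@minimizer_supersolution j D Dp).
- by move=> x /Dp[Ox _]; exact: minimizer_ge0.
- by move=> u0; left; split => //; apply: weyl => //; exact: minimizer_weakly_harmonic.
- by right.
Qed.

End Minimizer.
End Integration.

(** * The Hoelder estimate *)

Theorem lemma15 (R : realType) (n m : nat) (Omega : set 'rV[R]_n.+1)
    (Q : 'rV[R]_n.+1 -> R) (Qmin Qmax : R) (g u : 'rV[R]_n.+1 -> 'rV[R]_m) :
  (0 < m)%N ->
  domain Omega -> bounded_set Omega ->
  lmeasurable_fun Omega Q -> 0 < Qmin ->
  (\forall x \ae @lebesgue R n, Omega x -> Qmin <= Q x <= Qmax) ->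
  H1_vec Omega g -> nonneg_ae Omega g ->
  absolute_minimizer Omega Q g u \/ local_minimizer Omega Q g u ->
  (forall x, Omega x -> {for x, continuous u}) ->
  (* the threshold for r0 depends on u only, and is void if u is absolute *)
  exists2 rho : R, 0 < rho &
  forall (x0 : 'rV[R]_n.+1) (r0 : R),
  0 < r0 -> absolute_minimizer Omega Q g u \/ r0 < rho ->
  eball x0 r0 `<=` Omega -> boundary (pos_set Omega u) x0 ->
  forall te1 e1 M c : R, 0 < te1 -> te1 < e1 -> e1 < 1 ->
  let D1 := eball x0 (e1 * r0) `&` pos_set Omega u in
  nta D1 M (te1 * r0) c ->
  forall a : R -> 'rV[R]_n.+1 -> 'rV[R]_n.+1,
  corkscrew_points D1 M (te1 * r0) a ->
  forall lambda c1 c2 C3 C4 : R,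
  comparison_constants D1 (te1 * r0) a lambda c1 c2 C3 C4 ->
  let r1 := Num.min (1 / 2 * c1 * te1) (e1 / (2 * C3)) * r0 in
  let e2 := c2 * r1 / (e1 * r0) in
  let C5 := (c2 / (e2 * e1)) `^ lambda * C4 in
  forall j : 'I_m, (forall x, D1 x -> 0 < u x 0 j) ->
  (holder_seminorm lambda (eball x0 (e2 * e1 * r0) `&` pos_set Omega u)
      (fun x => (u x 0 j / enorm (u x))%R) <=
    (C5 / r0 `^ lambda *
      Num.sqrt (\sum_(i < m | i != j)
        (u (a r1 x0) 0 i / u (a r1 x0) 0 j) ^+ 2))%:E)%E.
Proof.
move=> m0 [oO _ _] bO mQ Qmin0 QQ _ _ umin0 cu.
have umin : local_minimizer Omega Q g u.
  case: umin0 => // -[au um]; split => //; exists 1 => // v av _.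
  exact: um.
(* Any threshold will do: the maps that u is compared with can be taken as close
   to u as desired, whatever the ball. *)
exists 1 => // x0 r0 r00 _ BO bx0 te1 e1 M c te10 te1e1 e11 D1 ntaD a cork.
move=> lambda c1 c2 C3 C4 [[lam01 c101 c201 C31 C40] cmp] r1 e2 C5 j uj0.
have [[[oD cD _] _ _ _ _] _ _ _] := ntaD.
have [lam0 _] := andP lam01; have [c10 c11] := andP c101.
have [c20 c21] := andP c201.
have e10 : 0 < e1 by exact: lt_trans te1e1.
have C30 : 0 < C3 by exact: lt_trans C31.
have r10 : 0 < r1.
  by rewrite mulr_gt0// lt_min !mulr_gt0//= ?invr_gt0 ?mulr_gt0.
have r1c : r1 < c1 * (te1 * r0).
  rewrite mulrA ltr_pM2r//.
  apply: (@le_lt_trans _ _ (1 / 2 * c1 * te1)); first by rewrite ge_min lexx.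
  have : 0 < c1 * te1 by exact: mulr_gt0.
  by rewrite -mulrA; lra.
have r1t : r1 < te1 * r0.
  apply: (lt_trans r1c); rewrite gtr_pMl//; exact: mulr_gt0.
have C3r1 : C3 * r1 <= e1 * r0 / 2.
  have : r1 <= e1 / (2 * C3) * r0 by rewrite ler_pM2r// ge_min lexx orbT.
  rewrite -(ler_pM2l C30) => /le_trans -> //.
  by rewrite le_eqVlt; apply/orP; left; apply/eqP; field; rewrite gt_eqF.
have e1r0 : 0 < e1 * r0 by exact: mulr_gt0.
have c2r1 : c2 * r1 <= e1 * r0.
  apply: (le_trans _ (le_trans C3r1 _)); last by lra.
  by rewrite ler_pM2r//; lra.
have B1O : eball x0 (e1 * r0) `<=` Omega.
  apply: subset_trans BO; apply: subset_eball; rewrite ger_pMl//; exact: ltW.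
have Dp : D1 `<=` pos_set Omega u by move=> y [].
have bD : boundary D1 x0.
  case: bx0 => clx nix; split.
    move=> B Bx; have [] := clx (B `&` eball x0 (e1 * r0)).
      apply: filterI => //; apply: open_nbhs_nbhs; split; first exact: open_eball.
      exact: eball_center.
    by move=> y [py [By ey]]; exists y.
  by move=> ix; apply: nix; apply: filterS ix.
have r101 : 0 < r1 < te1 * r0 by rewrite r10.
have [Da _ _] := cork x0 r1 bD r101.
have e2E : e2 * e1 * r0 = c2 * r1.
  by rewrite /e2; field; rewrite !gt_eqF.
have setE : eball x0 (e2 * e1 * r0) `&` pos_set Omega u =
    eball x0 (c2 * r1) `&` D1.
  rewrite e2E; apply/seteqP; split => [y [By py]|y [By [_ py]]]; last by split.
  by split => //; split => //; exact: (subset_eball c2r1).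
have constE : C5 / r0 `^ lambda = C4 / r1 `^ lambda.
  have -> : C5 = (r0 / r1) `^ lambda * C4.
    rewrite /C5; congr (_ `^ _ * _); rewrite /e2; field.
    by rewrite !gt_eqF.
  have -> : r0 `^ lambda = (r0 / r1) `^ lambda * r1 `^ lambda.
    by rewrite -powRM ?divr_ge0 ?ltW// divfK ?gt_eqF.
  by field; rewrite !gt_eqF ?powR_gt0 ?divr_gt0.
rewrite setE constE.
have van i : vanishes_continuously D1 (eball x0 (C3 * r1) `&` boundary D1)
    (Defs.comp u i).
  move=> z [Bz [_ nz]].
  have Bz1 : eball x0 (e1 * r0) z by apply: (subset_eball _ Bz); lra.
  have Oz := B1O _ Bz1.
  have uz : u z = 0.
    apply: contrapT => /enorm_gt0P uz; apply: nz.
    by apply: open_nbhs_nbhs; split.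
  have -> : 0 = Defs.comp u i z by rewrite /Defs.comp uz mxE.
  apply: cvg_within_filter.
  exact: (comp_cvg cu).
have dich i := minimizer_dichotomy oO bO mQ Qmin0 QQ cu umin i oD cD Dp.
have phj : positive_harmonic D1 (Defs.comp u j).
  case: (dich j) => // uj; have := uj0 _ Da.
  by rewrite -[u _ 0 j]/(Defs.comp u j _) uj ?ltxx.
pose ratio i y := u y 0 i / u y 0 j.
pose B := eball x0 (c2 * r1) `&` D1.
pose K := C4 / r1 `^ lambda.
have K0 : 0 < K by rewrite divr_gt0// powR_gt0.
have ratio_holder i y z : B y -> B z -> y != z ->
    `|ratio i y - ratio i z| <= K * ratio i (a r1 x0) * enorm (y - z) `^ lambda.
  move=> By Bz yz; case: (dich i) => [phi|ui]; last first.
    have ui' w : D1 w -> u w 0 i = 0 by exact: ui.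
    by rewrite /ratio !ui' ?By.2 ?Bz.2//; [rewrite !mul0r subrr normr0 mulr0 mul0r | exact: Bz.2 | exact: By.2].
  have r1c' : 0 < r1 < c1 * (te1 * r0) by rewrite r10.
  have [_ hs] := cmp r1 x0 _ _ r1c' bD phj phi (van j) (van i).
  rewrite -ler_pdivrMr; last first.
    rewrite powR_gt0//; apply/enorm_gt0P => /eqP.
    by rewrite subr_eq0 (negbTE yz).
  rewrite -lee_fin; apply: (le_trans _ hs).
  by apply: ereal_sup_ubound; exists (y, z).
have quotE y : D1 y ->
    u y 0 j / enorm (u y) = (Num.sqrt (1 + \sum_(i < m | i != j) ratio i y ^+ 2))^-1.
  move=> Dy; have ujy := uj0 _ Dy.
  have -> : enorm (u y) =
      u y 0 j * Num.sqrt (1 + \sum_(i < m | i != j) ratio i y ^+ 2).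
    rewrite /enorm -{1}(ger0_norm (ltW ujy)) -sqrtr_sqr -sqrtrM ?sqr_ge0//.
    congr Num.sqrt; rewrite mulrDr mulr1 (bigD1 j)//=; congr (_ + _).
    rewrite mulr_sumr; apply: eq_bigr => i _.
    by rewrite /ratio; field; rewrite gt_eqF.
  by rewrite invfM mulrA divff ?mul1r// gt_eqF.
apply: ge_ereal_sup => _ [[y z]/= [By Bz yz] <-].
rewrite lee_fin ler_pdivrMr; last first.
  rewrite powR_gt0//; apply/enorm_gt0P => /eqP.
  by rewrite subr_eq0 (negbTE yz).
rewrite (quotE y By.2) (quotE z Bz.2).
apply: (le_trans (lipschitz_inv_sqrt _ _ _)).
pose k := K * enorm (y - z) `^ lambda.
have k0 : 0 <= k by rewrite mulr_ge0 ?powR_ge0// ltW.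
have -> : C4 / r1 `^ lambda * Num.sqrt (\sum_(i < m | i != j) ratio i (a r1 x0) ^+ 2)
    * enorm (y - z) `^ lambda =
    Num.sqrt (\sum_(i < m | i != j) (k * ratio i (a r1 x0)) ^+ 2).
  under [in RHS]eq_bigr do rewrite exprMn.
  by rewrite -mulr_sumr sqrtrM ?sqr_ge0// sqrtr_sqr ger0_norm// /k /K mulrAC.
rewrite ler_wsqrtr//; apply: ler_sum => i _.
have le_i : `|ratio i y - ratio i z| <= k * ratio i (a r1 x0).
  by rewrite /k mulrAC; exact: ratio_holder.
rewrite -[leLHS]real_normK ?num_real// ler_sqr// nnegrE//.
exact: le_trans le_i.
Qed.
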